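(* Let $V$ be a vertex operator algebra over $\mathbb{F}$ and $n\ge0$. The assignment $M\mapsto M(n)$ induces a bijection between isomorphism classes of irreducible $V$-modules $M=\bigoplus_{m\ge0}M(m)$ with $M(0)\ne0$ and $M(n)\neq 0$, and isomorphism classes of simple $A_n(V)$-modules which do not factor through $A_{n-1}(V)$. The inverse sends such a simple $A_n(V)$-module $U$ to an irreducible $V$-module $L_n(U)$ with $L_n(U)(0)\neq 0$ and $L_n(U)(n)\cong U$.
   Context: Standing assumptions: $\mathbb{F}$ is an algebraically closed field with $\mathrm{char}\,\mathbb{F}\neq 2$. $V$ is a vertex operator algebra over $\mathbb{F}$ ($\mathbb{Z}$-graded vertex algebra $V=\bigoplus_kV_k$ with finite-dimensional graded pieces, $V_k=0$ for $k\ll0$, Virasoro vector $\omega\in V_2$ with modes $L(k)$, $u_kv\in V_{s+t-k-1}$ for $u\in V_s,v\in V_t$, Virasoro relations, $\frac{d}{dz}Y(v,z)=Y(L(-1)v,z)$, $L(0)|_{V_k}=k$). $\deg a=s$ for $a\in V_s$; $(1+z)^k=\sum_{i\ge0}\binom ki z^i$. For $n\ge0$: $O_n(V)$ is the span of all $L(-1)a+L(0)a$ and all $a\circ^s_{n,t}b=\mathrm{Res}_z\,Y(a,z)b\,\frac{(1+z)^{\deg a+n+s}}{z^{2n+2+t}}$ ($a$ homogeneous, $0\le s\le t$); $A_n(V)=V/O_n(V)$, associative with product induced by $a*_nb=\sum_{j=0}^n(-1)^j\binom{j+n}{n}\mathrm{Res}_z\,Y(a,z)b\frac{(1+z)^{\deg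 a+n}}{z^{n+j+1}}$; $A_{n-1}(V)$ is a quotient of $A_n(V)$ (as $O_n(V)\subseteq O_{n-1}(V)$), and a module factors through $A_{n-1}(V)$ if $O_{n-1}(V)$ acts as zero ($A_{-1}(V):=0$). A $V$-module is a weak $V$-module $M$ (vertex operators $Y_M(v,z)=\sum v_kz^{-k-1}$, $u_lw=0$ for $l\gg0$, $Y_M(\mathbf 1,z)=\mathrm{id}$, Jacobi identity) with grading $M=\bigoplus_{m\ge0}M(m)$, $v_kM(m)\subseteq M(m+\deg v-k-1)$. $M(n)$ is an $A_n(V)$-module with $[a]$ acting by $o(a)=a_{\deg a-1}$. *)

(* Defs.v *)
From HB Require Import structures.
From mathcomp Require Import all_boot all_order all_algebra.
Set Implicit Arguments. Unset Strict Implicit. Unset Printing Implicit Defensive.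
Import Order.TTheory GRing.Theory Num.Theory.
Local Open Scope ring_scope.

(* generalized binomial coefficient  binom(p, i)  for p : int, i : nat,
   so that (1+z)^p = sum_i binz p i z^i :
   binom(m,i) for p = m >= 0, and (-1)^i binom(m+i,i) for p = -(m+1). *)
Definition binz (p : int) (i : nat) : int :=
  match p with
  | Posz m => ('C(m, i))%:Z
  | Negz m => (-1) ^+ i * ('C(m + i, i))%:Z
  end.

Definition sgnz (r : int) : int := (-1) ^+ (absz r).

Section Generic.
Variable F : fieldType.

(* X = (+)_{k in I} X_k, given by the projections gr k onto X_k together with
   a (chosen) finite list containing the support of each vector. *)
Definition grading (I : eqType) (X : lmodType F) (gr : I -> X -> X)
    (supp : X -> seq I) : Prop :=
  (forall k (c : F) x y, gr k (c *: x + y) = c *: gr k x + gr k y) /\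
  (forall k l x, gr k (gr l x) = if k == l then gr k x else 0) /\
  (forall x, uniq (supp x)) /\
  (forall x k, k \notin supp x -> gr k x = 0) /\
  (forall x, x = \sum_(k <- supp x) gr k x).

(* act k a x  stands for  a_k x  (Y(a,z) x = sum_k a_k x z^{-k-1}) *)
Definition bilinear_act (A X : lmodType F) (act : int -> A -> X -> X) : Prop :=
  (forall k (c : F) a b x, act k (c *: a + b) x = c *: act k a x + act k b x) /\
  (forall k (c : F) a x y, act k a (c *: x + y) = c *: act k a x + act k a y).

Definition truncated (A X : lmodType F) (act : int -> A -> X -> X) : Prop :=
  forall a x, exists N : int, forall k : int, N <= k -> act k a x = 0.

(* Jacobi identity, written in components (Borcherds identity): for all
   p q r in Z, u v in V, w in X,
   sum_{i>=0} binom(p,i) (u_r+i v)_{p+q-i} w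
     = sum_{i>=0} (-1)^i binom(r,i) ( u_{p+r-i} v_{q+i} w
                                     - (-1)^r v_{q+r-i} u_{p+i} w ),
   the sums being finite: they are truncated at any N beyond which all
   terms vanish. *)
Definition borcherds (A X : lmodType F) (modeA : int -> A -> A -> A)
    (act : int -> A -> X -> X) : Prop :=
  forall (p q r : int) (u v : A) (w : X) (N : nat),
    (forall i : nat, (N <= i)%N ->
       [/\ modeA (r + i%:Z) u v = 0, act (q + i%:Z) v w = 0
         & act (p + i%:Z) u w = 0]) ->
    \sum_(i < N) act (p + q - (i : nat)%:Z) (modeA (r + (i : nat)%:Z) u v) w *~ binz p i =
    \sum_(i < N)
        (act (p + r - (i : nat)%:Z) u (act (q + (i : nat)%:Z) v w)
         - act (q + r - (i : nat)%:Z) v (act (p + (i : nat)%:Z) u w) *~ sgnz r)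
        *~ ((-1) ^+ i * binz r i).

End Generic.

(* Vertex operator algebra over F: mode k u v = u_k v, gr k = projection onto
   V_k, vac = 1, omega = Virasoro vector, cc = central charge,
   L(m) = omega_{m+1}. *)
Record VOA (F : fieldType) := {
  vs :> lmodType F;
  mode : int -> vs -> vs -> vs;
  gr : int -> vs -> vs;
  supp : vs -> seq int;
  vac : vs;
  omega : vs;
  cc : F;
  mode_bilin : bilinear_act mode;
  mode_trunc : truncated mode;
  grading_ax : grading gr supp;
  fin_dim : forall k : int, exists (m : nat) (b : 'I_m -> vs),
      (forall i, gr k (b i) = b i) /\
      (forall v, gr k v = v -> exists c : 'I_m -> F, v = \sum_i c i *: b i);
  lower_bd : exists N : int, forall (k : int) v, k < N -> gr k v = 0;
  vac_deg : gr 0 vac = vac;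
  vac_id : forall k v, mode k vac v = if k == -1 then v else 0;
  creation : forall v, mode (-1) v vac = v /\ (forall k : int, 0 <= k -> mode k v vac = 0);
  jacobi : borcherds mode mode;
  mode_deg : forall (s t k : int) u v, gr s u = u -> gr t v = v ->
      gr (s + t - k - 1) (mode k u v) = mode k u v;
  omega_deg : gr 2 omega = omega;
  (* [L(m),L(l)] = (m-l) L(m+l) + (m^3-m)/12 delta_{m+l,0} c,
     written as ((m^3-m)/6) * (c/2) since (m^3-m)/6 is an integer *)
  virasoro : forall (m l : int) v,
      mode (m + 1) omega (mode (l + 1) omega v) - mode (l + 1) omega (mode (m + 1) omega v)
      = mode (m + l + 1) omega v *~ (m - l)
        + (if m + l == 0 then ((((m ^+ 3 - m) %/ 6)%Z)%:~R * cc / 2%:R) *: v else 0);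
  (* d/dz Y(v,z) = Y(L(-1)v,z) *)
  L_deriv : forall (k : int) v w, mode k (mode 0 omega v) w = - (mode (k - 1) v w *~ k);
  L0_deg : forall (k : int) v, gr k v = v -> mode 1 omega v = v *~ k
}.

Arguments mode {F} v0 _ _ _.
Arguments gr {F} v0 _ _.
Arguments supp {F} v0 _.
Arguments vac {F} v0.
Arguments omega {F} v0.
Arguments cc {F} v0.

(* V-module: weak module with an N-grading M = (+)_{m>=0} M(m),
   v_k M(m) subset M(m + deg v - k - 1) (and M(j) = 0 for j < 0). *)
Record VMod (F : fieldType) (V : VOA F) := {
  mv :> lmodType F;
  mact : int -> vs V -> mv -> mv;
  mgr : nat -> mv -> mv;
  msupp : mv -> seq nat;
  mact_bilin : bilinear_act mact;
  mact_trunc : truncated mact;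
  mact_vac : forall k w, mact k (vac V) w = if k == -1 then w else 0;
  mjacobi : borcherds (mode V) mact;
  mgrading : grading mgr msupp;
  mact_deg : forall (s : int) (m : nat) (k : int) u w, gr V s u = u -> mgr m w = w ->
      let d := s + m%:Z - k - 1 in
      (d < 0 -> mact k u w = 0) /\ (0 <= d -> mgr (absz d) (mact k u w) = mact k u w)
}.

Arguments mact {F V} v _ _ _.
Arguments mgr {F V} v _ _.
Arguments msupp {F V} v _.

Local Unset Implicit Arguments.
Section Zhu.
Variable F : fieldType.
Variable V : VOA F.

Definition homog (k : int) (v : vs V) : Prop := gr V k v = v.
Definition Lm (m : int) (v : vs V) : vs V := mode V (m + 1) (omega V) v.

(* a o^s_{n,t} b = Res_z Y(a,z) b (1+z)^{deg a + n + s} / z^{2n+2+t}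
   = sum_{i>=0} binom(deg a + n + s, i) a_{i-2n-2-t} b, truncated at N *)
Definition circN (n : nat) (k : int) (s t N : nat) (a b : vs V) : vs V :=
  \sum_(i < N) mode V ((i : nat)%:Z - (2 * n + 2 + t)%N%:Z) a b *~ binz (k + n%:Z + s%:Z) i.
Definition circ_tail (n t N : nat) (a b : vs V) : Prop :=
  forall i : nat, (N <= i)%N -> mode V (i%:Z - (2 * n + 2 + t)%N%:Z) a b = 0.

Inductive inO (n : nat) : vs V -> Prop :=
| inO_L : forall x, inO n (Lm (-1) x + Lm 0 x)
| inO_circ : forall (k : int) (s t N : nat) a b, homog k a -> (s <= t)%N ->
    circ_tail n t N a b -> inO n (circN n k s t N a b)
| inO_zero : inO n 0
| inO_lin : forall (c : F) x y, inO n x -> inO n y -> inO n (c *: x + y).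

(* O_{n-1}(V), with O_{-1}(V) = V (so that A_{-1}(V) = 0) *)
Definition inOprev (n : nat) (a : vs V) : Prop :=
  if n is n'.+1 then inO n' a else True.

(* a *_n b = sum_{j=0}^n (-1)^j binom(j+n,n)
               Res_z Y(a,z) b (1+z)^{deg a + n} / z^{n+j+1}
           = sum_j (-1)^j binom(j+n,n) sum_{i>=0} binom(deg a+n,i) a_{i-n-j-1} b *)
Definition starN (n : nat) (k : int) (N : nat) (a b : vs V) : vs V :=
  \sum_(j < n.+1)
     (\sum_(i < N)
        mode V ((i : nat)%:Z - n%:Z - (j : nat)%:Z - 1) a b *~ binz (k + n%:Z) i)
     *~ ((-1) ^+ j * ('C(j + n, n))%:Z).
Definition star_tail (n N : nat) (a b : vs V) : Prop :=
  forall i j : nat, (N <= i)%N -> (j <= n)%N ->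
    mode V (i%:Z - n%:Z - j%:Z - 1) a b = 0.

(* An A_n(V)-module structure on the subspace W of X, where rho a is the
   action of the class [a] in A_n(V) = V / O_n(V): rho is linear, kills
   O_n(V), turns *_n into composition and [1] into the identity. *)
Definition AnModOn (n : nat) (X : lmodType F) (W : X -> Prop)
    (rho : vs V -> X -> X) : Prop :=
  [/\ W 0, (forall (c : F) x y, W x -> W y -> W (c *: x + y)),
      (forall a x, W x -> W (rho a x)),
      (forall (c : F) a b x, W x -> rho (c *: a + b) x = c *: rho a x + rho b x)
    & (forall (c : F) a x y, W x -> W y -> rho a (c *: x + y) = c *: rho a x + rho a y)]
  /\
  [/\ (forall a, inO n a -> forall x, W x -> rho a x = 0),
      (forall (k : int) (N : nat) a b, homog k a -> star_tail n N a b ->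
          forall x, W x -> rho (starN n k N a b) x = rho a (rho b x))
    & (forall x, W x -> rho (vac V) x = x)].

Definition AnSimple (X : lmodType F) (W : X -> Prop) (rho : vs V -> X -> X) : Prop :=
  (exists x, W x /\ x <> 0) /\
  forall S : X -> Prop,
    (forall x, S x -> W x) -> S 0 ->
    (forall (c : F) x y, S x -> S y -> S (c *: x + y)) ->
    (forall a x, S x -> S (rho a x)) ->
    (forall x, S x -> x = 0) \/ (forall x, W x -> S x).

Definition AnFactorsPrev (n : nat) (X : lmodType F) (W : X -> Prop)
    (rho : vs V -> X -> X) : Prop :=
  forall a, inOprev n a -> forall x, W x -> rho a x = 0.

Definition AnIso (X : lmodType F) (W : X -> Prop) (rho : vs V -> X -> X)
    (X' : lmodType F) (W' : X' -> Prop) (rho' : vs V -> X' -> X') : Prop :=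
  exists f : X -> X',
    [/\ (forall (c : F) x y, W x -> W y -> f (c *: x + y) = c *: f x + f y),
        (forall x, W x -> W' (f x)),
        (forall x y, W x -> W y -> f x = f y -> x = y),
        (forall y, W' y -> exists2 x, W x & f x = y)
      & (forall a x, W x -> f (rho a x) = rho' a (f x))].

Definition Mpart (M : VMod V) (m : nat) : mv M -> Prop := fun w => mgr M m w = w.

(* o(a) = a_{deg a - 1} on homogeneous a, extended linearly *)
Definition oact (M : VMod V) (a : vs V) (w : mv M) : mv M :=
  \sum_(k <- supp V a) mact M (k - 1) (gr V k a) w.

Definition Mnonzero (M : VMod V) (m : nat) : Prop :=
  exists w, Mpart M m w /\ w <> 0.

Definition VSubmod (M : VMod V) (S : mv M -> Prop) : Prop :=
  [/\ S 0, (forall (c : F) x y, S x -> S y -> S (c *: x + y)),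
      (forall k u x, S x -> S (mact M k u x))
    & (forall m x, S x -> S (mgr M m x))].

Definition VIrred (M : VMod V) : Prop :=
  (exists w : mv M, w <> 0) /\
  forall S, VSubmod M S -> (forall x, S x -> x = 0) \/ (forall x, S x).

Definition VIso (M M' : VMod V) : Prop :=
  exists f : mv M -> mv M',
    [/\ (forall (c : F) x y, f (c *: x + y) = c *: f x + f y),
        injective f, (forall y, exists x, f x = y),
        (forall k u x, f (mact M k u x) = mact M' k u (f x))
      & (forall m x, f (mgr M m x) = mgr M' m (f x))].

End Zhu.

Arguments homog {F V}.
Arguments Lm {F V}.
Arguments circN {F V}.
Arguments circ_tail {F V}.
Arguments inO {F V}.
Arguments inOprev {F V}.
Arguments starN {F V}.
Arguments star_tail {F V}.
Arguments AnModOn {F V} n {X}.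
Arguments AnSimple {F V X}.
Arguments AnFactorsPrev {F V} n {X}.
Arguments AnIso {F V X} W rho {X'}.
Arguments Mpart {F V}.
Arguments oact {F V}.
Arguments Mnonzero {F V}.
Arguments VSubmod {F V}.
Arguments VIrred {F V}.
Arguments VIso {F V}.

(* Main.v *)
Require Import Defs.
From HB Require Import structures.
From mathcomp Require Import all_boot all_order all_algebra.
From mathcomp Require Import boolp functions zify.
Set Implicit Arguments. Unset Strict Implicit. Unset Printing Implicit Defensive.
Import Order.TTheory GRing.Theory Num.Theory.
Local Open Scope ring_scope.

(* Write Y_M for the vertex operators of a module M and o(a) for the degree
   preserving mode of a.

   From modules to algebras: a vector w of M(n) is killed by a_l for l >= deg a + n, so
   Borcherds' identity expresses o(Res_t (1+t)^l t^k Y(a,t) b) w, for l >= deg a + n, as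
   a sum of terms a_p b_q w that is finite with explicit binomial coefficients.  This
   gives the action of A_n(V), and it shows that every product
   a_(deg a - 1 - n) b_(deg b - 1 + n) acts on M(n) as o(c) with c in O_{n-1}(V).
   Every element of M is a sum of a_k w, with w ranging over any nonzero set of
   vectors of an irreducible M, whence simplicity, and injectivity by looking at the
   submodule of M1 (+) M2 generated by the graph of M1(n) = M2(n).

   From algebras to modules: if M is to have M(n) = U, then y in M(m) should be
   determined by f_y : V -> U, f_y(v) = "the degree n part of Y_M(v,1) y", and
   Y_M(a,z) y should correspond to the expansion at z = 0 of f_y(Y(a,z-1) v), a rational
   function of z with poles at 0, 1 and infinity.  So the module is built inside the
   space of the linear maps f : V -> U for which f(Y(a,t) v) is rational with poles at
   t = 0, -1, infinity, of order bounded independently of v at the last two; a_l f is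
   a residue at t = -1.  The elements of U enter as f_x(v) = rho(v) x.  Residues are
   handled as functions g(l,k), standing for Res (1+t)^l t^k G(t) and characterised by
   g(l+1,k) = g(l,k) + g(l,k+1): such a function vanishes as soon as it vanishes
   near two of the three points 0 (k large), -1 (l large), infinity (l+k small).

   In positive characteristic L(-1) + L(0) does not control the divided powers
   v_(-m-1) 1; the relation needed for them, f_x(v_(-m-1) 1) = binom(-deg v, m) f_x(v),
   follows from rho(v *_n 1) = rho(v). *)

(** * Binomial coefficients, Pascal functions, eventually zero sums *)

Lemma int_updown (P : int -> Prop) (r0 : int) :
  P r0 -> (forall r, P r -> P (r + 1)) -> (forall r, P (r + 1) -> P r) ->
  forall r, P r.
Proof.
move=> P0 up dn.
have Pp (n : nat) : P (r0 + n%:Z).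
  elim: n => [|n IH]; first by rewrite addr0.
  have -> : r0 + n.+1%:Z = r0 + n%:Z + 1 by lia.
  exact: up.
have Pm (n : nat) : P (r0 - n%:Z).
  elim: n => [|n IH]; first by rewrite subr0.
  apply: dn.
  have -> : r0 - n.+1%:Z + 1 = r0 - n%:Z by lia.
  exact: IH.
move=> r; have [h|h] := lerP r0 r.
  have -> : r = r0 + (`|r - r0|%N)%:Z by lia.
  exact: Pp.
have -> : r = r0 - (`|r - r0|%N)%:Z by lia.
exact: Pm.
Qed.

Lemma binz_0r p : binz p 0 = 1.
Proof. by case: p => m /=; rewrite ?bin0 ?expr0 ?mul1r. Qed.

Lemma binz_0l i : binz 0 i = (i == 0%N)%:R.
Proof. by rewrite /= bin0n; case: i. Qed.

Lemma binzS p i : binz (p + 1) i.+1 = binz p i.+1 + binz p i.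
Proof.
case: p => [m|[|m]].
- have -> : Posz m + 1 = Posz m.+1 by lia.
  by rewrite /= binS PoszD.
- have -> : Negz 0 + 1 = 0 by lia.
  by rewrite binz_0l /= !add0n !binn exprS !mulr1 mulN1r addNr.
- have -> : Negz m.+1 + 1 = Negz m by lia.
  have -> : binz (Negz m.+1) i.+1 = (-1) ^+ i.+1 * ('C((m + i.+1).+1, i.+1))%:Z.
    by rewrite /= addSn.
  have -> : binz (Negz m.+1) i = (-1) ^+ i * ('C(m + i.+1, i))%:Z.
    by rewrite /= addSn addnS.
  rewrite /= binS PoszD mulrDr exprS.
  by rewrite !mulN1r !mulNr -addrA addNr addr0.
Qed.

Lemma binz_nat (m i : nat) : binz m%:Z i = ('C(m, i))%:Z.
Proof. by []. Qed.

Lemma binz_opp (m i : nat) : binz (- (m.+1)%:Z) i = (-1) ^+ i * ('C(m + i, i))%:Z.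
Proof. by []. Qed.

Lemma sgnzE (r : int) (i : nat) : sgnz (r + i%:Z) = sgnz r * (-1) ^+ i.
Proof.
rewrite /sgnz -exprD -signr_odd -[RHS]signr_odd; congr ((-1) ^+ nat_of_bool _); lia.
Qed.

Lemma sgnzS r : sgnz (r + 1) = - sgnz r.
Proof. by rewrite (sgnzE r 1) expr1 mulrN1. Qed.

Lemma sgnz_sqr r : sgnz r * sgnz r = 1.
Proof. by rewrite /sgnz -exprD addnn -muln2 exprM sqrr_sign. Qed.

Section Linear.
Variables (F : fieldType).

Definition lin (X Y : lmodType F) (f : X -> Y) :=
  forall (c : F) x y, f (c *: x + y) = c *: f x + f y.

Variables (X Y : lmodType F) (f : X -> Y) (fl : lin f).

Lemma lin0 : f 0 = 0.
Proof.
have := fl 0 0 0; rewrite !scale0r !add0r => h.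
by have := fl 1 0 0; rewrite !scale1r !addr0 => /esym/eqP; rewrite -subr_eq0 addrK => /eqP.
Qed.
Lemma linD x y : f (x + y) = f x + f y.
Proof. by have := fl 1 x y; rewrite !scale1r. Qed.
Lemma linZ c x : f (c *: x) = c *: f x.
Proof. by have := fl c x 0; rewrite lin0 !addr0. Qed.
Lemma linN x : f (- x) = - f x.
Proof. by rewrite -scaleN1r linZ scaleN1r. Qed.
Lemma linB x y : f (x - y) = f x - f y.
Proof. by rewrite linD linN. Qed.
Lemma linMn x m : f (x *+ m) = f x *+ m.
Proof. by elim: m => [|m IH]; rewrite ?mulr0n ?lin0 // !mulrS linD IH. Qed.
Lemma linMz x m : f (x *~ m) = f x *~ m.
Proof. by case: m => m; rewrite ?NegzE ?mulrNz ?linN -!pmulrn linMn. Qed.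
Lemma lin_sum (I : Type) (s : seq I) (P : pred I) G :
  f (\sum_(i <- s | P i) G i) = \sum_(i <- s | P i) f (G i).
Proof. by apply: (big_morph f linD lin0). Qed.
End Linear.

Lemma scalerMz (F : fieldType) (X : lmodType F) (c : F) (x : X) (m : int) :
  c *: (x *~ m) = (c *: x) *~ m.
Proof. by rewrite -!scaler_int !scalerA mulrC. Qed.

Section Pascal.
Variable X : zmodType.
Implicit Types g : int -> int -> X.

Definition pascal g := forall l k, g (l + 1) k = g l k + g l (k + 1).

(** The rule at (l, k - 1) gives g l k = g (l + 1) (k - 1) - g l (k - 1). The first point is closer
    to l >= A with the same l + k, the second is closer to l + k <= B; hence the nested induction on
    the two distances. *)
Lemma pascal_eq0 g (A B : int) : pascal g ->
  (forall l k : int, A <= l -> g l k = 0) ->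
  (forall l k : int, l + k <= B -> g l k = 0) ->
  forall l k, g l k = 0.
Proof.
move=> gP gA gB.
suff H : forall (n1 n2 : nat) (l k : int), A - l <= n1%:Z -> l + k - B <= n2%:Z -> g l k = 0.
  by move=> l k; apply: (H (absz (A - l)) (absz (l + k - B)%R)); lia.
elim=> [|n1 IH1] n2 l k; first by move=> h _; apply: gA; lia.
elim: n2 l k => [|n2 IH2] l k h1 h2; first by apply: gB; lia.
have := gP l (k - 1); rewrite subrK.
rewrite (IH1 n2.+1); [|lia|lia]; rewrite IH2; [|lia|lia].
by rewrite add0r.
Qed.

(** The rule carries zeros on the line l = 0 to larger l; towards smaller l it reads g l k = g (l +
    1) k - g l (k + 1), which is solved by descent from k >= K. *)
Lemma pascal_eq00 g (K : int) : pascal g ->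
  (forall k, g 0 k = 0) -> (forall l k : int, K <= k -> g l k = 0) ->
  forall l k, g l k = 0.
Proof.
move=> gP g0 gK; apply: (int_updown (r0 := 0)) => // l IH k; first by rewrite gP !IH addr0.
suff H : forall (m : nat) (k : int), K - k <= m%:Z -> g l k = 0 by apply: (H (absz (K - k))); lia.
elim=> [|m IHm] k' h; first by apply: gK; lia.
have := gP l k'; rewrite IH (IHm (k' + 1)); last by lia.
by rewrite addr0.
Qed.

Lemma pascalB g h : pascal g -> pascal h -> pascal (fun l k => g l k - h l k).
Proof. by move=> gP hP l k; rewrite gP hP opprD addrACA. Qed.
Lemma pascalD g h : pascal g -> pascal h -> pascal (fun l k => g l k + h l k).
Proof. by move=> gP hP l k; rewrite gP hP addrACA. Qed.
Lemma pascalMz g m : pascal g -> pascal (fun l k => g l k *~ m).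
Proof. by move=> gP l k; rewrite gP mulrzDl. Qed.
End Pascal.

Lemma pascal_lin (F : fieldType) (X Y : lmodType F) (f : X -> Y) g :
  lin f -> pascal g -> pascal (fun l k => f (g l k)).
Proof. by move=> fl gP l k; rewrite gP linD. Qed.

Section EventuallyZeroSums.
Variable X : zmodType.
Implicit Types g h : nat -> X.

Definition evz g := exists N : nat, forall i, (N <= i)%N -> g i = 0.

(** Sums without a truncation bound, with default value 0 when the terms are not eventually zero;
    identities then carry [evz] side conditions instead of explicit bounds. *)
Definition esum g : X :=
  match pselect (evz g) with
  | left h => \sum_(i < sval (cid h)) g i
  | right _ => 0
  end.

Lemma esumE g (N : nat) : (forall i, (N <= i)%N -> g i = 0) ->
  esum g = \sum_(i < N) g i.
Proof.
move=> gN; rewrite /esum; case: pselect => [h|[]]; last by exists N.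
case: cid => M /= gM.
have H (P Q : nat) : (P <= Q)%N -> (forall i, (P <= i)%N -> g i = 0) ->
    \sum_(i < Q) g i = \sum_(i < P) g i.
  move=> PQ gP; rewrite -!(big_mkord xpredT) (big_cat_nat (n := P)) //=.
  have -> : \sum_(P <= i < Q) g i = 0 by rewrite big_nat big1 // => i /andP[/gP].
  by rewrite addr0.
by case: (leqP M N) => [/H->//|/ltnW/H->].
Qed.

Lemma eq_esum g h : g =1 h -> esum g = esum h.
Proof. by move=> /funext->. Qed.

Lemma esum0 g : (forall i, g i = 0) -> esum g = 0.
Proof. by move=> h; rewrite (@esumE _ 0%N) ?big_ord0. Qed.

Lemma evzD g h : evz g -> evz h -> evz (fun i => g i + h i).
Proof.
move=> [N gN] [M hM]; exists (maxn N M) => i; rewrite geq_max => /andP[a b].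
by rewrite gN ?hM ?addr0.
Qed.

Lemma evzMz g (m : nat -> int) : evz g -> evz (fun i => g i *~ m i).
Proof. by move=> [N gN]; exists N => i /gN->; rewrite mul0rz. Qed.

Lemma evz_shift g : evz g -> evz (fun i => g i.+1).
Proof. by move=> [N gN]; exists N => i h; apply: gN; rewrite ltnW. Qed.

Lemma esumD g h : evz g -> evz h -> esum (fun i => g i + h i) = esum g + esum h.
Proof.
move=> [N gN] [M hM].
have b1 i : (maxn N M <= i)%N -> g i = 0 by rewrite geq_max => /andP[/gN].
have b2 i : (maxn N M <= i)%N -> h i = 0 by rewrite geq_max => /andP[_ /hM].
rewrite (esumE b1) (esumE b2) (@esumE _ (maxn N M)) ?big_split // => i H.
by rewrite b1 ?b2 ?addr0.
Qed.

End EventuallyZeroSums.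

Lemma esum_morph (X Y : zmodType) (f : X -> Y) (g : nat -> X) : {morph f : x y / x + y} -> f 0 = 0 ->
  evz g -> f (esum g) = esum (fun i => f (g i)).
Proof.
move=> fD f0 [N gN]; rewrite (esumE gN) (@esumE _ _ N) => [|i /gN->//].
exact: (big_morph f fD f0).
Qed.

Lemma esumN (X : zmodType) (g : nat -> X) : evz g -> esum (fun i => - g i) = - esum g.
Proof. by move=> gz; rewrite (esum_morph (f := -%R)) ?oppr0 //; exact: opprD. Qed.

Lemma esum_recl (X : zmodType) (g : nat -> X) : evz g ->
  esum g = g 0%N + esum (fun i => g i.+1).
Proof.
move=> [N gN].
rewrite (@esumE _ _ N.+1) => [|i h]; last by apply: gN; exact: ltnW.
rewrite big_ord_recl (@esumE _ (fun i => g i.+1) N) // => i h.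
by apply: gN; exact: ltnW.
Qed.

Lemma esum_lin (F : fieldType) (X Y : lmodType F) (f : X -> Y) g : lin f ->
  evz g -> f (esum g) = esum (fun i => f (g i)).
Proof. by move=> fl; apply: esum_morph; [exact: linD | exact: lin0]. Qed.

Lemma esum_binzS (X : zmodType) (x : nat -> X) p : evz x ->
  esum (fun i => x i *~ binz (p + 1) i) =
  esum (fun i => x i *~ binz p i) + esum (fun i => x i.+1 *~ binz p i).
Proof.
move=> xz; have xz' := evz_shift xz.
rewrite esum_recl; last exact: evzMz.
rewrite [X in _ = X + _]esum_recl; last exact: evzMz.
rewrite !binz_0r -addrA -esumD. all: try (exact: evzMz).
by congr (_ + _); apply: eq_esum => i; rewrite binzS mulrzDr.
Qed.

Lemma esum_sbinzS (X : zmodType) (x : nat -> X) p : evz x ->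
  esum (fun i => x i *~ ((-1) ^+ i * binz (p + 1) i)) =
  esum (fun i => x i *~ ((-1) ^+ i * binz p i))
  - esum (fun i => x i.+1 *~ ((-1) ^+ i * binz p i)).
Proof.
move=> xz.
have e q : esum (fun i => x i *~ ((-1) ^+ i * binz q i)) =
           esum (fun i => (x i *~ (-1) ^+ i) *~ binz q i).
  by apply: eq_esum => i; rewrite mulrzA.
rewrite !e esum_binzS; last exact: evzMz.
congr (_ + _); rewrite -esumN; last exact: (evzMz _ (evz_shift xz)).
by apply: eq_esum => i; rewrite exprS mulN1r mulrNz mulNrz mulrzA.
Qed.

Lemma esum_binz0 (X : zmodType) (x : nat -> X) : esum (fun i => x i *~ binz 0 i) = x 0%N.
Proof.
rewrite (@esumE _ _ 1) ?big_ord1 ?binz_0l // => -[|i] // _.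
Qed.

Lemma esum_sbinz0 (X : zmodType) (x : nat -> X) :
  esum (fun i => x i *~ ((-1) ^+ i * binz 0 i)) = x 0%N.
Proof.
rewrite (@esumE _ _ 1) ?big_ord1 ?binz_0l ?expr0 // => -[|i] // _.
by rewrite binz_0l mulr0 mulr0z.
Qed.

(** * Borcherds' identity with powers of 1 + t *)

Lemma bound_fin (P : nat -> int -> Prop) :
  (forall s, exists K : int, forall k, K <= k -> P s k) ->
  forall N, exists K : int, forall s, (s < N)%N -> forall k, K <= k -> P s k.
Proof.
move=> h; elim=> [|N [K IH]]; first by exists 0.
have [K' hK'] := h N; exists (Num.max K K') => s; rewrite ltnS leq_eqVlt.
by move=> /orP[/eqP->|/IH H] k; rewrite ge_max => /andP[? ?]; [exact: hK'|exact: H].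
Qed.

Lemma esum_pascal (X : zmodType) (G : nat -> int -> int -> X) :
  (forall i, pascal (G i)) -> (forall l k, evz (fun i => G i l k)) ->
  pascal (fun l k => esum (fun i => G i l k)).
Proof. by move=> GP Gz l k; rewrite -esumD //; apply: eq_esum => i; exact: GP. Qed.

Section TwoVariables.
Variable X : zmodType.
Implicit Types Th : int -> int -> int -> int -> X.

Definition pasc1 Th := forall l2 k2, pascal (fun l1 k1 => Th l1 k1 l2 k2).
Definition pasc2 Th := forall l1 k1, pascal (fun l2 k2 => Th l1 k1 l2 k2).
Definition vanK Th (K : int) :=
  forall l1 k1 l2 k2, K <= k2 -> Th l1 k1 l2 k2 = 0.
Definition vanL Th (L : int) :=
  forall l1 k1 l2 k2, L <= l2 -> Th l1 k1 l2 k2 = 0.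

(* [Th l1 k1 l2 k2] is the value on z1^l1 t1^k1 z2^l2 t2^k2, with z = 1 + t, of a
   functional on test functions; [Et] inserts (t1 - t2)^r expanded in powers of
   t2, and [Ez] inserts (z1 - z2)^r expanded in powers of z2. *)
Definition Et (r : int) Th l1 k1 l2 k2 : X :=
  esum (fun i => Th l1 (k1 + r - i%:Z) l2 (k2 + i%:Z) *~ ((-1) ^+ i * binz r i)).
Definition Ez (r : int) Th l1 k1 l2 k2 : X :=
  esum (fun i => Th (l1 + r - i%:Z) k1 (l2 + i%:Z) k2 *~ ((-1) ^+ i * binz r i)).

Lemma evzK Th K l1 l2 k2 (f : nat -> int) : vanK Th K ->
  evz (fun i => Th l1 (f i) l2 (k2 + i%:Z)).
Proof. by move=> h; exists (absz (K - k2)%R) => i hi; apply: h; lia. Qed.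
Lemma evzL Th L k1 l2 k2 (f : nat -> int) : vanL Th L ->
  evz (fun i => Th (f i) k1 (l2 + i%:Z) k2).
Proof. by move=> h; exists (absz (L - l2)%R) => i hi; apply: h; lia. Qed.

Lemma Et_pasc1 r Th K : vanK Th K -> pasc1 Th -> pasc1 (Et r Th).
Proof.
move=> hK h l2 k2; apply: (esum_pascal
  (G := fun i l1 k1 => Th l1 (k1 + r - i%:Z) l2 (k2 + i%:Z) *~ ((-1) ^+ i * binz r i))).
  by move=> i; apply: pascalMz => l k; rewrite h; congr (_ + Th _ _ _ _); lia.
by move=> l1 k1; apply: evzMz; exact: (evzK _ _ _ _ hK).
Qed.
Lemma Et_pasc2 r Th K : vanK Th K -> pasc2 Th -> pasc2 (Et r Th).
Proof.
move=> hK h l1 k1; apply: (esum_pascal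
  (G := fun i l2 k2 => Th l1 (k1 + r - i%:Z) l2 (k2 + i%:Z) *~ ((-1) ^+ i * binz r i))).
  by move=> i; apply: pascalMz => l k; rewrite h; congr (_ + Th _ _ _ _); lia.
by move=> l2 k2; apply: evzMz; exact: (evzK _ _ _ _ hK).
Qed.
Lemma Ez_pasc1 r Th L : vanL Th L -> pasc1 Th -> pasc1 (Ez r Th).
Proof.
move=> hL h l2 k2; apply: (esum_pascal
  (G := fun i l1 k1 => Th (l1 + r - i%:Z) k1 (l2 + i%:Z) k2 *~ ((-1) ^+ i * binz r i))).
  move=> i; apply: pascalMz => l k.
  have -> : l + 1 + r - i%:Z = l + r - i%:Z + 1 by lia.
  exact: h.
by move=> l1 k1; apply: evzMz; exact: (evzL _ _ _ _ hL).
Qed.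
Lemma Ez_pasc2 r Th L : vanL Th L -> pasc2 Th -> pasc2 (Ez r Th).
Proof.
move=> hL h l1 k1; apply: (esum_pascal
  (G := fun i l2 k2 => Th (l1 + r - i%:Z) k1 (l2 + i%:Z) k2 *~ ((-1) ^+ i * binz r i))).
  move=> i; apply: pascalMz => l k.
  have -> : l + 1 + i%:Z = l + i%:Z + 1 by lia.
  exact: h.
by move=> l2 k2; apply: evzMz; exact: (evzL _ _ _ _ hL).
Qed.

Lemma EtS r Th K l1 k1 l2 k2 : vanK Th K ->
  Et (r + 1) Th l1 k1 l2 k2 = Et r Th l1 (k1 + 1) l2 k2 - Et r Th l1 k1 l2 (k2 + 1).
Proof.
move=> hK; rewrite /Et.
rewrite (esum_sbinzS (x := fun i => Th l1 (k1 + (r + 1) - i%:Z) l2 (k2 + i%:Z)));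
  last exact: (evzK _ _ _ _ hK).
congr (_ - _); apply: eq_esum => i; congr (Th _ _ _ _ *~ _); lia.
Qed.
Lemma EzS r Th L l1 k1 l2 k2 : vanL Th L ->
  Ez (r + 1) Th l1 k1 l2 k2 = Ez r Th (l1 + 1) k1 l2 k2 - Ez r Th l1 k1 (l2 + 1) k2.
Proof.
move=> hL; rewrite /Ez.
rewrite (esum_sbinzS (x := fun i => Th (l1 + (r + 1) - i%:Z) k1 (l2 + i%:Z) k2));
  last exact: (evzL _ _ _ _ hL).
congr (_ - _); apply: eq_esum => i; congr (Th _ _ _ _ *~ _); lia.
Qed.

Lemma Et0 Th l1 k1 l2 k2 : Et 0 Th l1 k1 l2 k2 = Th l1 k1 l2 k2.
Proof.
rewrite /Et (esum_sbinz0 (fun i => Th l1 (k1 + 0 - i%:Z) l2 (k2 + i%:Z))).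
by rewrite !addr0 ?subr0.
Qed.
Lemma Ez0 Th l1 k1 l2 k2 : Ez 0 Th l1 k1 l2 k2 = Th l1 k1 l2 k2.
Proof.
rewrite /Ez (esum_sbinz0 (fun i => Th (l1 + 0 - i%:Z) k1 (l2 + i%:Z) k2)).
by rewrite !addr0 ?subr0.
Qed.

(* Near t1 = -1 and t2 = 0 the expansions of (t1 - t2)^r and (z1 - z2)^r are both
   the power series expansion of (- 1 + z1 - t2)^r. *)
Lemma Et_Ez r Th K L : pasc1 Th -> pasc2 Th -> vanK Th K ->
  (forall l1 k1 l2 k2, L <= l1 -> Th l1 k1 l2 k2 = 0) ->
  forall l1 k1 l2 k2, Et r Th l1 k1 l2 k2 =
    Ez r (fun l2 k2 l1 k1 => Th l1 k1 l2 k2) l2 k2 l1 k1 *~ sgnz r.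
Proof.
move=> P1 P2 hK hL.
pose Ts l2 k2 l1 k1 := Th l1 k1 l2 k2.
have hL' : vanL Ts L by move=> *; exact: hL.
(* As t1 - t2 = z1 - z2, the Pascal rules turn the recurrence of [Et] in the exponents k into the
   recurrence of [Ez] in the exponents l. *)
have EtR s l1 k1 l2 k2 : Et (s + 1) Th l1 k1 l2 k2 =
    Et s Th (l1 + 1) k1 l2 k2 - Et s Th l1 k1 (l2 + 1) k2.
  rewrite (EtS _ _ _ _ _ hK) (Et_pasc1 s hK P1) (Et_pasc2 s hK P2).
  by rewrite opprD addrACA addrN add0r.
pose e s l1 k1 l2 k2 := Et s Th l1 k1 l2 k2 - Ez s Ts l2 k2 l1 k1 *~ sgnz s.
have eR s l1 k1 l2 k2 : e (s + 1) l1 k1 l2 k2 = e s (l1 + 1) k1 l2 k2 - e s l1 k1 (l2 + 1) k2.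
  rewrite /e EtR (EzS _ _ _ _ _ hL') sgnzS mulrNz opprK mulrzBl.
  by rewrite opprB addrACA [in RHS]addrACA; congr (_ + _); rewrite addrC.
have eL s l1 k1 l2 k2 : L <= l1 -> e s l1 k1 l2 k2 = 0.
  move=> h; rewrite /e /Et /Ez !esum0 ?mul0rz ?subr0 // => i.
    by rewrite /Ts hL ?mul0rz //; lia.
  by rewrite hL ?mul0rz.
suff H : forall s l1 k1 l2 k2, e s l1 k1 l2 k2 = 0.
  by move=> l1 k1 l2 k2; apply/eqP; rewrite -subr_eq0; apply/eqP; exact: H.
apply: (int_updown (r0 := 0)) => [l1 k1 l2 k2|s IH l1 k1 l2 k2|s IH].
- by rewrite /e Et0 Ez0 subrr.
- by rewrite eR !IH subrr.
(* Downwards in s, the vanishing of e (s + 1) says that raising l1 or raising l2 has the same effect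
   on e s; so l1 can be raised until it exceeds L. *)
suff H : forall (m : nat) (l1 k1 l2 k2 : int), L - l1 <= m%:Z -> e s l1 k1 l2 k2 = 0.
  by move=> l1 k1 l2 k2; apply: (H (absz (L - l1)%R)); lia.
elim=> [|m IHm] l1 k1 l2 k2 h; first by apply: eL; lia.
have := IH l1 k1 (l2 - 1) k2; rewrite eR subrK IHm; last by lia.
by rewrite sub0r => /eqP; rewrite oppr_eq0 => /eqP.
Qed.

Lemma Et_van1 r Th K : vanK Th K ->
  (forall l2 k2, exists M : int, forall l1 k1, M <= k1 -> Th l1 k1 l2 k2 = 0) ->
  forall l2 k2, exists M : int, forall l1 k1, M <= k1 -> Et r Th l1 k1 l2 k2 = 0.
Proof.
move=> hK h l2 k2; pose N := absz (K - k2)%R.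
have [M hM] := bound_fin (P := fun s k => forall l, Th l k l2 (k2 + s%:Z) = 0)
   (fun s => let: ex_intro K h := h l2 (k2 + s%:Z) in
             ex_intro _ K (fun k H l => h l k H)) N.
exists (M - r + N%:Z) => l1 k1 hk; apply: esum0 => i.
case: (ltnP i N) => hi; last by rewrite hK ?mul0rz //; lia.
by rewrite (hM i hi) ?mul0rz //; lia.
Qed.
End TwoVariables.

Section Iterate.
Variables (X : zmodType) (N : nat) (Psi : nat -> int -> int -> X).
Hypothesis PsiP : forall s, pascal (Psi s).
Hypothesis PsiN : forall s l k, (N <= s)%N -> Psi s l k = 0.

(* The expansion of z1^l1 t1^k1 z2^l2 t2^k2 in powers of s = t1 - t2, the s-th
   power being paired with [Psi s]. *)
Definition J0 l1 k1 l2 k2 : X :=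
  esum (fun i => esum (fun j => Psi (i + j) (l1 + l2 - j%:Z) (k1 + k2 - i%:Z) *~ binz l1 j)
     *~ binz k1 i).

Lemma evz_Psi i (f g : nat -> int) : evz (fun j => Psi (i + j) (f j) (g j)).
Proof. by exists N => j h; apply: PsiN; lia. Qed.

Let Q (l1 : int) (i : nat) l k := esum (fun j => Psi (i + j) (l - j%:Z) k *~ binz l1 j).
Let QP l1 i : pascal (Q l1 i).
Proof.
apply: (esum_pascal (G := fun j l k => Psi (i + j) (l - j%:Z) k *~ binz l1 j)) => [j|l k].
  by apply: pascalMz => l k; rewrite addrAC PsiP.
by apply: evzMz; exact: evz_Psi.
Qed.
Let QN l1 i l k : (N <= i)%N -> Q l1 i l k = 0.
Proof. by move=> h; apply: esum0 => j; rewrite PsiN ?mul0rz //; lia. Qed.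
Let evzQ l1 (f g : nat -> int) : evz (fun i => Q l1 i (f i) (g i)).
Proof. by exists N => i h; exact: QN. Qed.

(** With s = t1 - t2 one has z1 = z2 + s and t1 = t2 + s. The factors z2 and s produced by an extra
    z1 are regrouped, using z2 = 1 + t2, into 1 and t2 + s = t1. *)
Lemma J0_pasc1 l2 k2 : pascal (fun l1 k1 => J0 l1 k1 l2 k2).
Proof.
move=> l1 k1.
have E1 i : esum (fun j => Psi (i + j) (l1 + 1 + l2 - j%:Z) (k1 + k2 - i%:Z) *~ binz (l1 + 1) j)
     = Q l1 i (l1 + l2) (k1 + k2 - i%:Z) +
       (Q l1 i (l1 + l2) (k1 + 1 + k2 - i%:Z) + Q l1 i.+1 (l1 + l2) (k1 + k2 - i%:Z)).
  rewrite (esum_binzS (x := fun j => Psi (i + j) (l1 + 1 + l2 - j%:Z) (k1 + k2 - i%:Z)));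
    last exact: evz_Psi.
  rewrite addrA; congr (_ + _).
    have -> : k1 + 1 + k2 - i%:Z = k1 + k2 - i%:Z + 1 by lia.
    rewrite -QP; apply: eq_esum => j; congr (Psi _ _ _ *~ _); lia.
  apply: eq_esum => j; congr (Psi _ _ _ *~ _); lia.
rewrite /J0; under eq_esum => i do rewrite E1 mulrzDl mulrzDl.
have z1 : evz (fun i => Q l1 i.+1 (l1 + l2) (k1 + k2 - i%:Z)).
  by exists N => i h; apply: QN; lia.
rewrite esumD; [|exact/evzMz/evzQ|by apply: evzD; apply: evzMz; [exact: evzQ|exact: z1]].
congr (_ + _).
rewrite (esum_binzS (x := fun i => Q l1 i (l1 + l2) (k1 + 1 + k2 - i%:Z))); last exact: evzQ.
rewrite esumD; [|exact/evzMz/evzQ|exact: evzMz].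
congr (_ + _); apply: eq_esum => i; congr (Q _ _ _ _ *~ _); lia.
Qed.

Lemma J0_pasc2 l1 k1 : pascal (fun l2 k2 => J0 l1 k1 l2 k2).
Proof.
apply: (esum_pascal (G := fun i l2 k2 => Q l1 i (l1 + l2) (k1 + k2 - i%:Z) *~ binz k1 i)).
  by move=> i; apply: pascalMz => l k; rewrite addrA QP addrA (addrAC _ 1).
by move=> l2 k2; apply: evzMz; exact: evzQ.
Qed.

Lemma J0_l0 k1 l2 k2 : J0 0 k1 l2 k2 = esum (fun i => Psi i l2 (k1 + k2 - i%:Z) *~ binz k1 i).
Proof.
apply: eq_esum => i; congr (_ *~ _).
rewrite (esum_binz0 (fun j => Psi (i + j) (0 + l2 - j%:Z) (k1 + k2 - i%:Z))).
by rewrite addn0 add0r subr0.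
Qed.

Lemma J0_k0 l1 l2 k2 : J0 l1 0 l2 k2 = esum (fun j => Psi j (l1 + l2 - j%:Z) k2 *~ binz l1 j).
Proof.
rewrite /J0 (esum_binz0 (fun i => esum (fun j =>
  Psi (i + j) (l1 + l2 - j%:Z) (0 + k2 - i%:Z) *~ binz l1 j))).
by apply: eq_esum => j; rewrite add0r subr0.
Qed.

Lemma J0_eq0 l1 k1 l2 k2 :
  (forall i j : nat, (i + j < N)%N -> Psi (i + j) (l1 + l2 - j%:Z) (k1 + k2 - i%:Z) = 0) ->
  J0 l1 k1 l2 k2 = 0.
Proof.
move=> h; apply: esum0 => i; rewrite esum0 ?mul0rz // => j.
case: (ltnP (i + j) N) => hN; first by rewrite h ?mul0rz.
by rewrite PsiN ?mul0rz.
Qed.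
End Iterate.

Lemma J0_morph (X Y : zmodType) (f : X -> Y) N (Psi : nat -> int -> int -> X) :
  {morph f : x y / x + y} -> f 0 = 0 -> (forall x m, f (x *~ m) = f x *~ m) ->
  (forall s l k, (N <= s)%N -> Psi s l k = 0) ->
  forall l1 k1 l2 k2, f (J0 Psi l1 k1 l2 k2) = J0 (fun s l k => f (Psi s l k)) l1 k1 l2 k2.
Proof.
move=> fD f0 fM PN l1 k1 l2 k2.
rewrite /J0 (esum_morph fD f0).
  apply: eq_esum => i; rewrite fM (esum_morph fD f0).
    by congr (_ *~ _); apply: eq_esum => j; rewrite fM.
  by apply: evzMz; exact: (evz_Psi PN).
by apply: evzMz; exists N => i h; apply: esum0 => j; rewrite PN ?mul0rz //; lia.
Qed.

Lemma Et_morph (X Y : zmodType) (f : X -> Y) Th K r :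
  {morph f : x y / x + y} -> f 0 = 0 -> (forall x m, f (x *~ m) = f x *~ m) ->
  vanK Th K ->
  forall l1 k1 l2 k2, f (Et r Th l1 k1 l2 k2) =
    Et r (fun a b c d => f (Th a b c d)) l1 k1 l2 k2.
Proof.
move=> fD f0 fM hK l1 k1 l2 k2.
rewrite /Et (esum_morph fD f0); first by apply: eq_esum => i; rewrite fM.
by apply: evzMz; exact: (evzK _ _ _ _ hK).
Qed.

Section WeakModules.
Variables (F : fieldType) (A X : lmodType F).
Variables (modeA : int -> A -> A -> A) (act : int -> A -> X -> X).
Hypothesis tA : truncated modeA.
Hypotheses (bX : bilinear_act act) (tX : truncated act) (jX : borcherds modeA act).

Lemma act_linl k x : lin (fun a => act k a x).
Proof. by move=> c a b; exact: (proj1 bX). Qed.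
Lemma act_linr k a : lin (act k a).
Proof. by move=> c x y; exact: (proj2 bX). Qed.

Lemma act_evz k a x : evz (fun i : nat => act (k + i%:Z) a x).
Proof.
have [N hN] := tX a x; exists (absz (N - k)%R) => i h; apply: hN; lia.
Qed.

Lemma borcherds_esum (p q r : int) u v w :
  esum (fun i => act (p + q - i%:Z) (modeA (r + i%:Z) u v) w *~ binz p i) =
  esum (fun i => act (p + r - i%:Z) u (act (q + i%:Z) v w) *~ ((-1) ^+ i * binz r i))
  - esum (fun i => act (q + r - i%:Z) v (act (p + i%:Z) u w) *~ ((-1) ^+ i * binz r i))
    *~ sgnz r.
Proof.
have [N1 h1] := tA u v; have [N2 h2] := tX v w; have [N3 h3] := tX u w.
pose N := (absz (N1 - r)%R + absz (N2 - q)%R + absz (N3 - p)%R)%N.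
have H (i : nat) : (N <= i)%N ->
    [/\ modeA (r + i%:Z) u v = 0, act (q + i%:Z) v w = 0 & act (p + i%:Z) u w = 0].
  by move=> h; split; [apply: h1|apply: h2|apply: h3]; lia.
have := jX H.
rewrite (@esumE _ _ N) => [->|i /H[-> _ _]]; last by rewrite (lin0 (act_linl _ _)) mul0rz.
rewrite (@esumE _ _ N) => [|i /H[_ -> _]]; last by rewrite (lin0 (act_linr _ _)) mul0rz.
rewrite (@esumE _ _ N) => [|i /H[_ _ ->]]; last by rewrite (lin0 (act_linr _ _)) mul0rz.
rewrite mulrz_suml -sumrB; apply: eq_bigr => i _.
by rewrite mulrzBl -!mulrzA [sgnz _ * _]mulrC.
Qed.
End WeakModules.

Section Modes.
Variables (F : fieldType) (V : VOA F).
Implicit Types a b v : V.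

Lemma mode_linl k v : lin (fun a => mode V k a v).
Proof. exact: act_linl (mode_bilin V) _ _. Qed.
Lemma mode_linr k a : lin (mode V k a).
Proof. exact: act_linr (mode_bilin V) _ _. Qed.

(* Res_t (1 + t)^l t^k Y(a,t) v *)
Definition mu (l k : int) a v : V := esum (fun i => mode V (k + i%:Z) a v *~ binz l i).

Lemma evz_mode k a v : evz (fun i : nat => mode V (k + i%:Z) a v).
Proof. exact: act_evz (@mode_trunc _ V) _ _ _. Qed.

Lemma mu_sum l k a v N : (forall i : nat, (N <= i)%N -> mode V (k + i%:Z) a v = 0) ->
  mu l k a v = \sum_(i < N) mode V (k + (i : nat)%:Z) a v *~ binz l i.
Proof. by move=> h; apply: esumE => i /h->; rewrite mul0rz. Qed.

Lemma mu_l0 k a v : mu 0 k a v = mode V k a v.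
Proof. by rewrite /mu (esum_binz0 (fun i => mode V (k + i%:Z) a v)) addr0. Qed.

Lemma mu_pascal a v : pascal (fun l k => mu l k a v).
Proof.
move=> l k; rewrite /mu (esum_binzS _ (evz_mode k a v)); congr (_ + _).
by apply: eq_esum => i; congr (mode V _ _ _ *~ _); lia.
Qed.

Lemma mu_van a v : exists K : int, forall l k, K <= k -> mu l k a v = 0.
Proof.
have [K hK] := @mode_trunc _ V a v; exists K => l k h; apply: esum0 => i.
by rewrite hK ?mul0rz //; lia.
Qed.

Lemma esum_scale (X : lmodType F) (c : F) (g : nat -> X) : evz g ->
  c *: esum g = esum (fun i => c *: g i).
Proof.
by move=> gz; rewrite (esum_morph (f := fun x => c *: x)) ?scaler0 // => x y; rewrite scalerDr.
Qed.

Lemma mu_linl l k v : lin (fun a => mu l k a v).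
Proof.
move=> c a b; rewrite /mu esum_scale; last exact: evzMz (evz_mode _ _ _).
rewrite -esumD; last exact: evzMz (evz_mode _ _ _).
  by apply: eq_esum => i; rewrite (mode_linl _ _ c) mulrzDl scalerMz.
by have [N hN] := evzMz (binz l) (evz_mode k a v); exists N => i /hN->; rewrite scaler0.
Qed.
Lemma mu_linr l k a : lin (mu l k a).
Proof.
move=> c u v; rewrite /mu esum_scale; last exact: evzMz (evz_mode _ _ _).
rewrite -esumD; last exact: evzMz (evz_mode _ _ _).
  by apply: eq_esum => i; rewrite (mode_linr _ _ c) mulrzDl scalerMz.
by have [N hN] := evzMz (binz l) (evz_mode k a u); exists N => i /hN->; rewrite scaler0.
Qed.

Definition mumu a b v l1 k1 l2 k2 := mu l1 k1 a (mu l2 k2 b v).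

Lemma mumu_pasc1 a b v : pasc1 (mumu a b v).
Proof. by move=> l2 k2; exact: mu_pascal. Qed.
Lemma mumu_pasc2 a b v : pasc2 (mumu a b v).
Proof. by move=> l1 k1; apply: pascal_lin (mu_linr _ _ _) (mu_pascal _ _). Qed.
Lemma mumu_vanK a b v : exists K, vanK (mumu a b v) K.
Proof.
have [K hK] := mu_van b v; exists K => l1 k1 l2 k2 h.
by rewrite /mumu hK // (lin0 (mu_linr _ _ _)).
Qed.

Definition muit r a b v (s : nat) l k := mu l k (mode V (r + s%:Z) a b) v.
Lemma muit_pasc r a b v s : pascal (muit r a b v s).
Proof. exact: mu_pascal. Qed.
Lemma muit_van r a b v : exists N, forall s l k, (N <= s)%N -> muit r a b v s l k = 0.
Proof.
have [N hN] := evz_mode r a b; exists N => s l k h.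
by rewrite /muit hN // (lin0 (mu_linl _ _ _)).
Qed.

(* Borcherds' identity paired with test functions z1^l1 t1^k1 z2^l2 t2^k2 (t1 - t2)^r,
   z = 1 + t: it extends from l1 = l2 = 0 by uniqueness of Pascal functions. *)
Lemma mu_borcherds r a b v l1 k1 l2 k2 :
  J0 (muit r a b v) l1 k1 l2 k2 =
  Et r (mumu a b v) l1 k1 l2 k2 - Et r (mumu b a v) l2 k2 l1 k1 *~ sgnz r.
Proof.
have [N hN] := muit_van r a b v.
have [K hK] := mumu_vanK a b v; have [K' hK'] := mumu_vanK b a v.
pose d l1 k1 l2 k2 := J0 (muit r a b v) l1 k1 l2 k2 -
  (Et r (mumu a b v) l1 k1 l2 k2 - Et r (mumu b a v) l2 k2 l1 k1 *~ sgnz r).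
have d1 : pasc1 d.
  move=> l2' k2'; apply: pascalB; first exact: (J0_pasc1 (muit_pasc r a b v) hN).
  apply: pascalB; first exact: (Et_pasc1 r hK (mumu_pasc1 a b v)).
  by apply: pascalMz; exact: (Et_pasc2 r hK' (mumu_pasc2 b a v)).
have d2 : pasc2 d.
  move=> l1' k1'; apply: pascalB; first exact: (J0_pasc2 (muit_pasc r a b v) hN).
  apply: pascalB; first exact: (Et_pasc2 r hK (mumu_pasc2 a b v)).
  by apply: pascalMz; exact: (Et_pasc1 r hK' (mumu_pasc1 b a v)).
have [M hM] := bound_fin (P := fun s k => forall l, muit r a b v s l k = 0)
  (fun s => let: ex_intro K h := mu_van (mode V (r + s%:Z) a b) v in
            ex_intro _ K (fun k H l => h l k H)) N.
have vJ l1' k1' l2' k2' : M + N%:Z <= k1' + k2' -> J0 (muit r a b v) l1' k1' l2' k2' = 0.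
  move=> h; apply: (J0_eq0 hN) => i j ij; apply: (hM (i + j)%N ij); lia.
have vE a' b' K0 : vanK (mumu a' b' v) K0 -> forall l2 k2, exists M : int,
    forall l1 k1, M <= k1 -> Et r (mumu a' b' v) l1 k1 l2 k2 = 0.
  move=> h; apply: (Et_van1 r h) => l2' k2'.
  have [M' hM'] := mu_van a' (mu l2' k2' b' v); exists M' => l k; exact: hM'.
have d00 k1' k2' : d 0 k1' 0 k2' = 0.
  rewrite /d (J0_l0 (muit r a b v)) /Et /mumu /muit.
  under eq_esum => i do rewrite mu_l0.
  under [in X in _ - (X - _)]eq_esum => i do rewrite !mu_l0.
  under [in X in _ - (_ - X)]eq_esum => i do rewrite !mu_l0.
  rewrite (borcherds_esum (@mode_trunc _ V) (mode_bilin V)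
    (@mode_trunc _ V) (@jacobi _ V)).
  by rewrite subrr.
have dl k1' k2' : forall l, d l k1' 0 k2' = 0.
  move=> l; have [M1 hM1] := @vE a b K hK 0 k2'.
  apply: (pascal_eq00 (K := `|M1| + `|M| + N%:Z + `|k2'| + `|K'|) (d1 0 k2')) => [k|l' k h]; first exact: d00.
  rewrite /d vJ; last by lia.
  rewrite hM1; last by lia.
  rewrite [Et _ _ _ _ _ _]esum0 ?mul0rz ?subrr // => i.
  by rewrite hK' ?mul0rz //; lia.
have dd : d l1 k1 l2 k2 = 0.
  have [M1 hM1] := @vE b a K' hK' l1 k1.
  apply: (pascal_eq00 (K := `|M1| + `|M| + N%:Z + `|k1| + `|K|) (d2 l1 k1)) => [k|l' k h]; first exact: dl.
  rewrite /d vJ; last by lia.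
  rewrite [in X in _ - (_ - X)]hM1; last by lia.
  rewrite [Et _ _ _ _ _ _]esum0 ?mul0rz ?subrr // => i.
  by rewrite hK ?mul0rz //; lia.
by apply/eqP; rewrite -subr_eq0; apply/eqP; exact: dd.
Qed.
End Modes.

(** * The coinduced weak module *)

Lemma esum_one (X : zmodType) (g : nat -> X) (m : nat) :
  (forall i, i <> m -> g i = 0) -> esum g = g m.
Proof.
move=> h; rewrite (@esumE _ _ m.+1) => [|i hi]; last by apply: h; lia.
by rewrite big_ord_recr /= big1 ?add0r // => i _; apply: h; have := ltn_ord i; lia.
Qed.

Section Polar.
Variable X : zmodType.
Variables (c : int -> int -> X) (A B : int).
Hypothesis cP : pascal c.
Hypothesis c0 : forall l k : int, A <= l -> l + k <= B -> c l k = 0.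

(** The value at the point with A - l = n1 and l + k - B = n2: zero on the line l = A, - c on the
    line l + k = B, and between them the Pascal rule solved for the value with the smallest l and
    the largest l + k. *)
Fixpoint polar_rec (n1 : nat) : nat -> X :=
  match n1 with
  | 0%N => fun _ => 0
  | m.+1 => fix rec (n2 : nat) :=
      match n2 with
      | 0%N => - c (A - n1%:Z) (B - A + n1%:Z)
      | p.+1 => polar_rec m p.+1 - rec p
      end
  end.

(** If [c] is the residue at t = 0, this is the residue at t = -1. It vanishes for l large, and
    equals - c for l + k small because the residues sum to zero and there is none at infinity; [c0]
    makes the two prescriptions compatible. *)
Definition polar (l k : int) : X :=
  if A <= l then 0 else if l + k <= B then - c l k
  else polar_rec (absz (A - l)%R) (absz (l + k - B)%R).

Lemma polar_high l k : A <= l -> polar l k = 0.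
Proof. by rewrite /polar => ->. Qed.

Lemma polar_low l k : l + k <= B -> polar l k = - c l k.
Proof. by rewrite /polar => h; case: ifP => [h'|_]; [rewrite c0 ?oppr0|rewrite h]. Qed.

Lemma polar_mid l k : l <= A -> B < l + k ->
  polar l k = polar_rec (absz (A - l)%R) (absz (l + k - B)%R).
Proof.
move=> h1 h2; rewrite /polar [l + k <= B]leNgt h2 /=; case: ifP => // h3.
have -> : absz (A - l)%R = 0%N by lia.
by [].
Qed.

Lemma polar_bnd l k : l < A -> l + k = B -> polar l k = polar_rec (absz (A - l)%R) 0.
Proof.
move=> h1 h2; rewrite polar_low; last by lia.
have -> : absz (A - l)%R = (absz (A - l)%R).-1.+1 by lia.
by rewrite /=; congr (- c _ _); lia.
Qed.

Lemma polar_pascal : pascal polar.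
Proof.
move=> l k; have [h|h] := lerP A l.
  by rewrite !polar_high ?addr0 //; lia.
have [h'|h'] := lerP (l + k + 1) B.
  rewrite polar_low; last by lia.
  rewrite (@polar_low l k); last by lia.
  rewrite (@polar_low l (k + 1)); last by lia.
  by rewrite cP opprD.
rewrite (@polar_mid l (k + 1)); [|lia|lia].
rewrite (@polar_mid (l + 1) k); [|lia|lia].
have -> : absz (A - l)%R = (absz (A - (l + 1))%R).+1 by lia.
have -> : absz (l + (k + 1) - B)%R = (absz (l + k - B)%R).+1 by lia.
have -> : absz (l + 1 + k - B)%R = (absz (l + k - B)%R).+1 by lia.
have -> : polar l k = polar_rec (absz (A - (l + 1))%R).+1 (absz (l + k - B)%R).
  have [h2|h2] := lerP (l + k) B.
    have e : l + k = B by lia.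
    rewrite polar_bnd // e subrr; congr (polar_rec _ _); lia.
  by rewrite polar_mid; [congr (polar_rec _ _); lia|lia|lia].
set m := absz (A - (l + 1))%R; set p := absz (l + k - B)%R.
have -> : polar_rec m.+1 p.+1 = polar_rec m p.+1 - polar_rec m.+1 p by [].
by rewrite addrC subrK.
Qed.
End Polar.

Section Coinduced.
Variables (F : fieldType) (V : VOA F) (U : lmodType F) (B : V -> int).
Implicit Types (a b v : V) (f g : V -> U).

(* For every v, f (Y(a,t) v) is the expansion at t = 0 of a rational function with
   poles at 0, -1 and infinity only, of order at -1 bounded by [A] and of order at
   infinity bounded in terms of [B a]. *)
Definition isD f := lin f /\ forall a, exists A : int,
  forall (l k : int) v, A <= l -> l + k <= B a -> f (mu l k a v) = 0.

(** Some pole bound as in [isD], picked by choice so that [ptl] is a total function; by [ptl_uniq]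
    the residue does not depend on the choice. *)
Definition Aof a f : int :=
  match pselect (exists A : int, forall (l k : int) v,
    A <= l -> l + k <= B a -> f (mu l k a v) = 0) with
  | left h => sval (cid h)
  | right _ => 0
  end.

(* Res_{t = -1} (1 + t)^l t^k f (Y(a,t) v), the pole being that of the rational
   function of [isD]; k = 0 gives the action of the mode a_l on f. *)
Definition ptl (l k : int) a f v : U :=
  polar (fun l k => f (mu l k a v)) (Aof a f) (B a) l k.

Lemma AofP f a l k v : isD f -> Aof a f <= l -> l + k <= B a -> f (mu l k a v) = 0.
Proof.
move=> [_ /(_ a) h]; rewrite /Aof; case: pselect => // h'.
by case: cid => A /= hA; exact: hA.
Qed.

Lemma fmu_pascal f a v : isD f -> pascal (fun l k => f (mu l k a v)).
Proof. by move=> [fl _]; apply: pascal_lin fl (mu_pascal _ _). Qed.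

Lemma ptl_pascal f a v : isD f -> pascal (fun l k => ptl l k a f v).
Proof.
move=> fD; apply: polar_pascal; first exact: fmu_pascal.
by move=> l k; exact: AofP.
Qed.

Lemma ptl_low f a l k v : isD f -> l + k <= B a -> ptl l k a f v = - f (mu l k a v).
Proof. by move=> fD; apply: polar_low => l' k'; exact: AofP. Qed.

(** By [pascal_eq0], the values for l large and for l + k small determine a Pascal function, however
    far out these ranges lie. Linearity and all other properties of [ptl] are obtained by exhibiting
    a competitor [g]. *)
Lemma ptl_uniq f a v (g : int -> int -> U) (A B' : int) : isD f -> pascal g ->
  (forall l k : int, A <= l -> g l k = 0) ->
  (forall l k : int, l + k <= B' -> g l k = - f (mu l k a v)) ->
  forall l k, ptl l k a f v = g l k.
Proof.
move=> fD gP gA gB l k; apply/eqP; rewrite -subr_eq0; apply/eqP.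
apply: (pascal_eq0 (g := fun l k => ptl l k a f v - g l k)
  (A := Num.max A (Aof a f)) (B := Num.min B' (B a))).
- by apply: pascalB => //; exact: ptl_pascal.
- by move=> l' k'; rewrite ge_max => /andP[h1 h2]; rewrite gA // /ptl polar_high ?subrr.
- move=> l' k'; rewrite le_min => /andP[h1 h2]; rewrite gB // ptl_low //.
  by rewrite subrr.
Qed.

(** Any pole bound valid for f makes the residues vanish, not only the chosen [Aof a f]. *)
Lemma ptl_highA f a (A : int) : isD f ->
  (forall (l k : int) v, A <= l -> l + k <= B a -> f (mu l k a v) = 0) ->
  forall (l k : int) v, A <= l -> ptl l k a f v = 0.
Proof.
move=> fD fA l k v h.
rewrite (@ptl_uniq _ _ _ (polar (fun l k => f (mu l k a v)) A (B a)) A (B a)) //.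
- by rewrite polar_high.
- by apply: polar_pascal; [exact: fmu_pascal|move=> l' k'; exact: fA].
- by move=> l' k'; exact: polar_high.
- by move=> l' k'; apply: polar_low => ? ?; exact: fA.
Qed.

Lemma ptl_high f a : isD f ->
  exists A : int, forall (l k : int) v, A <= l -> ptl l k a f v = 0.
Proof. by move=> fD; exists (Aof a f) => l k v h; rewrite /ptl polar_high. Qed.

Lemma ptl_high0 f a : isD f ->
  exists A : int, forall l k : int, A <= l -> ptl l k a f = 0.
Proof. by move=> /(ptl_high a)[A h]; exists A => l k hl; apply/funext => v; exact: h. Qed.

Lemma ptl_linv f l k a : isD f -> lin (ptl l k a f).
Proof.
move=> fD c u v; have [A hA] := ptl_high a fD.
apply: (@ptl_uniq _ _ _ (fun l k => c *: ptl l k a f u + ptl l k a f v) A (B a)) => //.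
- apply: pascalD; last exact: ptl_pascal.
  by move=> l' k'; rewrite ptl_pascal // scalerDr.
- by move=> l' k' h; rewrite !hA ?scaler0 ?addr0.
- move=> l' k' h; rewrite !ptl_low // (mu_linr _ _ _ c) (proj1 fD).
  by rewrite scalerN opprD.
Qed.

Lemma isD0 : isD 0.
Proof. by split=> [c x y|a]; rewrite ?scaler0 ?addr0 //; exists 0. Qed.

Lemma isD_lin c f g : isD f -> isD g -> isD (c *: f + g).
Proof.
move=> [fl fA] [gl gA]; split=> [d x y|a].
  rewrite !(scalrfctE, addrfctE) fl gl /= !scalerDr !scalerA mulrC.
  by rewrite addrACA.
have [A hA] := fA a; have [A' hA'] := gA a.
exists (Num.max A A') => l k v; rewrite ge_max => /andP[h1 h2] h.
by rewrite !(scalrfctE, addrfctE) hA // hA' // scaler0 addr0.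
Qed.

Lemma ptl_linf l k a c f g : isD f -> isD g ->
  ptl l k a (c *: f + g) = c *: ptl l k a f + ptl l k a g.
Proof.
move=> fD gD; apply/funext => v.
have [A hA] := ptl_high a fD; have [A' hA'] := ptl_high a gD.
change (ptl l k a (c *: f + g) v = c *: ptl l k a f v + ptl l k a g v).
apply: (@ptl_uniq _ _ _ (fun l k => c *: ptl l k a f v + ptl l k a g v)
  (Num.max A A') (B a)) => //.
- exact: isD_lin.
- apply: pascalD; last exact: ptl_pascal.
  by move=> l' k'; rewrite ptl_pascal // scalerDr.
- move=> l' k'; rewrite ge_max => /andP[h1 h2].
  by rewrite hA // hA' // scaler0 addr0.
- move=> l' k' h; rewrite !ptl_low //.
  by rewrite scalerN -opprD.
Qed.

Lemma ptl_lina l k c a b f : isD f ->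
  ptl l k (c *: a + b) f = c *: ptl l k a f + ptl l k b f.
Proof.
move=> fD; apply/funext => v.
have [A hA] := ptl_high a fD; have [A' hA'] := ptl_high b fD.
change (ptl l k (c *: a + b) f v = c *: ptl l k a f v + ptl l k b f v).
apply: (@ptl_uniq _ _ _ (fun l k => c *: ptl l k a f v + ptl l k b f v)
  (Num.max A A') (Num.min (B a) (B b))) => //.
- apply: pascalD; last exact: ptl_pascal.
  by move=> l' k'; rewrite ptl_pascal // scalerDr.
- move=> l' k'; rewrite ge_max => /andP[h1 h2].
  by rewrite hA // hA' // scaler0 addr0.
- move=> l' k'; rewrite le_min => /andP[h1 h2]; rewrite !ptl_low //.
  by rewrite (mu_linl _ _ _ c) (proj1 fD) scalerN opprD.
Qed.

Lemma ptl_f0 l k a : ptl l k a 0 = 0.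
Proof.
apply/funext => v.
rewrite (@ptl_uniq _ _ _ (fun _ _ => 0) 0 0 isD0) // => [l' k'|l' k' _].
  by rewrite addr0.
by rewrite [X in - X](_ : _ = 0) ?oppr0.
Qed.

(** Residue at t2 = -1 and at t1 = 0 of f (Y(b,t2) Y(a,t1) v): the mixed stage between [mumu], with
    both residues at 0, and [pp], with both at -1. *)
Definition Hba b a f v l2 k2 l1 k1 := ptl l2 k2 b f (mu l1 k1 a v).

Lemma Hba_pasc1 b a f v : isD f -> pasc1 (Hba b a f v).
Proof. by move=> fD l2 k2; exact: ptl_pascal. Qed.
Lemma Hba_pasc2 b a f v : isD f -> pasc2 (Hba b a f v).
Proof.
by move=> fD l1 k1; apply: (pascal_lin (ptl_linv _ _ _ fD) (mu_pascal a v)).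
Qed.
Lemma Hba_vanK b a f v : isD f -> exists K, vanK (Hba b a f v) K.
Proof.
move=> fD; have [K hK] := mu_van a v; exists K => l1 k1 l2 k2 h.
by rewrite /Hba hK // (lin0 (ptl_linv _ _ _ fD)).
Qed.

Lemma Hba_low r b a f v l2 k2 l1 k1 : isD f -> l2 + k2 + r <= B b ->
  Et r (Hba b a f v) l2 k2 l1 k1 = - f (Et r (mumu b a v) l2 k2 l1 k1).
Proof.
move=> fD h; have fl := proj1 fD; have [K hK] := mumu_vanK b a v.
rewrite (Et_morph r (linD fl) (lin0 fl) (linMz fl) hK).
have zz : evz (fun i => f (mumu b a v l2 (k2 + r - i%:Z) l1 (k1 + i%:Z))).
  by have [N hN] := evzK l2 l1 k1 (fun i => k2 + r - i%:Z) hK;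
     exists N => i /hN->; rewrite (lin0 fl).
rewrite /Et -esumN; last exact: evzMz.
apply: eq_esum => i; rewrite /Hba ptl_low //; last by lia.
by rewrite mulNrz.
Qed.

Lemma Hba_EtEz r b a f v l2 k2 l1 k1 : isD f ->
  Et r (Hba b a f v) l2 k2 l1 k1 =
  Ez r (fun l1 k1 l2 k2 => Hba b a f v l2 k2 l1 k1) l1 k1 l2 k2 *~ sgnz r.
Proof.
move=> fD; have [K hK] := Hba_vanK b a v fD; have [L hL] := ptl_high b fD.
apply: (Et_Ez r (Hba_pasc1 b a v fD) (Hba_pasc2 b a v fD) hK (L := L)).
by move=> *; exact: hL.
Qed.

Lemma sgnz_inj (X : zmodType) (x : X) r : x *~ sgnz r = 0 -> x = 0.
Proof. by move=> /(congr1 (fun x => x *~ sgnz r)); rewrite -mulrzA sgnz_sqr mul0rz. Qed.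

(* Locality: for N large (t1 - t2)^N Y(a,t1) Y(b,t2) is symmetric, so multiplying by
   (z1 - z2)^N bounds the pole of [b_l f] by that of f; the bound for [b_l f] itself
   follows by descending induction on l. *)
Lemma isD_ptl f b l2 k2 : isD f -> isD (ptl l2 k2 b f).
Proof.
move=> fD; split; first exact: ptl_linv.
move=> a; have [N hN] := evz_mode 0 a b; have [fl /(_ a)[Aa hAa]] := fD.
have [Ab hAb] := ptl_high b fD.
have sw v l1 k1 l2' k2' : Et N (mumu a b v) l1 k1 l2' k2' =
    Et N (mumu b a v) l2' k2' l1 k1 *~ sgnz N.
  apply/eqP; rewrite -subr_eq0 -mu_borcherds; apply/eqP.
  apply: (J0_eq0 (N := 0%N)) => // s l k _.
  rewrite /muit; have -> : N%:Z + s%:Z = 0 + (N + s)%N%:Z by lia.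
  by rewrite hN ?(lin0 (mu_linl _ _ _)) // leq_addr.
(* As a Pascal function of (l2', k2') this vanishes for l2' >= Ab; for l2' + k2' low it is a residue
   at 0, where [sw] lets Y(a,t1) act outermost and the pole bound [Aa] applies. *)
have E0 v l1 k1 l2' k2' : Aa <= l1 -> l1 + k1 + N%:Z <= B a ->
    Et N (Hba b a f v) l2' k2' l1 k1 = 0.
  move=> h1 h2; have [K hK] := Hba_vanK b a v fD.
  apply: (pascal_eq0 (g := fun l2' k2' => Et N (Hba b a f v) l2' k2' l1 k1)
    (A := Ab) (B := B b - N%:Z)).
  - exact: (Et_pasc1 N hK (Hba_pasc1 b a v fD)).
  - by move=> l k h; apply: esum0 => i; rewrite /Hba hAb ?mul0rz.
  - move=> l k h; rewrite Hba_low //; last by lia.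
    apply/eqP; rewrite oppr_eq0; apply/eqP; apply: (sgnz_inj (r := N)).
    rewrite -(linMz fl) -sw.
    have [K' hK'] := mumu_vanK a b v.
    rewrite (Et_morph N (linD fl) (lin0 fl) (linMz fl) hK'); apply: esum0 => i.
    by rewrite /mumu hAa ?mul0rz //; lia.
have E1 v l1 k1 l2' k2' : Aa <= l1 -> l1 + k1 + N%:Z <= B a ->
    Ez N (fun l1 k1 l2 k2 => Hba b a f v l2 k2 l1 k1) l1 k1 l2' k2' = 0.
  by move=> h1 h2; apply: (sgnz_inj (r := N)); rewrite -Hba_EtEz // E0.
suff H : forall m : nat, exists A : int, forall lb kb : int, Ab - lb <= m%:Z ->
    forall (l k : int) v, A <= l -> l + k <= B a -> ptl lb kb b f (mu l k a v) = 0.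
  have [A hA] := H (absz (Ab - l2)%R); exists A => l k v.
  by apply: hA; lia.
elim=> [|m [A IH]]; first by exists 0 => lb kb h l k v _ _; apply: hAb; lia.
exists (Num.max (A + N%:Z) (Aa + N%:Z)) => lb kb hb l k v.
rewrite ge_max => /andP[h1 h2] h3.
(* The term i = 0 of [E1] is the wanted value. The terms 1 <= i <= N have b-index lb + i and fall
   under the induction hypothesis; for i > N the binomial coefficient is zero. *)
have := @E1 v (l - N%:Z) k lb kb; rewrite /Ez (@esum_one _ _ 0%N).
  rewrite /Hba expr0 mul1r binz_0r mulr1z.
  have -> : l - N%:Z + N%:Z - 0%N%:Z = l by lia.
  have -> : lb + 0%N%:Z = lb by lia.
  by apply; lia.
case=> // i _; have [hi|hi] := leqP i.+1 N.
  by rewrite /Hba IH ?mul0rz //; lia.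
by rewrite binz_nat bin_small // mulr0.
Qed.

Definition pp a b f v l1 k1 l2 k2 := ptl l1 k1 a (ptl l2 k2 b f) v.

Lemma pp_pasc1 a b f v : isD f -> pasc1 (pp a b f v).
Proof. by move=> fD l2 k2; apply: ptl_pascal; exact: isD_ptl. Qed.

Lemma pp_pasc2 a b f v : isD f -> pasc2 (pp a b f v).
Proof.
move=> fD l1 k1 l2 k2; rewrite /pp.
have -> : ptl (l2 + 1) k2 b f = 1 *: ptl l2 k2 b f + ptl l2 (k2 + 1) b f.
  by apply/funext => u; rewrite ptl_pascal // scale1r.
by rewrite ptl_linf ?scale1r //; exact: isD_ptl.
Qed.

Lemma pp_vanL a b f v : isD f -> exists L, vanL (pp a b f v) L.
Proof.
move=> fD; have [L hL] := ptl_high0 b fD; exists L => l1 k1 l2 k2 h.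
by rewrite /pp hL // ptl_f0.
Qed.

Lemma Ezpp_high1 r a b f v : isD f -> forall l2 k2, exists L : int, forall l1 k1,
  L <= l1 -> Ez r (pp a b f v) l1 k1 l2 k2 = 0.
Proof.
move=> fD l2 k2; have [L hL] := pp_vanL a b v fD.
pose N := absz (L - l2)%R.
have h s : exists A : int, forall l, A <= l -> forall k, pp a b f v l k (l2 + s%:Z) k2 = 0.
  have [A hA] := ptl_high a (isD_ptl b (l2 + s%:Z) k2 fD).
  by exists A => l hl k; exact: hA.
have [M hM] := bound_fin h N; exists (M - r + N%:Z) => l1 k1 hl; apply: esum0 => i.
case: (ltnP i N) => hi; last by rewrite hL ?mul0rz //; lia.
by rewrite (hM i hi) ?mul0rz //; lia.
Qed.

Lemma Ezpp_high2 r a b f v : isD f -> exists L : int, forall l1 k1 l2 k2,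
  L <= l2 -> Ez r (pp a b f v) l1 k1 l2 k2 = 0.
Proof.
move=> fD; have [L hL] := pp_vanL a b v fD; exists L => l1 k1 l2 k2 h.
by apply: esum0 => i; rewrite hL ?mul0rz //; lia.
Qed.

(** The residue in t2, then the one in t1, is moved from 0 to -1. Each move costs a sign when the
    total degree is low, and in between [Hba_EtEz] changes the expansion of the power of t1 - t2. *)
Lemma pp_low r a b f v l1 k1 l2 k2 : isD f ->
  l1 + k1 + r <= B a -> l2 + k2 + r <= B b ->
  f (Et r (mumu b a v) l2 k2 l1 k1) = Ez r (pp a b f v) l1 k1 l2 k2 *~ sgnz r.
Proof.
move=> fD h1 h2; have [L hL] := ptl_high b fD.
rewrite -[LHS]opprK -Hba_low // Hba_EtEz // -mulNrz /Ez -esumN.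
  congr (_ *~ _); apply: eq_esum => i; rewrite -mulNrz; congr (_ *~ _).
  by rewrite /pp ptl_low //; [exact: isD_ptl|lia].
apply: evzMz; exists (absz (L - l2)%R) => i hi; apply: hL; lia.
Qed.

Definition ptlit r a b f v (s : nat) l k := ptl l k (mode V (r + s%:Z) a b) f v.

Lemma ptl_a0 l k f : isD f -> ptl l k 0 f = 0.
Proof.
move=> fD; apply/funext => v.
rewrite (@ptl_uniq _ _ _ (fun _ _ => 0) 0 0 fD) // => [l' k'|l' k' _].
  by rewrite addr0.
by rewrite (lin0 (mu_linl _ _ _)) (lin0 (proj1 fD)) oppr0.
Qed.

(* The difference of both sides vanishes when both total degrees l1 + k1, l2 + k2
   are low, by [mu_borcherds], and when one of l1, l2 is large, the other pair of
   exponents being fixed. *)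
Lemma ptl_borcherds r a b f v l1 k1 l2 k2 : isD f ->
  J0 (ptlit r a b f v) l1 k1 l2 k2 =
  Ez r (pp a b f v) l1 k1 l2 k2 - Ez r (pp b a f v) l2 k2 l1 k1 *~ sgnz r.
Proof.
move=> fD; have fl := proj1 fD.
have [N hN] := evz_mode r a b.
have Pz s l k : (N <= s)%N -> ptlit r a b f v s l k = 0.
  by move=> /hN h; rewrite /ptlit h ptl_a0.
have Mz s l k : (N <= s)%N -> muit r a b v s l k = 0.
  by move=> /hN h; rewrite /muit h (lin0 (mu_linl _ _ _)).
have PP s : pascal (ptlit r a b f v s) by exact: ptl_pascal.
have [L hL] := pp_vanL a b v fD; have [L' hL'] := pp_vanL b a v fD.
pose d l1 k1 l2 k2 := J0 (ptlit r a b f v) l1 k1 l2 k2 -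
  (Ez r (pp a b f v) l1 k1 l2 k2 - Ez r (pp b a f v) l2 k2 l1 k1 *~ sgnz r).
have d1 : pasc1 d.
  move=> l2' k2'; apply: pascalB; first exact: (J0_pasc1 PP Pz).
  apply: pascalB; first exact: (Ez_pasc1 r hL (pp_pasc1 a b v fD)).
  by apply: pascalMz; exact: (Ez_pasc2 r hL' (pp_pasc2 b a v fD)).
have d2 : pasc2 d.
  move=> l1' k1'; apply: pascalB; first exact: (J0_pasc2 PP Pz).
  apply: pascalB; first exact: (Ez_pasc2 r hL (pp_pasc2 a b v fD)).
  by apply: pascalMz; exact: (Ez_pasc1 r hL' (pp_pasc1 b a v fD)).
have hB (s : nat) : exists K : int, forall m : int, K <= m -> - m <= B (mode V (r + s%:Z) a b).
  by exists (- B (mode V (r + s%:Z) a b)) => m h; lia.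
have [M hM] := bound_fin hB N.
(* So low that all residues at 0 in [mu_borcherds], for a, for b and for the a_(r+s) b with s < N,
   turn into residues at -1. *)
pose D : int := - (`|M| + `|B a| + `|B b| + `|r|).
have low : forall l1 k1 l2 k2 : int, l1 + k1 <= D -> l2 + k2 <= D -> d l1 k1 l2 k2 = 0.
  move=> {}l1 {}k1 {}l2 {}k2 h1 h2; rewrite /d.
  have -> : J0 (ptlit r a b f v) l1 k1 l2 k2 = - f (J0 (muit r a b v) l1 k1 l2 k2).
    rewrite -(linN fl) (J0_morph (f := fun x => f (- x)) (N := N)) //.
    - apply: eq_esum => i; congr (_ *~ _); apply: eq_esum => j; congr (_ *~ _).
      have [hij|hij] := ltnP (i + j) N.
        rewrite /ptlit ptl_low //.
          by rewrite (linN fl).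
        have := hM (i + j)%N hij M (lexx _); rewrite /D in h1 h2; lia.
      by rewrite Pz // Mz // (linN fl) (lin0 fl) oppr0.
    - by move=> x y; rewrite opprD (linD fl).
    - by rewrite oppr0 (lin0 fl).
    - by move=> x m; rewrite -mulNrz (linMz fl).
  rewrite mu_borcherds (linB fl) (linMz fl).
  rewrite (@pp_low r a b); [|done|rewrite /D in h1 h2; lia|rewrite /D in h1 h2; lia].
  rewrite (@pp_low r b a); [|done|rewrite /D in h1 h2; lia|rewrite /D in h1 h2; lia].
  by rewrite -mulrzA sgnz_sqr mulr1z [X in X - _]opprB subrr.
have [H hH] := bound_fin (P := fun s l => forall k, ptlit r a b f v s l k = 0)
  (fun s => let: ex_intro A h := ptl_high (mode V (r + s%:Z) a b) fD in
     ex_intro _ A (fun l H k => h l k v H)) N.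
have vJ : forall l1 k1 l2 k2 : int, H + N%:Z <= l1 + l2 -> J0 (ptlit r a b f v) l1 k1 l2 k2 = 0.
  move=> {}l1 {}k1 {}l2 {}k2 h; apply: (J0_eq0 Pz) => i j hij; apply: (hH _ hij); lia.
have [L2 hL2] := Ezpp_high2 r a b v fD; have [L2' hL2'] := Ezpp_high2 r b a v fD.
have step1 : forall l1 k1 : int, l1 + k1 <= D -> forall l2 k2, d l1 k1 l2 k2 = 0.
  move=> {}l1 {}k1 h l k; have [L1 hL1] := Ezpp_high1 r b a v fD l1 k1.
  apply: (pascal_eq0 (A := `|L1| + `|L2| + `|H| + N%:Z + `|l1|) (B := D) (d2 l1 k1)).
    move=> l' k' h'; rewrite /d vJ; last by lia.
    rewrite hL2; last by lia.
    by rewrite hL1 ?mul0rz ?subrr //; lia.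
  by move=> l' k'; exact: low.
suff : d l1 k1 l2 k2 = 0 by move=> /eqP; rewrite subr_eq0 => /eqP.
have [L1 hL1] := Ezpp_high1 r a b v fD l2 k2.
apply: (pascal_eq0 (A := `|L1| + `|L2'| + `|H| + N%:Z + `|l2|) (B := D) (d1 l2 k2)).
  move=> l' k' h'; rewrite /d vJ; last by lia.
  rewrite hL1; last by lia.
  by rewrite hL2' ?mul0rz ?subrr //; lia.
by move=> l' k' h; exact: step1.
Qed.

Lemma ptl_borcherds_modes r a b f v p q : isD f ->
  esum (fun i => ptl (p + q - i%:Z) 0 (mode V (r + i%:Z) a b) f v *~ binz p i) =
  esum (fun i => ptl (p + r - i%:Z) 0 a (ptl (q + i%:Z) 0 b f) v *~ ((-1) ^+ i * binz r i))
  - esum (fun i => ptl (q + r - i%:Z) 0 b (ptl (p + i%:Z) 0 a f) v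
            *~ ((-1) ^+ i * binz r i)) *~ sgnz r.
Proof. by move=> fD; rewrite -(J0_k0 (ptlit r a b f v)) ptl_borcherds. Qed.
End Coinduced.

(** * Divided powers and the vacuum *)

Definition bz (p m : int) : int := if m is Posz i then binz p i else 0.

Lemma bz_neg p m : m < 0 -> bz p m = 0.
Proof. by case: m. Qed.

Lemma bzS p m : bz (p + 1) m = bz p m + bz p (m - 1).
Proof.
case: m => [[|m]|m] //; first by rewrite /= !binz_0r addr0.
have -> : Posz m.+1 - 1 = Posz m by lia.
exact: binzS.
Qed.

Lemma bz0 m : bz 0 m = (m == 0)%:R.
Proof. by case: m => [m|m] //; rewrite /bz binz_0l. Qed.

(* Res_{t = 0} and Res_{t = -1} of (1 + t)^l t^k *)
Definition res0 (l k : int) : int := bz l (- k - 1).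
Definition resm1 (l k : int) : int := sgnz (k + l + 1) * bz k (- l - 1).

Lemma res0_pascal : pascal res0.
Proof. by move=> l k; rewrite /res0 bzS; congr (_ + bz _ _); lia. Qed.

Lemma resm1_pascal : pascal resm1.
Proof.
move=> l k; rewrite /resm1 bzS.
have -> : k + (l + 1) + 1 = k + l + 1 + 1 by lia.
have -> : k + 1 + l + 1 = k + l + 1 + 1 by lia.
have -> : - (l + 1) - 1 = - l - 1 - 1 by lia.
by rewrite sgnzS mulrDr !mulNr addrA subrr add0r.
Qed.

(** The residues of (1 + t)^l t^k at 0, -1 and infinity add up to zero, and the one at infinity
    vanishes for l + k <= -2. *)
Lemma res0_resm1 (l k : int) : l + k <= - 2%:Z -> resm1 l k = - res0 l k.
Proof.
move=> h; rewrite /resm1 /res0.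
case: l h => a; case: k => b h; first by lia.
- rewrite bz_neg ?mulr0; last by lia.
  have -> : - Negz b - 1 = Posz b by lia.
  by rewrite /= bin_small ?oppr0 //; lia.
- rewrite [bz _ (- Posz b - 1)]bz_neg; last by lia.
  have -> : - Negz a - 1 = Posz a by lia.
  by rewrite /= bin_small ?mulr0 ?oppr0 //; lia.
have -> : - Negz b - 1 = Posz b by lia.
have -> : - Negz a - 1 = Posz a by lia.
have -> : Negz b + Negz a + 1 = - (a + b).+1%:Z by lia.
rewrite /sgnz abszN absz_nat /= mulrA -exprD.
have -> : ((a + b).+1 + a = (a + a + b).+1)%N by lia.
rewrite exprS exprD addnn -muln2 exprM sqrr_sign mul1r mulN1r mulNr.
by congr (- (_ * _)); rewrite addnC -[in RHS]bin_sub ?leq_addl // addnK addnC.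
Qed.

Section DividedPowers.
Variables (F : fieldType) (V : VOA F).
Implicit Types a b v : V.

(** This is D^m v / m! for D = L(-1) in characteristic 0, in a form that makes sense in every
    characteristic. *)
Definition Dz (m : int) v : V := mode V (- m - 1) v (vac V).

Lemma Dz_0 v : Dz 0 v = v.
Proof. by rewrite /Dz oppr0 sub0r; case: (creation v). Qed.

Lemma Dz_neg m v : m < 0 -> Dz m v = 0.
Proof. by move=> h; case: (creation v) => _; apply; lia. Qed.

(* e^{sD} Y(a,t) v = Y(a, t + s) e^{sD} v *)
Lemma Dz_mode m r a v : Dz m (mode V r a v) =
  esum (fun i => mode V (r - i%:Z) a (Dz (m - i%:Z) v) *~ ((-1) ^+ i * binz r i)).
Proof.
have := borcherds_esum (@mode_trunc _ V) (mode_bilin V) (@mode_trunc _ V) (@jacobi _ V)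
  0 (- m - 1) r a v (vac V).
rewrite (esum_binz0 (fun i => mode V (0 + (- m - 1) - i%:Z) (mode V (r + i%:Z) a v) (vac V))).
rewrite add0r subr0 addr0 {1}/Dz => ->.
rewrite [X in _ - X *~ _]esum0 ?mul0rz ?subr0 => [|i].
  apply: eq_esum => i; congr (mode V _ _ _ *~ _); first by lia.
  by congr (mode V _ _ _); lia.
by rewrite add0r (proj2 (creation a)) // (lin0 (mode_linr _ _)) mul0rz.
Qed.

Lemma mu_vac l k v : mu l k (vac V) v = v *~ res0 l k.
Proof.
apply/eqP; rewrite -subr_eq0; apply/eqP.
have [K hK] := mu_van (vac V) v.
apply: (pascal_eq00 (g := fun l k => mu l k (vac V) v - v *~ res0 l k) (K := `|K|)).
- apply: pascalB; first exact: mu_pascal.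
  by move=> l' k'; rewrite res0_pascal mulrzDr.
- move=> k'; rewrite mu_l0 vac_id /res0 bz0.
  have -> : (- k' - 1 == 0) = (k' == -1) by lia.
  by case: eqP => _; rewrite ?mulr1z ?mulr0z subrr.
- by move=> l' k' h; rewrite hK /res0 ?bz_neg ?mulr0z ?subrr //; lia.
Qed.

Section Twist.
Variables (X : zmodType) (E : int) (G : int -> int -> int -> X).
Hypothesis GP : forall m, pascal (G m).
Hypothesis Gn : forall m l k, m < 0 -> G m l k = 0.

Let R m l k : X := esum (fun i => G (m - i%:Z) l (k - i%:Z) *~ ((-1) ^+ i * binz k i)).
(** For G m l k = f (mu l k a (Dz m v)) and l = 0, [R] is f (Dz m (a_k v)) by [Dz_mode], so the
    vanishing of [twist] is [Dprop] at a_k v. The form with all l makes sense for residues at -1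
    too, where k = 0 is the case of interest. *)
Definition twist m l k : X := G 0 l k *~ bz (E + k + l) m - R m l k.

Let evzG m (f g : nat -> int) : evz (fun i => G (m - i%:Z) (f i) (g i)).
Proof. by exists (absz m).+1 => i h; apply: Gn; lia. Qed.

Lemma twistS m l k :
  twist m (l + 1) k = twist m l k + twist m l (k + 1) + twist (m - 1) l k.
Proof.
have e1 : R m (l + 1) k = R m l k + R m l (k + 1) + R (m - 1) l k.
  have -> : R m l (k + 1) = esum (fun i => G (m - i%:Z) l (k - i%:Z + 1)
      *~ ((-1) ^+ i * binz k i)) - R (m - 1) l k.
    rewrite /R (esum_sbinzS (x := fun i => G (m - i%:Z) l (k + 1 - i%:Z))) //.
    congr (_ - _); apply: eq_esum => i; congr (G _ _ _ *~ _); lia.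
  rewrite -addrA subrK -esumD; try exact: evzMz.
  by apply: eq_esum => i; rewrite GP mulrzDl.
have e2 : E + k + (l + 1) = E + k + l + 1 by lia.
have e3 : E + (k + 1) + l = E + k + l + 1 by lia.
rewrite /twist e1 e2 e3 GP mulrzDl {1}bzS mulrzDr !opprD.
set x1 := G 0 l k *~ bz _ m; set x2 := G 0 l k *~ bz _ (m - 1).
set x3 := G 0 l (k + 1) *~ _.
set y1 := R m l k; set y2 := R m l (k + 1); set y3 := R _ _ _.
by rewrite (addrAC x1 x2) addrACA [x1 + x3 + _]addrACA.
Qed.

Lemma twist_neg m l k : m < 0 -> twist m l k = 0.
Proof.
by move=> h; rewrite /twist bz_neg // mulr0z sub0r /R esum0 ?oppr0 // => i;
   rewrite Gn ?mul0rz //; lia.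
Qed.

(** Induction on m: once twist (m - 1) vanishes, [twistS] is the Pascal rule for twist m, and the
    uniqueness lemmas apply. *)
Lemma twist_eq0 : (forall m, pascal (twist m) -> forall l k, twist m l k = 0) ->
  forall m l k, twist m l k = 0.
Proof.
move=> h; case=> [m|m]; last by move=> l k; exact: twist_neg.
have P m' : (forall l k, twist (m' - 1) l k = 0) -> pascal (twist m').
  by move=> h' l k; rewrite twistS h' addr0.
elim: m => [|m IH] l k; apply: h; apply: P => l' k'.
  by apply: twist_neg; lia.
have -> : Posz m.+1 - 1 = Posz m by lia.
exact: IH.
Qed.

Lemma twist_k0 m l : twist m l 0 = G 0 l 0 *~ bz (E + l) m - G m l 0.
Proof.
rewrite /twist /R (esum_sbinz0 (fun i => G (m - i%:Z) l (0 - i%:Z))).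
by rewrite addr0; congr (_ - G _ _ _); lia.
Qed.
End Twist.

Variables (U : lmodType F) (B : V -> int).
Implicit Types f : V -> U.

(** In generating form, f (e^(tD) v) = (1 + t)^(E - deg v) f v. *)
Definition Dprop (E : int) f := forall (dv : int) v (m : int), homog dv v ->
  f (Dz m v) = f v *~ bz (E - dv) m.

(** For residues at 0 ([G]) the twisted relation holds on l = 0 by [Dz_mode] and the hypothesis at
    b_k v, hence for all l. Residues at -1 ([H]) satisfy it for l large by the pole bound and for l
    + k low by comparison with [G], hence everywhere. *)
Lemma Dprop_ptl E f b (db l : int) : isD B f -> Dprop E f -> homog db b ->
  Dprop (E - (db - l - 1)) (ptl B l 0 b f).
Proof.
move=> fD fE hb dv v m hv; have fl := proj1 fD.
pose E' := E - db - dv + 1.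
pose G m l k := f (mu l k b (Dz m v)).
have GP m' : pascal (G m') by exact: (fmu_pascal _ _ fD).
have Gn m' l' k' : m' < 0 -> G m' l' k' = 0.
  by move=> h; rewrite /G Dz_neg // (lin0 (mu_linr _ _ _)) (lin0 fl).
have c0 m' l' k' : twist E' G m' l' k' = 0.
  apply: (twist_eq0 GP Gn) => {}m' P {}l' {}k'.
  have hK (s : nat) : exists K : int, forall k, K <= k -> forall l, G (m' - s%:Z) l k = 0.
    have [K hK] := mu_van b (Dz (m' - s%:Z) v); exists K => k h l0.
    by rewrite /G hK // (lin0 fl).
  have [K {}hK] := bound_fin hK (absz m').+1.
  have [K0 hK0] := mu_van b (Dz 0 v).
  apply: (pascal_eq00 (K := `|K| + `|m'| + 1 + `|K0|) P) => [k|l0 k h].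
    rewrite /twist {1}/G mu_l0 addr0 Dz_0.
    have -> : esum (fun i => G (m' - i%:Z) 0 (k - i%:Z) *~ ((-1) ^+ i * binz k i)) =
              f (Dz m' (mode V k b v)).
      rewrite Dz_mode (esum_lin fl); last first.
        by exists (absz m').+1 => i h; rewrite Dz_neg ?(lin0 (mode_linr _ _)) ?mul0rz //; lia.
      by apply: eq_esum => i; rewrite (linMz fl) /G mu_l0.
    rewrite (fE (db + dv - k - 1)); last exact: mode_deg.
    by apply/eqP; rewrite subr_eq0; apply/eqP; congr (_ *~ bz _ _); rewrite /E'; lia.
  rewrite /twist {1}/G hK0; last by lia.
  rewrite (lin0 fl) mul0rz sub0r esum0 ?oppr0 // => i.
  have [hi|hi] := ltnP i (absz m').+1; last by rewrite Gn ?mul0rz //; lia.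
  by rewrite hK ?mul0rz //; lia.
pose H m l k := ptl B l k b f (Dz m v).
have HP m' : pascal (H m') by exact: ptl_pascal.
have Hn m' l' k' : m' < 0 -> H m' l' k' = 0.
  by move=> h; rewrite /H Dz_neg // (lin0 (ptl_linv _ _ _ fD)).
have [A hA] := ptl_high b fD.
have : twist E' H m l 0 = 0.
  apply: (twist_eq0 HP Hn) => m' P; apply: (pascal_eq0 (A := A) (B := B b) P) => l' k' h.
    by rewrite /twist /H hA // mul0rz sub0r esum0 ?oppr0 // => i; rewrite hA ?mul0rz.
  have -> : twist E' H m' l' k' = - twist E' G m' l' k'; last by rewrite c0 oppr0.
  rewrite /twist opprB [RHS]addrC; congr (_ + _).
    by rewrite /H ptl_low // mulNrz.
  rewrite -esumN; last first.
    by exists (absz m').+1 => i h'; rewrite Hn ?mul0rz //; lia.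
  apply: eq_esum => i; rewrite /H ptl_low //; last by lia.
  by rewrite mulNrz opprK.
rewrite (twist_k0 E' H) => /eqP; rewrite subr_eq0 => /eqP; rewrite /H Dz_0 => <-.
by congr (_ *~ bz _ _); rewrite /E'; lia.
Qed.

(* f (Y(v,t) 1) = (1 + t)^w f v with w = E - deg v, so this is Res_{t = -1} of
   (1 + t)^(-1) f v. *)
Lemma ptl_vacuum E f v (dv : int) : isD B f -> Dprop E f -> homog dv v ->
  ptl B (dv - E - 1) 0 v f (vac V) = f v.
Proof.
move=> fD fE hv; have fl := proj1 fD.
have e l k : f (mu l k v (vac V)) = f v *~ res0 (l + (E - dv)) k.
  apply/eqP; rewrite -subr_eq0; apply/eqP.
  have [K hK] := mu_van v (vac V).
  apply: (pascal_eq00 (g := fun l k => f (mu l k v (vac V)) - f v *~ res0 (l + (E - dv)) k)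
    (K := `|K|)).
  - apply: pascalB; first exact: (fmu_pascal _ _ fD).
    by move=> l' k'; rewrite addrAC res0_pascal mulrzDr.
  - move=> k'; rewrite mu_l0 add0r /res0 -(fE dv) //.
    rewrite /Dz; have -> : - (- k' - 1) - 1 = k' by lia.
    by rewrite subrr.
  - by move=> l' k' h; rewrite hK /res0 ?bz_neg ?(lin0 fl) ?mulr0z ?subrr //; lia.
rewrite (@ptl_uniq _ _ _ B f v _ (fun l k => f v *~ resm1 (l + (E - dv)) k)
  (- (E - dv)) (- 2%:Z - (E - dv)) fD).
- rewrite /resm1; have -> : dv - E - 1 + (E - dv) = -1 by lia.
  by rewrite mulr1z.
- by move=> l' k'; rewrite addrAC resm1_pascal mulrzDr.
- by move=> l' k' h; rewrite /resm1 bz_neg ?mulr0 ?mulr0z //; lia.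
- move=> l' k' h; rewrite e res0_resm1 ?mulrNz //; lia.
Qed.

Lemma ptl_vac f l k v : isD B f -> ptl B l k (vac V) f v = f v *~ resm1 l k.
Proof.
move=> fD; have fl := proj1 fD.
apply: (@ptl_uniq _ _ _ B f (vac V) v (fun l k => f v *~ resm1 l k) 0 (- 2%:Z) fD).
- by move=> l' k'; rewrite resm1_pascal mulrzDr.
- by move=> l' k' h; rewrite /resm1 bz_neg ?mulr0 ?mulr0z //; lia.
- by move=> l' k' h; rewrite mu_vac (linMz fl) res0_resm1 ?mulrNz.
Qed.

Lemma ptl_vac0 f l : isD B f -> ptl B l 0 (vac V) f = if l == -1 then f else 0.
Proof.
move=> fD; apply/funext => v; rewrite ptl_vac // /resm1 bz0.
case: (l =P -1) => [->|h]; first by rewrite mulr1z.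
have -> : (- l - 1 == 0) = false by lia.
by rewrite mulr0 mulr0z.
Qed.
End DividedPowers.

(** * The action of A_n(V) on M(n) *)

Lemma big_sub_uniq (X : zmodType) (I : eqType) (r r' : seq I) (G : I -> X) :
  uniq r -> uniq r' -> (forall k, k \notin r -> G k = 0) ->
  (forall k, k \notin r' -> G k = 0) -> \sum_(k <- r) G k = \sum_(k <- r') G k.
Proof.
move=> ur ur' h h'.
have E (s t : seq I) : uniq s -> (forall k, k \notin t -> G k = 0) ->
    \sum_(k <- s) G k = \sum_(k <- [seq x <- s | x \in t]) G k.
  move=> us hs; rewrite big_filter [RHS]big_mkcond; apply: eq_bigr => k _.
  by case: ifPn => // /hs.
rewrite (E r r') // (E r' r) //; apply: perm_big; apply: uniq_perm; rewrite ?filter_uniq //.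
by move=> k; rewrite !mem_filter andbC.
Qed.

Section Subspaces.
Variables (F : fieldType) (X : lmodType F).

Definition subsp (S : X -> Prop) := S 0 /\ forall (c : F) x y, S x -> S y -> S (c *: x + y).

Variables (S : X -> Prop) (SS : subsp S).
Lemma subspD x y : S x -> S y -> S (x + y).
Proof. by move=> hx hy; rewrite -[x]scale1r; apply: (proj2 SS). Qed.
Lemma subspZ c x : S x -> S (c *: x).
Proof. by move=> hx; rewrite -[_ *: _]addr0; apply: (proj2 SS) => //; case: SS. Qed.
Lemma subspMz x (m : int) : S x -> S (x *~ m).
Proof. by move=> hx; rewrite -scaler_int; exact: subspZ. Qed.
Lemma subspB x y : S x -> S y -> S (x - y).
Proof. by move=> hx hy; apply: subspD => //; rewrite -scaleN1r; exact: subspZ. Qed.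
Lemma subsp_sum (I : Type) (r : seq I) (P : pred I) G :
  (forall i, P i -> S (G i)) -> S (\sum_(i <- r | P i) G i).
Proof. by move=> h; apply: big_ind => //; [case: SS|exact: subspD]. Qed.
Lemma subsp_esum (g : nat -> X) : (forall i, S (g i)) -> S (esum g).
Proof.
move=> h; rewrite /esum; case: pselect => [h'|_]; last by case: SS.
exact: subsp_sum.
Qed.

Inductive lspan (G : X -> Prop) : X -> Prop :=
| lspan_gen x : G x -> lspan G x
| lspan_0 : lspan G 0
| lspan_lin c x y : lspan G x -> lspan G y -> lspan G (c *: x + y).

Lemma lspan_subsp G : subsp (lspan G).
Proof. by split; [exact: lspan_0|exact: lspan_lin]. Qed.

Lemma lspan_min G : (forall x, G x -> S x) -> forall x, lspan G x -> S x.
Proof.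
move=> h x; elim=> [{}x /h //||c {}x y _ hx _ hy]; first by case: SS.
exact: (proj2 SS).
Qed.
End Subspaces.

Lemma lspan_lin_image (F : fieldType) (X Y : lmodType F) (f : X -> Y)
    (G : X -> Prop) (T : Y -> Prop) :
  lin f -> subsp T -> (forall x, G x -> T (f x)) -> forall x, lspan G x -> T (f x).
Proof.
move=> fl TT h; apply: (lspan_min (S := fun x => T (f x))) => //.
by split=> [|c x y hx hy]; rewrite ?(lin0 fl) ?fl; [case: TT|exact: (proj2 TT)].
Qed.

Section Homogeneous.
Variables (F : fieldType) (V : VOA F).
Implicit Types a b v : V.

Lemma gr_lin k : lin (gr V k).
Proof. by move=> c x y; case: (grading_ax V) => h _; exact: h. Qed.
Lemma gr_gr k l x : gr V k (gr V l x) = if k == l then gr V k x else 0.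
Proof. by case: (grading_ax V) => _ [h _]; exact: h. Qed.
Lemma supp_uniq x : uniq (supp V x).
Proof. by case: (grading_ax V) => _ [_ [h _]]; exact: h. Qed.
Lemma gr_supp x k : k \notin supp V x -> gr V k x = 0.
Proof. by case: (grading_ax V) => _ [_ [_ [h _]]]; exact: h. Qed.
Lemma gr_sum x : x = \sum_(k <- supp V x) gr V k x.
Proof. by case: (grading_ax V) => _ [_ [_ [_ h]]]; exact: h. Qed.
Lemma homog_gr k x : homog k (gr V k x).
Proof. by rewrite /homog gr_gr eqxx. Qed.
Lemma gr_homog k s x : homog s x -> gr V k x = if k == s then x else 0.
Proof. by move=> h; rewrite -[in LHS]h gr_gr; case: eqP => // ->; exact: h. Qed.

Lemma subsp_homog (X : lmodType F) (f : V -> X) (T : X -> Prop) : lin f -> subsp T ->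
  (forall s v, homog s v -> T (f v)) -> forall v, T (f v).
Proof.
move=> fl TT h v; rewrite (gr_sum v) (lin_sum fl); apply: subsp_sum => // s _.
exact: h (homog_gr s v).
Qed.

Lemma subsp0 (X : lmodType F) : subsp (fun x : X => x = 0).
Proof. by split=> // c x y -> ->; rewrite scaler0 addr0. Qed.

Lemma lin_homog_eq (X : lmodType F) (f g : V -> X) : lin f -> lin g ->
  (forall s v, homog s v -> f v = g v) -> forall v, f v = g v.
Proof.
move=> fl gl h v; apply/eqP; rewrite -subr_eq0; apply/eqP.
apply: (subsp_homog (f := fun v => f v - g v) (T := fun x => x = 0)).
- by move=> c x y; rewrite fl gl opprD addrACA scalerBr.
- exact: subsp0.
- by move=> s v' /h->; rewrite subrr.
Qed.

Variables (X : lmodType F) (g : int -> V -> X).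
Hypothesis gl : forall k, lin (g k).

Definition hext a : X := \sum_(k <- supp V a) g k (gr V k a).

Lemma hext_seq (r : seq int) a : uniq r -> (forall k, k \notin r -> gr V k a = 0) ->
  hext a = \sum_(k <- r) g k (gr V k a).
Proof.
move=> ur hr; apply: big_sub_uniq => //; first exact: supp_uniq.
  by move=> k /gr_supp->; rewrite (lin0 (gl k)).
by move=> k /hr->; rewrite (lin0 (gl k)).
Qed.

Lemma hext_lin : lin hext.
Proof.
move=> c a b.
pose r := undup (supp V a ++ supp V b).
have nr k : k \notin r -> k \notin supp V a /\ k \notin supp V b.
  by rewrite mem_undup mem_cat negb_or => /andP[].
rewrite (@hext_seq r) ?undup_uniq //; last first.
  by move=> k /nr[/gr_supp h1 /gr_supp h2]; rewrite gr_lin h1 h2 scaler0 addr0.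
rewrite (@hext_seq r a) ?undup_uniq //; last by move=> k /nr[/gr_supp].
rewrite (@hext_seq r b) ?undup_uniq //; last by move=> k /nr[_ /gr_supp].
rewrite scaler_sumr -big_split; apply: eq_bigr => k _.
by rewrite gr_lin gl.
Qed.

Lemma hext_homog s a : homog s a -> hext a = g s a.
Proof.
move=> h; rewrite (@hext_seq [:: s]) // => [|k]; first by rewrite big_seq1 h.
by rewrite inE (gr_homog _ h) => /negPf->.
Qed.
End Homogeneous.

Section SpanningModes.
Variables (F : fieldType) (V : VOA F) (X : lmodType F) (act : int -> V -> X -> X) (w : X).
Hypothesis act0 : forall k a, act k a 0 = 0.
Hypothesis act_trunc : forall a, exists N : int, forall k, N <= k -> act k a w = 0.
Hypothesis act_bor : forall (p q r : int) u v,
  esum (fun i => act (p + q - i%:Z) (mode V (r + i%:Z) u v) w *~ binz p i) =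
  esum (fun i => act (p + r - i%:Z) u (act (q + i%:Z) v w) *~ ((-1) ^+ i * binz r i))
  - esum (fun i => act (q + r - i%:Z) v (act (p + i%:Z) u w) *~ ((-1) ^+ i * binz r i))
    *~ sgnz r.

(* Take Borcherds' identity with p so large that a_p w = 0, and induct downwards
   on the index q of the inner mode. *)
Lemma span_modes (S : X -> Prop) (da db p q : int) a b : subsp S ->
  homog da a -> homog db b ->
  (forall (s k : int) c, homog s c -> s - k = da + db - p - q - 1 -> S (act k c w)) ->
  S (act p a (act q b w)).
Proof.
move=> SS ha hb; have [K hK] := act_trunc b; have [P hP] := act_trunc a.
suff H : forall (m : nat) (p q : int), K - q <= m%:Z ->
    (forall (s k : int) c, homog s c -> s - k = da + db - p - q - 1 -> S (act k c w)) ->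
    S (act p a (act q b w)).
  by apply: (H (absz (K - q)%R)); lia.
elim=> [|m IH] {}p {}q h hS.
  by rewrite hK ?act0; [case: SS|lia].
have := act_bor P q (p - P) a b.
rewrite [X in _ = _ - X *~ _]esum0 => [|i]; last first.
  by rewrite hP ?act0 ?mul0rz //; lia.
rewrite mul0rz subr0.
rewrite (@esum_recl _ (fun i => act (P + (p - P) - i%:Z) a (act (q + i%:Z) b w) *~ _)).
  2: by exists (absz (K - q)%R) => i hi; rewrite hK ?act0 ?mul0rz //; lia.
rewrite expr0 mul1r binz_0r mulr1z.
have -> : P + (p - P) - 0%N%:Z = p by lia.
have -> : q + 0%N%:Z = q by lia.
set lhs := (X in X = _); set rest := (X in _ = _ + X) => E.
have -> : act p a (act q b w) = lhs - rest by rewrite E addrK.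
apply: subspB => //; apply: subsp_esum => // i; apply: subspMz => //.
  apply: hS; first exact: (mode_deg (p - P + i%:Z) ha hb).
  by lia.
have -> : P + (p - P) - i.+1%:Z = p - i.+1%:Z by lia.
by apply: IH => [|s k c hc hk]; [lia|apply: (hS s) => //; lia].
Qed.
End SpanningModes.

Lemma binz1 p : binz p 1 = p.
Proof.
case: p => m; first by rewrite /= bin1.
by rewrite /= expr1 mulN1r bin1 NegzE addn1.
Qed.

(** Since binom(j+n,n) binom(n+k,k-j) = binom(n+k,k) binom(k,j), the sum is a multiple of (1 -
    1)^k. *)
Lemma bin_conv (n k : nat) : (0 < k)%N ->
  \sum_(j < k.+1) (-1) ^+ j * ('C(j + n, n) * 'C(n + k, k - j))%N%:Z = 0 :> int.
Proof.
move=> k0.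
have E (j : 'I_k.+1) : (-1) ^+ j * ('C(j + n, n) * 'C(n + k, k - j))%N%:Z =
    ('C(n + k, k))%:Z * (1 ^+ (k - j) * (-1) ^+ j *+ 'C(k, j)) :> int.
  have hj : (j <= k)%N by rewrite -ltnS.
  have -> : ('C(j + n, n) * 'C(n + k, k - j) = 'C(n + k, k) * 'C(k, j))%N.
    apply/eqP; rewrite -(eqn_pmul2r (m := n`! * j`! * (k - j)`!)) ?muln_gt0 ?fact_gt0 //.
    apply/eqP; transitivity (n + k)`!%N.
      rewrite -(bin_fact (n := n + k) (m := k - j)); last by lia.
      have -> : (n + k - (k - j) = j + n)%N by lia.
      by rewrite -(bin_fact (n := j + n) (m := n)) ?leq_addl // addnK; lia.
    rewrite -(bin_fact (n := n + k) (m := k)) ?leq_addl // addnK -(bin_fact hj); lia.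
  by rewrite expr1n mul1r PoszM -[X in _ = _ * X]mulr_natr natz; lia.
under eq_bigr do rewrite E.
by rewrite -mulr_sumr -exprDn subrr expr0n; case: k k0 {E} => // k _; rewrite mulr0.
Qed.

(* Cauchy product over the triangle i + j <= n. *)
Lemma bin_triangle (X : zmodType) (x : nat -> X) (n : nat) :
  (forall k, (n < k)%N -> x k = 0) ->
  \sum_(j < n.+1) esum (fun i => x (j + i)%N *~ ('C(n + j + i, i))%:Z)
      *~ ((-1) ^+ j * ('C(j + n, n))%:Z) = x 0%N.
Proof.
move=> hx.
have E (j : 'I_n.+1) : esum (fun i => x (j + i)%N *~ ('C(n + j + i, i))%:Z)
      *~ ((-1) ^+ j * ('C(j + n, n))%:Z) =
    \sum_(k < n.+1 | (j <= k)%N)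
      x k *~ ((-1) ^+ j * ('C(j + n, n) * 'C(n + k, k - j))%N%:Z).
  rewrite (@esumE _ _ (n.+1 - j)) => [|i hi]; last by rewrite hx ?mul0rz //; lia.
  rewrite mulrz_suml.
  rewrite -(big_mkord (fun k => (j <= k)%N)
     (fun k => x k *~ ((-1) ^+ j * ('C(j + n, n) * 'C(n + k, k - j))%N%:Z))).
  rewrite (big_cat_nat (n := j)) ?leq0n //=; last exact: ltnW.
  rewrite [X in _ = X + _]big_nat_cond [X in _ = X + _]big1 ?add0r; last first.
    by move=> i /andP[/andP[_ h1] h2]; lia.
  rewrite -[X in _ = \sum_(X <= i < n.+1 | _) _]add0n big_addn big_mkord.
  apply: eq_big => [i|i _]; first by rewrite leq_addl.
  rewrite -mulrzA addnK [(i + j)%N]addnC addnA; congr (_ *~ _).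
  by rewrite PoszM; lia.
rewrite (eq_bigr _ (fun j _ => E j)) (exchange_big_dep xpredT) //=.
rewrite big_ord_recl [X in X + _](big_pred1 ord0) /=; last first.
  by move=> j; rewrite leqn0.
rewrite expr0 mul1r add0n binn addn0 bin0 mulr1z big1 ?addr0 // => k _.
rewrite -mulrz_sumr -[RHS](mulr0z (x (lift ord0 k))); congr (_ *~ _).
rewrite -[RHS](@bin_conv n (lift ord0 k)) //.
rewrite -(big_mkord (fun j => (j <= lift ord0 k)%N)
  (fun j => (-1) ^+ j * ('C(j + n, n) * 'C(n + lift ord0 k, lift ord0 k - j))%N%:Z)).
rewrite -(big_mkord xpredT
  (fun j => (-1) ^+ j * ('C(j + n, n) * 'C(n + lift ord0 k, lift ord0 k - j))%N%:Z)).
by rewrite (big_nat_widen _ _ _ _ _ (ltn_ord (lift ord0 k))).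
Qed.

Lemma starN_mu (F : fieldType) (V : VOA F) n (k : int) N (a b : V) : star_tail n N a b ->
  starN n k N a b = \sum_(j < n.+1)
    mu (k + n%:Z) (- n%:Z - (j : nat)%:Z - 1) a b *~ ((-1) ^+ j * ('C(j + n, n))%:Z).
Proof.
move=> tl; apply: eq_bigr => j _; congr (_ *~ _).
have tl' (i : nat) : (N <= i)%N -> mode V (- n%:Z - (j : nat)%:Z - 1 + i%:Z) a b = 0.
  move=> hi; have := tl i j hi; rewrite -ltnS => /(_ (ltn_ord j)) <-.
  by congr (mode V _ _ _); lia.
by rewrite (mu_sum _ tl'); apply: eq_bigr => i _; congr (mode V _ _ _ *~ _); lia.
Qed.

Lemma star_tail_ex (F : fieldType) (V : VOA F) n (a b : V) : exists N, star_tail n N a b.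
Proof.
have [K hK] := @mode_trunc _ V a b; exists (absz K + 2 * n + 2)%N => i j hi hj.
by apply: hK; lia.
Qed.

Section Modules.
Variables (F : fieldType) (V : VOA F) (M : VMod V).
Implicit Types (a b v : V) (w : M).

Lemma mact_linl k w : lin (fun a => mact M k a w).
Proof. exact: act_linl (mact_bilin M) _ _. Qed.
Lemma mact_linr k a : lin (mact M k a).
Proof. exact: act_linr (mact_bilin M) _ _. Qed.

Lemma mact_borcherds (p q r : int) a b w :
  esum (fun i => mact M (p + q - i%:Z) (mode V (r + i%:Z) a b) w *~ binz p i) =
  esum (fun i => mact M (p + r - i%:Z) a (mact M (q + i%:Z) b w) *~ ((-1) ^+ i * binz r i))
  - esum (fun i => mact M (q + r - i%:Z) b (mact M (p + i%:Z) a w)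
            *~ ((-1) ^+ i * binz r i)) *~ sgnz r.
Proof. exact: borcherds_esum (@mode_trunc _ V) (mact_bilin M) (@mact_trunc _ _ M) (@mjacobi _ _ M) _ _ _ _ _ _. Qed.

(** The modes of the m-th divided derivative of Y_M(v,z). In Borcherds' identity with the vacuum as
    second vector, only the mode 1_(-1) survives: in the first sum for q < 0, in the second for q >=
    m, and in neither for 0 <= q < m. *)
Lemma mact_Dz (m : nat) (q : int) v w :
  mact M q (Dz m%:Z v) w = mact M (q - m%:Z) v w *~ ((-1) ^+ m * binz q m).
Proof.
have := mact_borcherds 0 q (- m%:Z - 1) v (vac V) w.
rewrite (esum_binz0 (fun i => mact M (0 + q - i%:Z) (mode V (- m%:Z - 1 + i%:Z) v (vac V)) w)).
rewrite add0r subr0 addr0 /Dz => ->.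
have [hq|hq] := lerP 0 q.
  rewrite [X in X - _]esum0 ?sub0r => [|i]; last first.
    rewrite mact_vac; have -> : (q + i%:Z == -1) = false by lia.
    by rewrite (lin0 (mact_linr _ _)) mul0rz.
  have [h|h] := ltnP (absz q) m.
    rewrite esum0 => [|i]; last first.
      rewrite mact_vac; have -> : (q + (- m%:Z - 1) - i%:Z == -1) = false by lia.
      by rewrite mul0rz.
    by case: q hq h => q // _ h; rewrite /= bin_small // mulr0 mulr0z mul0rz oppr0.
  rewrite (@esum_one _ _ (absz (q - m%:Z)%R)) => [|i hi]; last first.
    rewrite mact_vac; have -> : (q + (- m%:Z - 1) - i%:Z == -1) = false by lia.
    by rewrite mul0rz.
  rewrite mact_vac; have -> : (q + (- m%:Z - 1) - (absz (q - m%:Z)%R)%:Z == -1) by lia.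
  rewrite add0r; have -> : ((absz (q - m%:Z)%R)%:Z = q - m%:Z) by lia.
  rewrite -mulrzA -mulrNz; congr (_ *~ _).
  case: q hq h => q // _ h; have -> : absz (Posz q - m%:Z)%R = (q - m)%N by lia.
  have -> : - m%:Z - 1 = Negz m by lia.
  rewrite binz_nat /= mulrA -exprD addnn -muln2 exprM sqrr_sign mul1r.
  have -> : sgnz (Negz m) = (-1) ^+ m.+1 by [].
  by rewrite subnKC // bin_sub // exprS; lia.
rewrite [X in _ - X *~ _]esum0 ?mul0rz ?subr0 => [|i]; last first.
  rewrite mact_vac; have -> : (q + (- m%:Z - 1) - i%:Z == -1) = false by lia.
  by rewrite mul0rz.
rewrite (@esum_one _ _ (absz (- q - 1)%R)) => [|i hi]; last first.
  rewrite mact_vac; have -> : (q + i%:Z == -1) = false by lia.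
  by rewrite (lin0 (mact_linr _ _)) mul0rz.
rewrite mact_vac; have -> : (q + (absz (- q - 1)%R)%:Z == -1) by lia.
case: q hq => q // _; have -> : absz (- Negz q - 1)%R = q by lia.
have -> : 0 + (- m%:Z - 1) - q%:Z = Negz q - m%:Z by lia.
have -> : - m%:Z - 1 = Negz m by lia.
congr (_ *~ _); rewrite /= !mulrA -!exprD !addnn -!muln2 !exprM !sqrr_sign !mul1r.
by rewrite -bin_sub ?leq_addl // addnK addnC.
Qed.

Lemma oact_lina w : lin (fun a => oact M a w).
Proof. by apply: (hext_lin (g := fun s a => mact M (s - 1) a w)) => k; exact: mact_linl. Qed.
Lemma oact_homog s a w : homog s a -> oact M a w = mact M (s - 1) a w.
Proof.
by apply: (hext_homog (g := fun s a => mact M (s - 1) a w)) => k; exact: mact_linl.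
Qed.
Lemma oact_linw a : lin (oact M a).
Proof.
move=> c x y; rewrite /oact scaler_sumr -big_split; apply: eq_bigr => k _.
exact: mact_linr.
Qed.

(* The condition satisfied by the vectors of M(j), j <= m *)
Definition Omega (m : int) w := forall (s : int) a (l : int), homog s a ->
  s + m <= l -> mact M l a w = 0.

(** Borcherds' identity with p = l: all a_(l+i) kill w, so one of the two sums on the right drops
    out, while the modes on the left are those defining o on the homogeneous vectors a_(k+i) b. *)
Lemma oact_mu (m : int) w (da db l k : int) a b : Omega m w ->
  homog da a -> homog db b -> da + m <= l ->
  oact M (mu l k a b) w = esum (fun i => mact M (l + k - i%:Z) a
     (mact M (da + db - k - 2 - l + i%:Z) b w) *~ ((-1) ^+ i * binz k i)).
Proof.
move=> hw ha hb hl.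
have := mact_borcherds l (da + db - k - 2 - l) k a b w.
rewrite [X in _ = _ - X *~ _]esum0 ?mul0rz ?subr0 => [|i]; last first.
  by rewrite (hw da) ?(lin0 (mact_linr _ _)) ?mul0rz //; lia.
move=> <-; rewrite /mu (esum_lin (oact_lina w)); last exact: evzMz (evz_mode _ _ _).
apply: eq_esum => i; rewrite (linMz (oact_lina w)).
rewrite (oact_homog _ (mode_deg (k + i%:Z) ha hb)).
by congr (mact M _ _ _ *~ _); lia.
Qed.

Lemma oact_inO (m : nat) w a : Omega m w -> inO m a -> oact M a w = 0.
Proof.
move=> hw; elim=> [x|k s t N {}a b ha st tl||c x y _ hx _ hy].
- apply: (lin_homog_eq (f := fun x => oact M (Lm (-1) x + Lm 0 x) w) (g := fun _ => 0)).
  + move=> c u v; rewrite /Lm !(mode_linr _ _ c) addrACA -scalerDr.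
    exact: oact_lina.
  + by move=> c u v; rewrite scaler0 addr0.
  move=> s v hv; rewrite (linD (oact_lina w)) /Lm.
  have -> : mode V (-1 + 1) (omega V) v = Dz 1%N%:Z v.
    have := L_deriv (-1) v (vac V); rewrite (proj1 (creation _)) => ->.
    by rewrite /Dz mulrN1z opprK.
  have hD : homog (s + 1) (Dz 1%N%:Z v).
    have := mode_deg (- 1%N%:Z - 1) hv (vac_deg V).
    by rewrite /Dz; have -> : s + 0 - (- 1%N%:Z - 1) - 1 = s + 1 by lia.
  rewrite (oact_homog _ hD) mact_Dz (L0_deg hv) (linMz (oact_lina w)) (oact_homog _ hv).
  have -> : s + 1 - 1 = s by lia.
  by rewrite expr1 mulN1r binz1 mulrNz addNr.
- have -> : circN m k s t N a b = mu (k + m%:Z + s%:Z) (- (2 * m + 2 + t)%N%:Z) a b.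
    have tl' (i : nat) : (N <= i)%N -> mode V (- (2 * m + 2 + t)%N%:Z + i%:Z) a b = 0.
      by move=> /tl; rewrite addrC.
    by rewrite (mu_sum _ tl'); apply: eq_bigr => i _; rewrite addrC.
  apply: (lin_homog_eq (f := fun b => oact M (mu _ _ a b) w) (g := fun _ => 0)).
  + by move=> c u v; rewrite (mu_linr _ _ _ c) oact_lina.
  + by move=> c u v; rewrite scaler0 addr0.
  (* The inner modes of v have index db + m + (t - s) + i, which is at least db + m as s <= t. *)
  move=> db v hv; rewrite (oact_mu _ hw ha hv); last by lia.
  apply: esum0 => i; rewrite (hw db) //; last by lia.
  by rewrite (lin0 (mact_linr _ _)) mul0rz.
- exact: (lin0 (oact_lina w)).
- by rewrite oact_lina hx hy scaler0 addr0.
Qed.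

(** By [oact_mu] the j-th summand of a *_n b acts through the products x (j + i), where x i = a_(deg
    a - 1 - i) b_(deg b - 1 + i) w vanishes for i > n; [bin_triangle] leaves x 0 = o(a) o(b) w. *)
Lemma oact_starN (n : nat) w (k : int) N a b : Omega n w -> homog k a -> star_tail n N a b ->
  oact M (starN n k N a b) w = oact M a (oact M b w).
Proof.
move=> hw ha tl.
rewrite (starN_mu _ tl).
pose f b := oact M (\sum_(j < n.+1)
    mu (k + n%:Z) (- n%:Z - (j : nat)%:Z - 1) a b *~ ((-1) ^+ j * ('C(j + n, n))%:Z)) w.
apply: (lin_homog_eq (f := f) (g := fun b => oact M a (oact M b w))).
- move=> c u v; rewrite /f -oact_lina scaler_sumr -big_split /=; congr (oact M _ w).
  by apply: eq_bigr => j _; rewrite (mu_linr _ _ _ c) mulrzDl scalerMz.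
- by move=> c u v; rewrite oact_lina oact_linw.
move=> db v hv; rewrite /f (lin_sum (oact_lina w)).
pose x i := mact M (k - 1 - i%:Z) a (mact M (db - 1 + i%:Z) v w).
rewrite (oact_homog _ ha) (oact_homog _ hv).
transitivity (x 0%N); last by rewrite /x subr0 addr0.
rewrite -(bin_triangle (x := x) (n := n)) => [|i hi]; last first.
  by rewrite /x (hw db) ?(lin0 (mact_linr _ _)) //; lia.
apply: eq_bigr => j _; rewrite (linMz (oact_lina w)) (oact_mu _ hw ha hv) //.
congr (_ *~ _); apply: eq_esum => i; congr (_ *~ _).
  rewrite /x; congr (mact M _ _ _); first by lia.
  by congr (mact M _ _ _); lia.
have -> : - n%:Z - (j : nat)%:Z - 1 = Negz (n + j) by lia.
by rewrite /= mulrA -exprD addnn -muln2 exprM sqrr_sign mul1r.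
Qed.
End Modules.

(** * Irreducible modules *)

Section GeneratedSubspace.
Variables (F : fieldType) (V : VOA F) (X : lmodType F) (act : int -> V -> X -> X).
Variable G : X -> Prop.
Hypothesis act_bil : bilinear_act act.
Hypothesis act_trunc : forall w a, G w -> exists N : int, forall k, N <= k -> act k a w = 0.
Hypothesis act_bor : forall w (p q r : int) u v, G w ->
  esum (fun i => act (p + q - i%:Z) (mode V (r + i%:Z) u v) w *~ binz p i) =
  esum (fun i => act (p + r - i%:Z) u (act (q + i%:Z) v w) *~ ((-1) ^+ i * binz r i))
  - esum (fun i => act (q + r - i%:Z) v (act (p + i%:Z) u w) *~ ((-1) ^+ i * binz r i))
    *~ sgnz r.

Definition gens x := exists (s k : int) (a : V) w, [/\ homog s a, G w & x = act k a w].

(** By [span_modes] a product of two modes on w is a combination of single modes on w, so the span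
    of single modes is stable. It is stated for a bare action so as to cover both a module and the
    sum of two modules. *)
Lemma gens_closed k u x : lspan gens x -> lspan gens (act k u x).
Proof.
apply: (lspan_lin_image (f := act k u)).
- exact: act_linr act_bil _ _.
- exact: lspan_subsp.
move=> _ [s [l [b [w [hb hw ->]]]]].
apply: (subsp_homog (f := fun u => act k u (act l b w))).
- exact: act_linl act_bil _ _.
- exact: lspan_subsp.
move=> t a ha; apply: (span_modes _ _ _ (lspan_subsp gens) ha hb).
- by move=> k' a'; exact: (lin0 (act_linr act_bil k' a')).
- by move=> a'; exact: act_trunc.
- by move=> *; exact: act_bor.
- by move=> s' k' c hc _; apply: lspan_gen; exists s', k', c, w.
Qed.
End GeneratedSubspace.

Section IrreducibleModules.
Variables (F : fieldType) (V : VOA F).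

Section OneModule.
Variable M : VMod V.
Implicit Types (a b v : V) (w x : M).

Lemma mgr_lin m : lin (mgr M m).
Proof. by move=> c x y; case: (mgrading M) => h _; exact: h. Qed.
Lemma mgr_mgr m l x : mgr M m (mgr M l x) = if m == l then mgr M m x else 0.
Proof. by case: (mgrading M) => _ [h _]; exact: h. Qed.
Lemma mgr_sum x : x = \sum_(k <- msupp M x) mgr M k x.
Proof. by case: (mgrading M) => _ [_ [_ [_ h]]]; exact: h. Qed.
Lemma mgr_Mpart j m x : Mpart M m x -> mgr M j x = if j == m then x else 0.
Proof. by move=> h; rewrite -[in LHS]h mgr_mgr; case: eqP => // ->; exact: h. Qed.
Lemma Mpart_subsp m : subsp (Mpart M m).
Proof. by split=> [|c x y hx hy]; rewrite /Mpart ?(lin0 (mgr_lin _)) ?mgr_lin ?hx ?hy. Qed.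

Lemma mgr_eq0 x : (forall m, mgr M m x = 0) -> x = 0.
Proof. by move=> h; rewrite (mgr_sum x) big1. Qed.

Lemma Mpart_Omega m w : Mpart M m w -> Omega (m%:Z) w.
Proof.
by move=> hw s a l ha hl; have [h _] := mact_deg l ha hw; apply: h; lia.
Qed.

Lemma mgr_mact (s k : int) (m j : nat) a w : homog s a -> Mpart M m w ->
  mgr M j (mact M k a w) = if s + m%:Z - k - 1 == j%:Z then mact M k a w else 0.
Proof.
move=> ha hw; have [h1 h2] := mact_deg k ha hw.
have [h|h] := ltrP (s + m%:Z - k - 1) 0.
  by rewrite h1 // (lin0 (mgr_lin _)); case: ifP.
rewrite (mgr_Mpart j (h2 h)); congr (if _ then _ else _); lia.
Qed.

Lemma oact_Mpart m a w : Mpart M m w -> Mpart M m (oact M a w).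
Proof.
move=> hw; apply: (subsp_homog (f := fun a => oact M a w) (T := Mpart M m)).
- exact: oact_lina.
- exact: Mpart_subsp.
move=> s v hv; rewrite (oact_homog _ hv) /Mpart (mgr_mact _ _ hv hw).
by have -> : s + m%:Z - (s - 1) - 1 == m%:Z by lia.
Qed.

Lemma oact_vac w : oact M (vac V) w = w.
Proof. by rewrite (oact_homog _ (vac_deg V)) mact_vac. Qed.

Lemma Mpart_AnModOn n : AnModOn n (Mpart M n) (oact M).
Proof.
split; split.
- by case: (Mpart_subsp n).
- by case: (Mpart_subsp n).
- by move=> a x; exact: oact_Mpart.
- by move=> c a b x _; exact: oact_lina.
- by move=> c a x y _ _; exact: oact_linw.
- by move=> a ha x /Mpart_Omega hx; exact: (oact_inO hx ha).
- by move=> k N a b ha tl x /Mpart_Omega hx; exact: (oact_starN hx ha tl).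
- by move=> x _; exact: oact_vac.
Qed.

Definition mgens (G : M -> Prop) := gens (mact M) G.

Lemma span_mgens_VSubmod n (G : M -> Prop) : (forall w, G w -> Mpart M n w) ->
  VSubmod M (lspan (mgens G)).
Proof.
move=> hG; split.
- exact: lspan_0.
- exact: lspan_lin.
- move=> k u x; apply: gens_closed.
  + exact: mact_bilin.
  + by move=> w a _; exact: mact_trunc.
  + by move=> w *; exact: mact_borcherds.
- move=> m x; apply: (lspan_lin_image (f := mgr M m)); first exact: mgr_lin.
    exact: lspan_subsp.
  move=> _ [s [k [a [w [ha hw ->]]]]]; rewrite (mgr_mact _ _ ha (hG w hw)).
  by case: ifP => _; [apply: lspan_gen; exists s, k, a, w|exact: lspan_0].
Qed.

Lemma irred_span n (G : M -> Prop) : VIrred M -> (forall w, G w -> Mpart M n w) ->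
  (exists w, G w /\ w <> 0) -> forall x, lspan (mgens G) x.
Proof.
move=> [_ irr] hG [w [hw nz]]; case: (irr _ (span_mgens_VSubmod hG)) => // h.
case: nz; apply: h; apply: lspan_gen; exists 0, (-1), (vac V), w.
by split=> //; [exact: vac_deg|rewrite mact_vac].
Qed.

(** For w in M(n) the degree n part of a_k w is o(a) w or 0, so the submodule generated by G gains
    in degree n only vectors already reached by the operators o(a). *)
Lemma mgr_span_mgens n (G : M -> Prop) (T : M -> Prop) : (forall w, G w -> Mpart M n w) ->
  subsp T -> (forall a w, G w -> T (oact M a w)) ->
  forall x, lspan (mgens G) x -> T (mgr M n x).
Proof.
move=> hG TT hT; apply: (lspan_lin_image (f := mgr M n) (T := T)) => //; first exact: mgr_lin.
move=> _ [s [k [a [w [ha hw ->]]]]]; rewrite (mgr_mact _ _ ha (hG w hw)).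
case: ifP => h; last by case: TT.
have -> : k = s - 1 by lia.
by rewrite -oact_homog //; exact: hT.
Qed.

Lemma irred_AnSimple n : VIrred M -> Mnonzero M n -> AnSimple (Mpart M n) (oact M).
Proof.
move=> irr nz; split=> [//|S SW S0 Sl So].
have [[x [Sx nx]]|h] := pselect (exists x, S x /\ x <> 0); last first.
  by left=> x Sx; apply: contrapT => nx; apply: h; exists x.
right=> y hy; rewrite -hy.
have sp : lspan (mgens S) y by apply: (irred_span irr SW); exists x.
by apply: (mgr_span_mgens (G := S)) sp => // a w; exact: So.
Qed.

Lemma mu_inO n (k : int) (s t : nat) a b : homog k a -> (s <= t)%N ->
  inO n (mu (k + n%:Z + s%:Z) (- (2 * n + 2 + t)%N%:Z) a b).
Proof.
move=> ha st; have [N hN] := evz_mode (- (2 * n + 2 + t)%N%:Z) a b.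
have tl : circ_tail n t N a b by move=> i /hN <-; rewrite addrC.
rewrite (mu_sum _ hN).
have := inO_circ _ _ n k s t N a b ha st tl; rewrite /circN.
by under eq_bigr do rewrite addrC.
Qed.

(* A nonzero vector of M(0) is reached from M(n) by some b_k, and M(n) from it by
   some a_l; on M(n) the operator a_l b_k is o(c) for some c in O_{n-1}(V). *)
Lemma irred_not_factor n : VIrred M -> Mnonzero M 0 -> Mnonzero M n ->
  ~ AnFactorsPrev n (Mpart M n) (oact M).
Proof.
move=> irr [z [hz nz]] [w [hw nw]] fac; case: n => [|n] in hw fac *.
  by apply: nw; rewrite -(oact_vac w); apply: fac.
have step (i j : nat) (x y : M) : Mpart M i x -> Mpart M j y -> x <> 0 -> y <> 0 ->
    exists s k a, [/\ homog s a, s + i%:Z - k - 1 = j%:Z & mact M k a x <> 0].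
  move=> hx hy nx ny; apply: contrapT => h; apply: ny; rewrite -hy.
  have sp : lspan (mgens (eq^~ x)) y.
    by apply: (irred_span (n := i) irr) => [? ->//|]; exists x.
  apply: (lspan_lin_image (f := mgr M j) (T := fun x => x = 0)) sp; first exact: mgr_lin.
    exact: subsp0.
  move=> _ [s [k [a [_ [ha -> ->]]]]]; rewrite (mgr_mact _ _ ha hx); case: eqP => // e.
  by apply: contrapT => h'; apply: h; exists s, k, a.
have [s [k [b [hb ek nb]]]] := step _ _ _ _ hw hz nw nz.
have hy : Mpart M 0 (mact M k b w) by rewrite /Mpart (mgr_mact _ _ hb hw) ek.
have [t [l [a [ha el na]]]] := step _ _ _ _ hy hw nb nw.
(* The product with s = t = 1 is chosen so that the term i = 0 of [oact_mu] is the operator at hand;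
   the terms with i > 0 have an inner mode that kills M(n+1). *)
apply: na; rewrite -[RHS](fac _ (mu_inO n b ha (leqnn 1)) w hw).
rewrite (oact_mu _ (Mpart_Omega hw) ha hb); last by lia.
rewrite (@esum_one _ _ 0%N) => [|i hi]; last first.
  by rewrite (Mpart_Omega hw hb) ?(lin0 (mact_linr _ _)) ?mul0rz //; lia.
rewrite expr0 mul1r binz_0r mulr1z.
congr (mact M _ _ _); first by lia.
by congr (mact M _ _ _); lia.
Qed.
End OneModule.

Lemma VIso_AnIso n (M1 M2 : VMod V) : VIso M1 M2 ->
  AnIso (Mpart M1 n) (oact M1) (Mpart M2 n) (oact M2).
Proof.
move=> [f [fl fi fs fa fg]]; exists f; split.
- by move=> c x y _ _; exact: fl.
- by move=> x hx; rewrite /Mpart -fg hx.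
- by move=> x y _ _; exact: fi.
- move=> y hy; have [x hx] := fs y; exists x => //.
  by apply: fi; rewrite fg hx.
- move=> a x _; rewrite /oact (lin_sum fl); apply: eq_bigr => k _; exact: fa.
Qed.

Section Graph.
Variables (M1 M2 : VMod V) (n : nat) (f : M1 -> M2).
Let X := (mv M1 * mv M2)%type.
Hypothesis fl : forall (c : F) x y, Mpart M1 n x -> Mpart M1 n y -> f (c *: x + y) = c *: f x + f y.
Hypothesis fM : forall x, Mpart M1 n x -> Mpart M2 n (f x).
Hypothesis fi : forall x y, Mpart M1 n x -> Mpart M1 n y -> f x = f y -> x = y.
Hypothesis fs : forall y, Mpart M2 n y -> exists2 x, Mpart M1 n x & f x = y.
Hypothesis fa : forall a x, Mpart M1 n x -> f (oact M1 a x) = oact M2 a (f x).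

Definition act2 (k : int) (a : V) (x : X) : X := (mact M1 k a x.1, mact M2 k a x.2).

Lemma fst_lin : lin (fun x : X => x.1). Proof. by []. Qed.
Lemma snd_lin : lin (fun x : X => x.2). Proof. by []. Qed.

Lemma act2_bil : bilinear_act act2.
Proof.
split=> [k c a b [x y]|k c a [x y] [x' y']]; rewrite /act2 /=.
  by rewrite (mact_linl _ _ c) (mact_linl k y c).
by rewrite (mact_linr _ _ c) (mact_linr k a c).
Qed.

Lemma act2_trunc x a : exists N : int, forall k, N <= k -> act2 k a x = 0.
Proof.
have [N hN] := @mact_trunc _ _ M1 a x.1; have [N' hN'] := @mact_trunc _ _ M2 a x.2.
exists (Num.max N N') => k; rewrite ge_max => /andP[h h'].
by rewrite /act2 hN // hN'.
Qed.

Lemma act2_evz k a x (g : nat -> int) (h : nat -> V) (m : nat -> int) :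
  evz (fun i : nat => act2 (g i) (h i) (act2 (k + i%:Z) a x) *~ m i).
Proof.
apply: evzMz; have [N hN] := act2_trunc x a; exists (absz (N - k)%R) => i hi.
rewrite hN; last by lia.
exact: (lin0 (act_linr act2_bil _ _)).
Qed.

Lemma act2_bor w (p q r : int) u v :
  esum (fun i => act2 (p + q - i%:Z) (mode V (r + i%:Z) u v) w *~ binz p i) =
  esum (fun i => act2 (p + r - i%:Z) u (act2 (q + i%:Z) v w) *~ ((-1) ^+ i * binz r i))
  - esum (fun i => act2 (q + r - i%:Z) v (act2 (p + i%:Z) u w) *~ ((-1) ^+ i * binz r i))
    *~ sgnz r.
Proof.
have z1 : evz (fun i => act2 (p + q - i%:Z) (mode V (r + i%:Z) u v) w *~ binz p i).
  apply: evzMz; have [N hN] := evz_mode r u v; exists N => i /hN->.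
  exact: (lin0 (act_linl act2_bil _ _)).
have z2 := act2_evz q v w (fun i => p + r - i%:Z) (fun=> u) (fun i => (-1) ^+ i * binz r i).
have z3 := act2_evz p u w (fun i => q + r - i%:Z) (fun=> v) (fun i => (-1) ^+ i * binz r i).
rewrite [LHS]surjective_pairing [RHS]surjective_pairing; congr pair.
  rewrite (linB fst_lin) (linMz fst_lin) !(esum_lin fst_lin) //.
  under eq_esum do rewrite (linMz fst_lin) /=.
  under [X in _ = X - _]eq_esum do rewrite (linMz fst_lin) /=.
  under [X in _ = _ - X *~ _]eq_esum do rewrite (linMz fst_lin) /=.
  exact: mact_borcherds.
rewrite (linB snd_lin) (linMz snd_lin) !(esum_lin snd_lin) //.
under eq_esum do rewrite (linMz snd_lin) /=.
under [X in _ = X - _]eq_esum do rewrite (linMz snd_lin) /=.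
under [X in _ = _ - X *~ _]eq_esum do rewrite (linMz snd_lin) /=.
exact: mact_borcherds.
Qed.

Definition graph0 (x : X) := Mpart M1 n x.1 /\ x.2 = f x.1.
Definition graph : X -> Prop := lspan (gens act2 graph0).

Lemma f0 : f 0 = 0.
Proof.
have h : Mpart M1 n 0 by case: (Mpart_subsp M1 n).
have := fl 0 h h; rewrite !scale0r !add0r => e.
have := fl 1 h h; rewrite !scale1r addr0 => /esym/eqP.
by rewrite -subr_eq0 addrK => /eqP.
Qed.

Lemma graph_subsp : subsp graph. Proof. exact: lspan_subsp. Qed.

Lemma graph_act k u x : graph x -> graph (act2 k u x).
Proof.
apply: gens_closed; first exact: act2_bil.
  by move=> w a _; exact: act2_trunc.
by move=> w *; exact: act2_bor.
Qed.

Definition mgr2 m (x : X) : X := (mgr M1 m x.1, mgr M2 m x.2).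
Lemma mgr2_lin m : lin (mgr2 m).
Proof. by move=> c x y; rewrite /mgr2 /= !(mgr_lin _ c). Qed.

Lemma graph_mgr m x : graph x -> graph (mgr2 m x).
Proof.
apply: (lspan_lin_image (f := mgr2 m)); [exact: mgr2_lin|exact: graph_subsp|].
move=> _ [s [k [a [[w w'] [ha [/= hw ->] ->]]]]].
rewrite /mgr2 /= (mgr_mact _ _ ha hw) (mgr_mact _ _ ha (fM hw)).
case: ifP => _; last by case: graph_subsp.
by apply: lspan_gen; exists s, k, a, (w, f w).
Qed.

(** The generated submodule does not grow in degree n: there it is still the graph of f. This
    prevents it from containing all of M1 or all of M2. *)
Lemma graph_n x y : graph (x, y) -> mgr M2 n y = f (mgr M1 n x).
Proof.
pose T (z : X) := Mpart M1 n z.1 /\ z.2 = f z.1.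
have TT : subsp T.
  split; first by split; rewrite /= ?f0 //; case: (Mpart_subsp M1 n).
  move=> c [x1 y1] [x2 y2] [/= h1 ->] [/= h2 ->]; split=> /=; last by rewrite fl.
  exact: (proj2 (Mpart_subsp M1 n)).
move=> gxy; suff [] : T (mgr2 n (x, y)) by [].
move: gxy; apply: (lspan_lin_image (f := mgr2 n)) => //; first exact: mgr2_lin.
move=> _ [s [k [a [[w w'] [ha [/= hw ->] ->]]]]].
rewrite /mgr2 /= (mgr_mact _ _ ha hw) (mgr_mact _ _ ha (fM hw)).
case: ifP => h; last by case: TT.
have -> : k = s - 1 by lia.
rewrite -!oact_homog //; split=> /=; first exact: oact_Mpart.
by rewrite fa.
Qed.

Lemma graph_gen x : Mpart M1 n x -> graph (x, f x).
Proof.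
move=> hx; apply: lspan_gen; exists 0, (-1), (vac V), (x, f x).
by split; [exact: vac_deg|split|rewrite /act2 !mact_vac].
Qed.

Hypotheses (irr1 : VIrred M1) (irr2 : VIrred M2) (nz1 : Mnonzero M1 n).

Lemma nz2 : Mnonzero M2 n.
Proof.
have [w [hw nw]] := nz1; exists (f w); split; first exact: fM.
by rewrite -f0 => /fi h; apply: nw; apply: h => //; case: (Mpart_subsp M1 n).
Qed.

Lemma pair_lin (c : F) (x x' : M1) (y y' : M2) :
  (c *: x + x', c *: y + y') = c *: ((x, y) : X) + (x', y').
Proof. by []. Qed.

(** The y with (0, y) in the graph form a submodule of M2; by [graph_n] its degree n part is zero,
    so it is proper, hence zero by irreducibility. *)
Lemma graph_fun y : graph (0, y) -> y = 0.
Proof.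
have S : VSubmod M2 (fun y => graph (0, y)).
  split; first by case: graph_subsp.
  - move=> c y1 y2 h1 h2.
    by have := proj2 graph_subsp c _ _ h1 h2; rewrite -pair_lin scaler0 addr0.
  - move=> k u y1 /(graph_act k u); rewrite /act2 /=.
    by rewrite (lin0 (mact_linr _ _)).
  - by move=> m y1 /(graph_mgr m); rewrite /mgr2 /= (lin0 (mgr_lin _)).
case: (proj2 irr2 _ S) => [h|h _]; first exact: h.
have [w [hw []]] := nz2; have := graph_n (h w).
by rewrite hw (lin0 (mgr_lin _)) f0.
Qed.

Lemma graph_inj x : graph (x, 0) -> x = 0.
Proof.
have S : VSubmod M1 (fun x => graph (x, 0)).
  split; first by case: graph_subsp.
  - move=> c y1 y2 h1 h2.
    by have := proj2 graph_subsp c _ _ h1 h2; rewrite -pair_lin scaler0 addr0.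
  - move=> k u y1 /(graph_act k u); rewrite /act2 /=.
    by rewrite (lin0 (mact_linr _ _)).
  - by move=> m y1 /(graph_mgr m); rewrite /mgr2 /= (lin0 (mgr_lin _)).
case: (proj2 irr1 _ S) => [h|h _]; first exact: h.
have [w [hw []]] := nz1; have := graph_n (h w).
rewrite hw (lin0 (mgr_lin _)) -f0 => /esym /fi; apply=> //.
by case: (Mpart_subsp M1 n).
Qed.

(** The projection to M1 is a submodule containing M1(n), which is nonzero. *)
Lemma graph_dom x : exists y, graph (x, y).
Proof.
have S : VSubmod M1 (fun x => exists y, graph (x, y)).
  split; first by exists 0; case: graph_subsp.
  - move=> c x1 x2 [y1 h1] [y2 h2]; exists (c *: y1 + y2).
    exact: (proj2 graph_subsp c _ _ h1 h2).
  - by move=> k u x1 [y1 /(graph_act k u) h]; exists (mact M2 k u y1).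
  - by move=> m x1 [y1 /(graph_mgr m) h]; exists (mgr M2 m y1).
case: (proj2 irr1 _ S) => h; last exact: h.
have [w [hw []]] := nz1; apply: h; exists (f w); exact: graph_gen.
Qed.

Lemma graph_ran y : exists x, graph (x, y).
Proof.
have S : VSubmod M2 (fun y => exists x, graph (x, y)).
  split; first by exists 0; case: graph_subsp.
  - move=> c x1 x2 [y1 h1] [y2 h2]; exists (c *: y1 + y2).
    exact: (proj2 graph_subsp c _ _ h1 h2).
  - by move=> k u x1 [y1 /(graph_act k u) h]; exists (mact M1 k u y1).
  - by move=> m x1 [y1 /(graph_mgr m) h]; exists (mgr M1 m y1).
case: (proj2 irr2 _ S) => h; last exact: h.
have [w [hw []]] := nz1; have : f w = 0.
  by apply: h; exists w; exact: graph_gen.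
by rewrite -f0 => /fi; apply=> //; case: (Mpart_subsp M1 n).
Qed.

Lemma graphB x x' y y' : graph (x, y) -> graph (x', y') -> graph (x - x', y - y').
Proof. exact: (subspB graph_subsp). Qed.

Lemma graph_VIso : VIso M1 M2.
Proof.
pose g x := sval (cid (graph_dom x)).
have gP x : graph (x, g x) by rewrite /g; case: cid.
have gU x y : graph (x, y) -> g x = y.
  move=> h; apply/eqP; rewrite -subr_eq0; apply/eqP; apply: graph_fun.
  by rewrite -(subrr x); exact: graphB.
exists g; split.
- by move=> c x y; apply: gU; exact: (proj2 graph_subsp c _ _ (gP x) (gP y)).
- move=> x y e; apply/eqP; rewrite -subr_eq0; apply/eqP; apply: graph_inj.
  by rewrite -(subrr (g x)) {2}e; apply: graphB.
- by move=> y; have [x h] := graph_ran y; exists x; exact: gU.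
- by move=> k u x; apply: gU; exact: (graph_act k u (gP x)).
- by move=> m x; apply: gU; exact: (graph_mgr m (gP x)).
Qed.
End Graph.
End IrreducibleModules.

(** * Expansion at infinity, and reduction of Borcherds' identity to homogeneous vectors *)

Lemma binz_neg p (m : nat) : binz (- p) m = (-1) ^+ m * binz (p + m%:Z - 1) m.
Proof.
case: p => [[|p]|p].
- rewrite oppr0 binz_0l; case: m => [|m]; first by rewrite binz_0r.
  have -> : 0 + m.+1%:Z - 1 = Posz m by lia.
  by rewrite binz_nat bin_small // mulr0.
- have -> : Posz p.+1 + m%:Z - 1 = Posz (p + m) by lia.
  by rewrite binz_opp.
have -> : - Negz p = Posz p.+1 by lia.
have [h|h] := leqP (p + 2) m.
  have -> : Negz p + m%:Z - 1 = Posz (m - p - 2) by lia.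
  by rewrite !binz_nat !bin_small ?mulr0 //; lia.
have -> : Negz p + m%:Z - 1 = Negz (p + 1 - m) by lia.
rewrite /= mulrA -exprD addnn -muln2 exprM sqrr_sign mul1r.
by congr (Posz 'C(_, _)); lia.
Qed.

(** The expansion (1 + t)^(-N) = sum_j binom(-N,j) t^(-N-j) at infinity, a finite sum here because g
    vanishes for low total degree. *)
Lemma pascal_inf (X : zmodType) (g : int -> int -> X) (B : int) : pascal g ->
  (forall l k : int, l + k <= B -> g l k = 0) ->
  forall (N : nat) l k,
    g (l - N%:Z) k = esum (fun j => g l (k - N%:Z - j%:Z) *~ binz (- N%:Z) j).
Proof.
move=> gP gB N l.
have ez k : evz (fun j : nat => g l (k - j%:Z)).
  by exists (absz (l + k - B)%R) => i h; apply: gB; lia.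
elim: N => [|N IH] k.
  have -> : - 0%N%:Z = 0 :> int by [].
  by rewrite (esum_binz0 (fun j => g l (k + 0 - j%:Z))); congr g; lia.
pose d k := g (l - N.+1%:Z) k - esum (fun j => g l (k - N.+1%:Z - j%:Z) *~ binz (- N.+1%:Z) j).
(* The step from N to N + 1 only gives d k' = - d (k' + 1); as d vanishes for k' low, it vanishes
   everywhere. *)
have dS k' : d k' + d (k' + 1) = 0.
  have := IH k'; have -> : l - N%:Z = l - N.+1%:Z + 1 by lia.
  have -> : - N%:Z = - N.+1%:Z + 1 by lia.
  rewrite gP (esum_binzS (x := fun j => g l (k' + (- N.+1%:Z + 1) - j%:Z))) // => e.
  have e1 : esum (fun j => g l (k' + 1 - N.+1%:Z - j%:Z) *~ binz (- N.+1%:Z) j) =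
    esum (fun j => g l (k' + (- N.+1%:Z + 1) - j%:Z) *~ binz (- N.+1%:Z) j).
    by apply: eq_esum => j; congr (g _ _ *~ _); lia.
  have e2 : esum (fun j => g l (k' - N.+1%:Z - j%:Z) *~ binz (- N.+1%:Z) j) =
    esum (fun j => g l (k' + (- N.+1%:Z + 1) - j.+1%:Z) *~ binz (- N.+1%:Z) j).
    by apply: eq_esum => j; congr (g _ _ *~ _); lia.
  by rewrite /d e1 e2 addrACA e -opprD [in X in _ - X]addrC subrr.
have d0 k' : l + k' <= B -> d k' = 0.
  move=> h; rewrite /d gB ?esum0 ?subr0 // => [i|]; last by lia.
  by rewrite gB ?mul0rz //; lia.
suff H : forall (m : nat) k, k <= B - l + m%:Z -> d k = 0.
  by apply/eqP; rewrite -subr_eq0; apply/eqP; apply: (H (absz (k - B + l)%R)); lia.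
elim=> [|m IHm] k' h; first by apply: d0; lia.
have := dS (k' - 1); rewrite subrK IHm ?add0r //; lia.
Qed.

Lemma esum_lin_param (F : fieldType) (A X : lmodType F) (G : nat -> A -> X) :
  (forall i, lin (G i)) -> (forall a, evz (fun i => G i a)) ->
  lin (fun a => esum (fun i => G i a)).
Proof.
move=> Gl Gz c a b; rewrite esum_scale // -esumD //.
  by apply: eq_esum => i; exact: Gl.
by have [N hN] := Gz a; exists N => i /hN->; rewrite scaler0.
Qed.

Section BorcherdsHomogeneous.
Variables (F : fieldType) (V : VOA F) (X : lmodType F) (act : int -> V -> X -> X).
Hypothesis (bX : bilinear_act act) (tX : truncated act).

Let act2z k a x (g : nat -> int) (b : V) (m : nat -> int) :
  evz (fun i : nat => act (g i) b (act (k + i%:Z) a x) *~ m i).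
Proof.
apply: evzMz; have [N hN] := tX a x; exists (absz (N - k)%R) => i hi.
rewrite hN; last by lia.
exact: (lin0 (act_linr bX _ _)).
Qed.

Lemma lin_compMz (Y : lmodType F) (f : Y -> X) (m : int) : lin f -> lin (fun x => f x *~ m).
Proof. by move=> fl c x y; rewrite fl mulrzDl scalerMz. Qed.

Lemma linB_fun (Y : lmodType F) (f g : Y -> X) : lin f -> lin g -> lin (fun x => f x - g x).
Proof. by move=> fl gl c x y; rewrite fl gl opprD addrACA scalerBr. Qed.

Lemma borcherds_homog :
  (forall (p q r : int) (s t : int) u v w, homog s u -> homog t v ->
  esum (fun i => act (p + q - i%:Z) (mode V (r + i%:Z) u v) w *~ binz p i) =
  esum (fun i => act (p + r - i%:Z) u (act (q + i%:Z) v w) *~ ((-1) ^+ i * binz r i))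
  - esum (fun i => act (q + r - i%:Z) v (act (p + i%:Z) u w) *~ ((-1) ^+ i * binz r i))
    *~ sgnz r) -> borcherds (mode V) act.
Proof.
move=> H p q r u v w N tl.
have z1 u' v' : evz (fun i => act (p + q - i%:Z) (mode V (r + i%:Z) u' v') w *~ binz p i).
  apply: evzMz; have [K hK] := evz_mode r u' v'; exists K => i /hK->.
  exact: (lin0 (act_linl bX _ _)).
have E : esum (fun i => act (p + q - i%:Z) (mode V (r + i%:Z) u v) w *~ binz p i) =
  esum (fun i => act (p + r - i%:Z) u (act (q + i%:Z) v w) *~ ((-1) ^+ i * binz r i))
  - esum (fun i => act (q + r - i%:Z) v (act (p + i%:Z) u w) *~ ((-1) ^+ i * binz r i))
    *~ sgnz r.
  apply: (lin_homog_eq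
    (f := fun u => esum (fun i => act (p + q - i%:Z) (mode V (r + i%:Z) u v) w *~ binz p i))
    (g := fun u => esum (fun i => act (p + r - i%:Z) u (act (q + i%:Z) v w) *~ _)
      - esum (fun i => act (q + r - i%:Z) v (act (p + i%:Z) u w) *~ _) *~ sgnz r)).
  - apply: esum_lin_param => // i; apply: lin_compMz => c x y.
    by rewrite (mode_linl _ _ c) (act_linl bX).
  - apply: linB_fun; last apply: lin_compMz; apply: esum_lin_param => // i; apply: lin_compMz.
      exact: (act_linl bX).
    by move=> c x y; rewrite (act_linl bX _ _ c) (act_linr bX).
  move=> s u' hu; apply: (lin_homog_eq
    (f := fun v => esum (fun i => act (p + q - i%:Z) (mode V (r + i%:Z) u' v) w *~ binz p i))
    (g := fun v => esum (fun i => act (p + r - i%:Z) u' (act (q + i%:Z) v w) *~ _)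
      - esum (fun i => act (q + r - i%:Z) v (act (p + i%:Z) u' w) *~ _) *~ sgnz r)).
  - apply: esum_lin_param => // i; apply: lin_compMz => c x y.
    by rewrite (mode_linr _ _ c) (act_linl bX).
  - apply: linB_fun; last apply: lin_compMz; apply: esum_lin_param => // i; apply: lin_compMz.
      by move=> c x y; rewrite (act_linl bX _ _ c) (act_linr bX).
    exact: (act_linl bX).
  by move=> t v' hv; exact: (H p q r s t).
rewrite (@esumE _ _ N) in E => [|i /tl[-> _ _]]; last first.
  by rewrite (lin0 (act_linl bX _ _)) mul0rz.
rewrite E (@esumE _ _ N) => [|i /tl[_ -> _]]; last first.
  by rewrite (lin0 (act_linr bX _ _)) mul0rz.
rewrite (@esumE _ _ N) => [|i /tl[_ _ ->]]; last first.
  by rewrite (lin0 (act_linr bX _ _)) mul0rz.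
rewrite mulrz_suml -sumrB; apply: eq_bigr => i _.
by rewrite mulrzBl -!mulrzA [sgnz _ * _]mulrC.
Qed.
End BorcherdsHomogeneous.

(** * The module attached to a simple A_n(V)-module *)

Lemma le_sum_seq (g : int -> int) (r : seq int) s : (forall i, 0 <= g i) -> s \in r ->
  g s <= \sum_(i <- r) g i.
Proof.
by move=> g0 h; rewrite (perm_big _ (perm_to_rem h)) big_cons lerDl sumr_ge0.
Qed.

Section InducedModule.
Variables (F : fieldType) (V : VOA F) (n : nat) (U : lmodType F) (rho : V -> U -> U).
Implicit Types (a b v : V) (x : U) (f g : V -> U).

(* For homogeneous a, (1 + t)^(deg a + n) rho (Y(a,t) v) x is a Laurent polynomial of
   degree at most 2n, as rho kills O_n(V); [Bn] records the resulting order at infinity. *)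
Definition Bn a : int := - \sum_(s <- supp V a) `|s - n%:Z - 2|.

Lemma Bn_le s a : s \in supp V a -> Bn a <= s - n%:Z - 2.
Proof.
move=> h; rewrite /Bn.
have /= := @le_sum_seq (fun s => `|s - n%:Z - 2|) _ _ (fun=> normr_ge0 _) h.
by set T := \sum_(s <- _) _; lia.
Qed.

Definition fx x v : U := rho v x.
Notation pt := (ptl Bn).

(** The future degree e part: f_x has degree n and a_l raises the degree by deg a - l - 1. *)
Definition Le (e : int) : (V -> U) -> Prop :=
  lspan (fun g => exists s l a x, [/\ homog s a, s - l - 1 + n%:Z = e & g = pt l 0 a (fx x)]).

(** Families of components instead of sums of functions, so that the sum of the [Le e] is direct by
    construction. Finiteness is imposed only for e large, since [Le e] is zero for e < 0 by
    [Le_neg]. *)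
Definition inL (y : int -> V -> U) := (forall e, Le e (y e)) /\
  exists N : nat, forall e : int, N%:Z <= e -> y e = 0.

Definition Lpred : {pred (int -> V -> U)} := fun y => `[< inL y >].

Lemma Lpred_closed : submod_closed Lpred.
Proof.
split; first by apply/asboolP; split=> [e|]; [exact: lspan_0|exists 0%N].
move=> c y z /asboolP[hy [N hN]] /asboolP[hz [M hM]]; apply/asboolP; split=> [e|].
  exact: (lspan_lin c (hy e) (hz e)).
exists (maxn N M) => e he.
change (c *: y e + z e = 0).
rewrite hN; last by lia.
rewrite hM; last by lia.
by rewrite scaler0 addr0.
Qed.
HB.instance Definition _ := GRing.isSubmodClosed.Build F (int -> V -> U) Lpred Lpred_closed.

Record Lt := MkL { lval :> int -> V -> U; lvalP : lval \in Lpred }.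
HB.instance Definition _ := [isSub for lval].
HB.instance Definition _ := [Choice of Lt by <:].
HB.instance Definition _ := [SubChoice_isSubLmodule of Lt by <:].

Lemma lval_inj (y z : Lt) : (forall e, lval y e = lval z e) -> y = z.
Proof. by move=> h; apply: val_inj; apply/funext. Qed.

Lemma lval_lin e : lin (fun y : Lt => lval y e).
Proof. by []. Qed.

Lemma Lt_Le (y : Lt) e : Le e (lval y e).
Proof. by have /asboolP[h _] := lvalP y. Qed.

Lemma Lt_fin (y : Lt) : exists N : nat, forall e : int, N%:Z <= e -> lval y e = 0.
Proof. by have /asboolP[_ h] := lvalP y. Qed.

Hypothesis An : AnModOn n (fun _ : U => True) rho.

Lemma rho_linl x : lin (fun a => rho a x).
Proof. by move=> c a b; case: An => -[_ _ _ h _] _; exact: h. Qed.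
Lemma rho_linr a : lin (rho a).
Proof. by move=> c x y; case: An => -[_ _ _ _ h] _; exact: h. Qed.
Lemma rho_O a x : inO n a -> rho a x = 0.
Proof. by move=> h; case: An => _ [h' _ _]; exact: h'. Qed.
Lemma rho_star (k : int) N a b x : homog k a -> star_tail n N a b ->
  rho (starN n k N a b) x = rho a (rho b x).
Proof. by move=> ha tl; case: An => _ [_ h _]; exact: h. Qed.
Lemma rho_vac x : rho (vac V) x = x.
Proof. by case: An => _ [_ _ h]; exact: h. Qed.

(** This residue is a o^(s')_{n,t} v with s' = l - deg a - n and t = - k - 2n - 2; the bound on l +
    k says exactly that s' <= t. *)
Lemma fx_van s a (l k : int) v x : homog s a -> s + n%:Z <= l -> l + k <= s - n%:Z - 2 ->
  rho (mu l k a v) x = 0.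
Proof.
move=> ha h1 h2; pose s' := absz (l - s - n%:Z)%R; pose t := absz (- k - 2 * n%:Z - 2)%R.
have := @mu_inO _ _ n s s' t a v ha; rewrite /s' /t.
have -> : s + n%:Z + (absz (l - s - n%:Z)%R)%:Z = l by lia.
have -> : - (2 * n + 2 + absz (- k - 2 * n%:Z - 2)%R)%N%:Z = k by lia.
by move=> H; apply: rho_O; apply: H; lia.
Qed.

Lemma fx_vanB s a (l k : int) v x : homog s a -> s + n%:Z <= l -> l + k <= Bn a ->
  rho (mu l k a v) x = 0.
Proof.
move=> ha h1 h2; have [h|h] := boolP (s \in supp V a).
  by apply: (fx_van (s := s)) => //; have := Bn_le h; lia.
by rewrite -ha gr_supp // (lin0 (mu_linl _ _ _)) (lin0 (rho_linl _)).
Qed.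

Lemma fx_isD x : isD Bn (fx x).
Proof.
split=> [|a]; first exact: rho_linl.
exists (\sum_(s <- supp V a) `|s + n%:Z|) => l k v h1 h2.
rewrite /fx [in mu l k a v](gr_sum a) (lin_sum (mu_linl _ _ _)) (lin_sum (rho_linl x)).
rewrite big_seq big1 // => s hs; apply: (fx_van (s := s)); first exact: homog_gr.
  move: (@le_sum_seq (fun s => `|s + n%:Z|) _ _ (fun=> normr_ge0 _) hs) h1 => /=.
  by set T := \sum_(s <- _) _; lia.
by have := Bn_le hs; lia.
Qed.

Lemma fx_high s a (l k : int) x : homog s a -> s + n%:Z <= l -> pt l k a (fx x) = 0.
Proof.
move=> ha h; apply/funext => v; apply: (ptl_highA (A := s + n%:Z)) => //.
  exact: fx_isD.
by move=> l' k' v' h1 h2; exact: (fx_vanB _ _ ha).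
Qed.

(* rho (a *_n 1) = rho a, and a *_n 1 computes this residue by expanding the
   factor (1 + t)^(- n - 1) at infinity. *)
Lemma fx_unit s a x : homog s a -> pt (s - 1) 0 a (fx x) (vac V) = rho a x.
Proof.
move=> ha; have [N tl] := star_tail_ex n a (vac V).
rewrite -{2}(rho_vac x) -(rho_star x ha tl) (starN_mu s tl).
(* Minus the residue at infinity. The wanted value is g (s - 1) 0, as the creation axiom kills the
   residue at 0 for k = 0; after the expansion all terms have l = s + n, where the residue at -1
   vanishes. *)
pose g (l k : int) := pt l k a (fx x) (vac V) + rho (mu l k a (vac V)) x.
have gP : pascal g.
  apply: pascalD; first exact: ptl_pascal (fx_isD x).
  exact: (fmu_pascal _ _ (fx_isD x)).
have gB (l k : int) : l + k <= Bn a -> g l k = 0.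
  by move=> h; rewrite /g (ptl_low _ (fx_isD x)) // addNr.
have := pascal_inf gP gB n.+1 (s + n%:Z) 0.
have -> : s + n%:Z - n.+1%:Z = s - 1 by lia.
have -> : g (s - 1) 0 = pt (s - 1) 0 a (fx x) (vac V).
  rewrite /g /mu esum0 ?(lin0 (rho_linl x)) ?addr0 // => i.
  by rewrite (proj2 (creation a)) ?mul0rz.
move=> ->; rewrite (@esumE _ _ n.+1) => [|j hj]; last first.
  rewrite /g (fx_high _ _ ha) // add0r (fx_van (s := s)) ?mul0rz //; lia.
rewrite (lin_sum (rho_linl x)); apply: eq_bigr => j _.
rewrite (linMz (rho_linl x)) /g (fx_high _ _ ha) // add0r.
have -> : 0 - n.+1%:Z - (j : nat)%:Z = - n%:Z - (j : nat)%:Z - 1 by lia.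
by rewrite binz_opp -[in RHS]bin_sub ?leq_addl // addnK addnC.
Qed.

Lemma isD_subsp : subsp (isD Bn : (V -> U) -> Prop).
Proof. by split; [exact: isD0|move=> *; exact: isD_lin]. Qed.

Lemma Le_isD e g : Le e g -> isD Bn g.
Proof.
apply: (lspan_min isD_subsp) => _ [s [l [a [x [_ _ ->]]]]].
by apply: isD_ptl; exact: fx_isD.
Qed.

Lemma fx_Le x : Le n%:Z (fx x).
Proof.
apply: lspan_gen; exists 0, (-1), (vac V), x; split; first exact: vac_deg.
  by lia.
by rewrite ptl_vac0 ?eqxx //; exact: fx_isD.
Qed.

Lemma ptl_bor f (p q r : int) a b : isD Bn f ->
  esum (fun i => pt (p + q - i%:Z) 0 (mode V (r + i%:Z) a b) f *~ binz p i) =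
  esum (fun i => pt (p + r - i%:Z) 0 a (pt (q + i%:Z) 0 b f) *~ ((-1) ^+ i * binz r i))
  - esum (fun i => pt (q + r - i%:Z) 0 b (pt (p + i%:Z) 0 a f)
            *~ ((-1) ^+ i * binz r i)) *~ sgnz r.
Proof.
move=> fD; apply/funext => v.
have evl : lin (fun h : V -> U => h v) by [].
have z2 c d l (h : nat -> int) (m : nat -> int) :
    evz (fun i => pt (h i) 0 c (pt (l + i%:Z) 0 d f) *~ m i).
  apply: evzMz; have [A hA] := ptl_high0 d fD; exists (absz (A - l)%R) => i hi.
  by rewrite hA ?ptl_f0 //; lia.
have z1 : evz (fun i => pt (p + q - i%:Z) 0 (mode V (r + i%:Z) a b) f *~ binz p i).
  by apply: evzMz; have [N hN] := evz_mode r a b; exists N => i /hN->; rewrite ptl_a0.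
rewrite (esum_lin evl z1) [RHS](linB evl) (linMz evl).
rewrite (esum_lin evl (z2 _ _ _ _ _)) (esum_lin evl (z2 _ _ _ _ _)).
under eq_esum do rewrite (linMz evl).
under [X in _ = X - _]eq_esum do rewrite (linMz evl).
under [X in _ = _ - X *~ _]eq_esum do rewrite (linMz evl).
exact: ptl_borcherds_modes.
Qed.

Lemma Le_act e t b l g : homog t b -> Le e g -> Le (e + t - l - 1) (pt l 0 b g).
Proof.
move=> hb hg; suff [] : isD Bn g /\ Le (e + t - l - 1) (pt l 0 b g) by [].
move: g hg; apply: lspan_min.
  split=> [|c g h [gD hg] [hD hh]]; first by rewrite ptl_f0; split; [exact: isD0|exact: lspan_0].
  by split; [exact: isD_lin|rewrite ptl_linf //; exact: lspan_lin].
move=> _ [s [k [a [x [ha ek ->]]]]]; split; first exact/isD_ptl/fx_isD.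
apply: (@span_modes F V _ (fun k a f => pt k 0 a f) (fx x)) _ _ _ _ _ hb ha _.
- by move=> *; exact: ptl_f0.
- by move=> a'; have [A hA] := ptl_high0 a' (fx_isD x); exists A => k'; exact: hA.
- by move=> *; apply: ptl_bor; exact: fx_isD.
- exact: lspan_subsp.
- move=> s' k' c hc ek'; apply: lspan_gen; exists s', k', c, x; split=> //; lia.
Qed.

Lemma Le_neg e g : e < 0 -> Le e g -> g = 0.
Proof.
move=> he; apply: (lspan_min (subsp0 _)) => _ [s [l [a [x [ha el ->]]]]].
by apply: (fx_high _ _ ha); lia.
Qed.

Lemma lval_isD (y : Lt) e : isD Bn (lval y e).
Proof. exact: Le_isD (Lt_Le y e). Qed.

Definition Lact0 (k : int) a (y : int -> V -> U) (e : int) : V -> U :=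
  hext (fun s a => pt k 0 a (y (e - s + k + 1))) a.

Lemma Lact0_inL k a (y : Lt) : Lact0 k a y \in Lpred.
Proof.
apply/asboolP; split=> [e|].
  apply: subsp_sum => [|s _]; first exact: lspan_subsp.
  have := Le_act k (homog_gr s a) (Lt_Le y (e - s + k + 1)).
  by have -> : e - s + k + 1 + s - k - 1 = e by lia.
have [N hN] := Lt_fin y.
exists (N + absz k + absz (\sum_(s <- supp V a) `|s|)%R)%N => e he.
rewrite /Lact0 /hext big_seq big1 // => s hs.
rewrite hN ?ptl_f0 //.
move: (@le_sum_seq (fun s => `|s|) _ _ (fun=> normr_ge0 _) hs) he => /=.
by set T := \sum_(s <- _) _; lia.
Qed.

Definition Lact k a (y : Lt) : Lt := MkL (Lact0_inL k a y).

Lemma lval_homog k s a (y : Lt) e : homog s a ->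
  lval (Lact k a y) e = pt k 0 a (lval y (e - s + k + 1)).
Proof.
move=> ha; apply: (hext_homog (g := fun s a => pt k 0 a (lval y (e - s + k + 1)))) => //.
by move=> s' c u v; apply: ptl_lina; exact: lval_isD.
Qed.

Lemma Lact_bil : bilinear_act Lact.
Proof.
split=> [k c a b y|k c a y z]; apply: lval_inj => e.
  apply: (hext_lin (g := fun s a => pt k 0 a (lval y (e - s + k + 1)))).
  by move=> s' c' u v; apply: ptl_lina; exact: lval_isD.
change (Lact0 k a (c *: y + z) e = c *: Lact0 k a y e + Lact0 k a z e).
rewrite /Lact0 /hext scaler_sumr -big_split; apply: eq_bigr => s _ /=.
exact: ptl_linf (lval_isD _ _) (lval_isD _ _).
Qed.

Lemma Lact_trunc : truncated Lact.
Proof.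
move=> a y; have [N hN] := Lt_fin y.
exists (N%:Z + \sum_(s <- supp V a) `|s|) => k hk; apply: lval_inj => e.
(* The bound must not depend on e: components with e < 0 are zero, and for e >= 0 the index e - s +
   k + 1 exceeds N. *)
have [he|he] := ltrP e 0.
  by rewrite (Le_neg he (Lt_Le (Lact k a y) e)).
change (Lact0 k a y e = 0); rewrite /Lact0 /hext big_seq big1 // => s hs.
rewrite hN ?ptl_f0 //.
move: (@le_sum_seq (fun s => `|s|) _ _ (fun=> normr_ge0 _) hs) hk => /=.
by set T := \sum_(s <- _) _; lia.
Qed.

Lemma Lact_vac k y : Lact k (vac V) y = if k == -1 then y else 0.
Proof.
apply: lval_inj => e; rewrite (lval_homog _ _ _ (vac_deg V)) ptl_vac0; last exact: lval_isD.
by case: eqP => // ->; congr (lval y _); lia.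
Qed.

Lemma Lact_bor : borcherds (mode V) Lact.
Proof.
apply: (borcherds_homog Lact_bil Lact_trunc) => p q r s t u v w hu hv.
apply: lval_inj => e.
have evl := lval_lin e.
have z2 c d l (h : nat -> int) (m : nat -> int) :
    evz (fun i => Lact (h i) c (Lact (l + i%:Z) d w) *~ m i).
  apply: evzMz; have [A hA] := Lact_trunc d w; exists (absz (A - l)%R) => i hi.
  rewrite hA; last by lia.
  exact: (lin0 (act_linr Lact_bil _ _)).
have z1 : evz (fun i => Lact (p + q - i%:Z) (mode V (r + i%:Z) u v) w *~ binz p i).
  apply: evzMz; have [N hN] := evz_mode r u v; exists N => i /hN->.
  exact: (lin0 (act_linl Lact_bil _ _)).
rewrite (esum_lin evl z1) (linB evl) (linMz evl).
rewrite (esum_lin evl (z2 _ _ _ _ _)) (esum_lin evl (z2 _ _ _ _ _)).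
(* Every term of the identity uses the component of w in this one degree. *)
pose e0 := e - s - t + r + p + q + 2.
transitivity (esum (fun i => pt (p + q - i%:Z) 0 (mode V (r + i%:Z) u v) (lval w e0)
    *~ binz p i)).
  apply: eq_esum => i; rewrite (linMz evl) (lval_homog _ _ _ (mode_deg (r + i%:Z) hu hv)).
  have -> : e - (s + t - (r + i%:Z) - 1) + (p + q - i%:Z) + 1 = e0 by rewrite /e0; lia.
  by [].
rewrite (ptl_bor p q r u v (lval_isD w e0)); congr (_ - _ *~ _).
  apply: eq_esum => i; rewrite (linMz evl) (lval_homog _ _ _ hu) (lval_homog _ _ _ hv).
  have -> : e - s + (p + r - i%:Z) + 1 - t + (q + i%:Z) + 1 = e0 by rewrite /e0; lia.
  by [].
apply: eq_esum => i; rewrite (linMz evl) (lval_homog _ _ _ hv) (lval_homog _ _ _ hu).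
have -> : e - t + (q + r - i%:Z) + 1 - s + (p + i%:Z) + 1 = e0 by rewrite /e0; lia.
by [].
Qed.

Definition sfun (e : int) g : int -> V -> U := fun e' => if e' == e then g else 0.

Lemma sfun_inL e g : Le e g -> sfun e g \in Lpred.
Proof.
move=> h; apply/asboolP; split=> [e'|].
  by rewrite /sfun; case: eqP => [->//|_]; exact: lspan_0.
exists (absz e).+1 => e' he; rewrite /sfun; case: eqP => // h'; lia.
Qed.

Definition sing e g (h : Le e g) : Lt := MkL (sfun_inL h).
Definition Lgr (m : nat) (y : Lt) : Lt := sing (Lt_Le y m%:Z).
Definition Lsupp (y : Lt) : seq nat := iota 0 (sval (cid (Lt_fin y))).

Lemma Lgr_lval m y e : lval (Lgr m y) e = if e == m%:Z then lval y m%:Z else 0.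
Proof. by []. Qed.

Lemma Lgrading : grading Lgr Lsupp.
Proof.
split; [|split; [|split; [|split]]].
- move=> k c x y; apply: lval_inj => e; rewrite (lval_lin e) !Lgr_lval.
  by case: eqP => // _; rewrite ?scaler0 ?addr0.
- move=> k l x; apply: lval_inj => e; rewrite !Lgr_lval.
  case: (k =P l) => [->|hkl]; first by rewrite eqxx.
  have -> : (k%:Z == l%:Z) = false by lia.
  by case: ifP.
- by move=> x; exact: iota_uniq.
- move=> x k; rewrite /Lsupp; case: cid => N hN /=; rewrite mem_iota /= add0n -leqNgt => hk.
  by apply: lval_inj => e; rewrite Lgr_lval hN; [case: ifP|lia].
- move=> x; rewrite /Lsupp; case: cid => N hN /=; apply: lval_inj => e.
  rewrite (lin_sum (lval_lin e)).
  rewrite (eq_bigr (fun k : nat => if e == k%:Z then lval x k%:Z else 0)) //.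
  have [he|he] := ltrP e 0.
    rewrite (Le_neg he (Lt_Le x e)) big1 // => k _.
    by have -> : (e == k%:Z) = false by lia.
  have [hN'|hN'] := ltrP e N%:Z; last first.
    rewrite hN // big_seq big1 // => k; rewrite mem_iota /= add0n => hk.
    by have -> : (e == k%:Z) = false by lia.
  rewrite (bigD1_seq (absz e)) ?iota_uniq ?mem_iota //=; last by lia.
  have -> : (absz e)%:Z = e by lia.
  rewrite eqxx big1 ?addr0 // => k hk.
  by have -> : (e == k%:Z) = false by lia.
Qed.

Lemma Lact_deg (s : int) (m : nat) (k : int) u w : homog s u -> Lgr m w = w ->
  let d := s + m%:Z - k - 1 in
  (d < 0 -> Lact k u w = 0) /\ (0 <= d -> Lgr (absz d) (Lact k u w) = Lact k u w).
Proof.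
move=> hu hw d.
have E e : e <> d -> lval (Lact k u w) e = 0.
  move=> he; rewrite (lval_homog _ _ _ hu) -hw Lgr_lval.
  have -> : (e - s + k + 1 == m%:Z) = false by apply/negP => /eqP h; apply: he; rewrite /d; lia.
  by rewrite ptl_f0.
split=> hd; apply: lval_inj => e.
  have [->|he] := eqVneq e d; last by apply: E; exact/eqP.
  exact: (Le_neg hd (Lt_Le _ d)).
rewrite Lgr_lval; have -> : (absz d)%:Z = d by lia.
by case: eqP => [->//|he]; rewrite E.
Qed.

Definition Lmod : VMod V :=
  Build_VMod Lact_bil Lact_trunc Lact_vac Lact_bor Lgrading Lact_deg.
End InducedModule.

Section InducedModuleIrreducible.
Variables (F : fieldType) (V : VOA F) (n : nat) (U : lmodType F) (rho : V -> U -> U).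
Hypothesis An : AnModOn n (fun _ : U => True) rho.
Implicit Types (a b v : V) (x : U) (f g : V -> U).
Notation pt := (ptl (Bn n)).
Notation fx := (fx rho).
Notation Le := (Le n rho).
Notation L := (Lmod An).
Notation lval := (@lval F V n U rho).

Definition y0 x : L := sing (fx_Le An x).

Lemma mact_sing k s a e g (h : Le e g) : homog s a ->
  lval (mact L k a (sing h)) = sfun (e + s - k - 1) (pt k 0 a g).
Proof.
move=> ha; apply/funext => e'; rewrite (lval_homog An _ _ _ ha) /sfun /=.
rewrite /sfun; case: (e' =P e + s - k - 1) => [->|he].
  have -> : e + s - k - 1 - s + k + 1 = e by lia.
  by rewrite eqxx.
have -> : (e' - s + k + 1 == e) = false by apply/negP => /eqP h'; apply: he; lia.
by rewrite ptl_f0.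
Qed.

Lemma y0_lval x : lval (y0 x) n%:Z = fx x.
Proof. by rewrite /= /sfun eqxx. Qed.

Lemma y0_Mpart x : Mpart L n (y0 x).
Proof. by apply: lval_inj => e; rewrite Lgr_lval /= /sfun eqxx. Qed.

Lemma fx_vac x : fx x (vac V) = x.
Proof. exact: rho_vac An x. Qed.

Lemma ev_lin : lin (fun y : L => lval y n%:Z (vac V)).
Proof. by []. Qed.

Lemma oact_y0_vac c x : lval (oact L c (y0 x)) n%:Z (vac V) = rho c x.
Proof.
apply: (lin_homog_eq (f := fun c => lval (oact L c (y0 x)) n%:Z (vac V)) (g := fun c => rho c x)).
- by move=> d u v; rewrite (oact_lina _ d) ev_lin.
- exact: rho_linl An x.
move=> s a ha; rewrite (oact_homog _ ha) (mact_sing _ _ ha) /sfun.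
have -> : n%:Z == n%:Z + s - (s - 1) - 1 by lia.
exact: fx_unit.
Qed.

(** By [oact_y0_vac], rho c x is read off from o(c) on the module, where [mact_Dz] yields (-1)^m
    binom(deg v + m - 1, m) = binom(- deg v, m). *)
Lemma fx_Dprop x : Dprop 0 (fx x).
Proof.
move=> dv v [m|m] hv; last by rewrite Dz_neg // (lin0 (proj1 (fx_isD An x))) bz_neg.
have hD : homog (dv + m%:Z) (Dz m%:Z v).
  have := mode_deg (- m%:Z - 1) hv (vac_deg V).
  by rewrite /Dz; have -> : dv + 0 - (- m%:Z - 1) - 1 = dv + m%:Z by lia.
rewrite -[LHS]/(rho (Dz m%:Z v) x) -(oact_y0_vac (Dz m%:Z v) x) (oact_homog _ hD) mact_Dz.
rewrite (linMz ev_lin); have -> : dv + m%:Z - 1 - m%:Z = dv - 1 by lia.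
rewrite -(oact_homog _ hv) oact_y0_vac sub0r; congr (_ *~ _).
by rewrite /= binz_neg.
Qed.

Lemma Le_Dprop e g : Le e g -> Dprop (n%:Z - e) g.
Proof.
move=> hg; suff [] : isD (Bn n) g /\ Dprop (n%:Z - e) g by [].
move: g hg; apply: lspan_min.
  split; first by split; [exact: isD0|move=> dv v m _; rewrite mul0rz].
  move=> c f g [fD fE] [gD gE]; split; first exact: isD_lin.
  move=> dv v m hv.
  change (c *: f (Dz m v) + g (Dz m v) = (c *: f v + g v) *~ bz (n%:Z - e - dv) m).
  by rewrite (fE dv) // (gE dv) // mulrzDl scalerMz.
move=> _ [s [l [a [x [ha el ->]]]]]; split; first exact/isD_ptl/(fx_isD An).
have := Dprop_ptl l (fx_isD An x) (fx_Dprop x) ha.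
by have -> : 0 - (s - l - 1) = n%:Z - e by lia.
Qed.

(** Each value of g is thus the vacuum value of a mode of g lying in degree n. *)
Lemma Le_eval e g v (dv : int) : Le e g -> homog dv v ->
  pt (dv - (n%:Z - e) - 1) 0 v g (vac V) = g v.
Proof. by move=> hg hv; apply: (ptl_vacuum (Le_isD An hg) (Le_Dprop hg) hv). Qed.

(** By [Le_eval] the left side at b is the vacuum value of o(b) o(a) f_x; as o turns b *_n a into
    this product, it is rho (b *_n a) x = rho b (rho a x). *)
Lemma ptl_o_fx s a x : homog s a -> pt (s - 1) 0 a (fx x) = fx (rho a x).
Proof.
move=> ha; have hL : Le n%:Z (pt (s - 1) 0 a (fx x)).
  have := Le_act An (s - 1) ha (fx_Le An x).
  by have -> : n%:Z + s - (s - 1) - 1 = n%:Z by lia.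
apply/funext; apply: lin_homog_eq.
- exact: (ptl_linv _ _ _ (fx_isD An x)).
- exact: (rho_linl An (rho a x)).
move=> t b hb; rewrite -(Le_eval hL hb).
have [N tl] := star_tail_ex n b a.
rewrite [RHS](_ : _ = rho (starN n t N b a) x); last by rewrite (rho_star An x hb tl).
rewrite -oact_y0_vac (oact_starN (Mpart_Omega (y0_Mpart x)) hb tl).
rewrite (oact_homog _ hb) (lval_homog An _ _ _ hb) (oact_homog _ ha) (mact_sing _ _ ha).
have -> : n%:Z - t + (t - 1) + 1 = n%:Z by lia.
have -> : t - (n%:Z - n%:Z) - 1 = t - 1 by lia.
rewrite /sfun; have -> : n%:Z == n%:Z + s - (s - 1) - 1 by lia.
by [].
Qed.

Lemma Le_n g : Le n%:Z g -> exists x, g = fx x.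
Proof.
have fl : lin fx by move=> c x y; apply/funext => v; exact: rho_linr An v c x y.
have SS : subsp (fun g : V -> U => exists x, g = fx x).
  split; first by exists 0; rewrite (lin0 fl).
  by move=> c f h [x ->] [y ->]; exists (c *: x + y); rewrite fl.
apply: (lspan_min SS) => _ [s [l [a [x [ha el ->]]]]].
exists (rho a x); rewrite -(ptl_o_fx x ha); congr (pt _ _ _ _); lia.
Qed.

Lemma Mpart_y0 (y : L) : Mpart L n y -> exists x, y = y0 x.
Proof.
move=> hy; have [x hx] := Le_n (Lt_Le y n%:Z); exists x; apply: lval_inj => e.
by rewrite -[in LHS]hy Lgr_lval hx.
Qed.

Lemma y0_vac x : lval (y0 x) n%:Z (vac V) = x.
Proof. by rewrite y0_lval fx_vac. Qed.

Lemma oact_y0 a x : oact L a (y0 x) = y0 (rho a x).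
Proof.
have [z hz] := Mpart_y0 (oact_Mpart a (y0_Mpart x)).
by rewrite hz -{1}(y0_vac z) -hz oact_y0_vac.
Qed.

Lemma y0_lin : lin y0.
Proof.
move=> c x y; have h : Mpart L n (c *: y0 x + y0 y).
  by apply: (proj2 (Mpart_subsp L n)); exact: y0_Mpart.
have [z hz] := Mpart_y0 h; rewrite hz; congr y0.
by rewrite -(y0_vac z) -hz ev_lin !y0_vac.
Qed.

Hypothesis simple : AnSimple (fun _ : U => True) rho.

Lemma Lmod_nonzero : Mnonzero L n.
Proof.
have [[x [_ nx]] _] := simple; exists (y0 x); split; first exact: y0_Mpart.
by move=> /(congr1 (fun y : L => lval y n%:Z (vac V))); rewrite y0_vac.
Qed.

Lemma submod_sing (S : L -> Prop) e g : VSubmod L S -> (forall x, S (y0 x)) -> Le e g ->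
  exists2 y, S y & lval y = sfun e g.
Proof.
move=> [S0 Sl Sa Sg] Sx; apply: (lspan_min (S := fun g => exists2 y, S y & lval y = sfun e g)).
  split; first by exists 0 => //; apply/funext => e'; rewrite /sfun; case: eqP.
  move=> c f h [y Sy ey] [z Sz ez]; exists (c *: y + z); first exact: Sl.
  change (c *: lval y + lval z = sfun e (c *: f + h)); rewrite ey ez.
  apply/funext => e'; change (c *: sfun e f e' + sfun e h e' = sfun e (c *: f + h) e').
  by rewrite /sfun; case: eqP => // _; rewrite scaler0 addr0.
move=> _ [s [l [a [x [ha el ->]]]]]; exists (mact L l a (y0 x)); first exact: Sa.
by rewrite (mact_sing _ _ ha); congr (sfun _ _); lia.
Qed.

(* A nonzero g in L(e) has g v <> 0 for some homogeneous v, and by [Le_eval] a mode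
   of v sends g to a nonzero vector of L(n) = U. *)
Lemma Lmod_irred : VIrred L.
Proof.
split; first by have [w [_ nw]] := Lmod_nonzero; exists w.
move=> S SS; have [S0 Sl Sa Sg] := SS.
have [[y [Sy ny]]|h] := pselect (exists y, S y /\ y <> 0); last first.
  by left=> y Sy; apply: contrapT => ny; apply: h; exists y.
right; have [m nm] : exists m, mgr L m y <> 0.
  by apply: contrapT => h; apply: ny; apply: mgr_eq0 => m; apply: contrapT => h'; apply: h; exists m.
pose g := lval y m%:Z; have hg : Le m%:Z g by exact: Lt_Le.
have [dv [v [hv nv]]] : exists dv v, homog dv v /\ g v <> 0.
  apply: contrapT => h; apply: nm; apply: lval_inj => e; rewrite Lgr_lval.
  case: eqP => // _; apply/funext; apply: lin_homog_eq => //.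
    exact: (proj1 (Le_isD An hg)).
    by move=> c x z; rewrite scaler0 addr0.
  by move=> s v hv; apply: contrapT => h'; apply: h; exists s, v.
pose k := dv - (n%:Z - m%:Z) - 1.
have Sz : S (mact L k v (mgr L m y)) by apply: Sa; exact: Sg.
have ez : lval (mact L k v (mgr L m y)) = sfun n%:Z (pt k 0 v g).
  rewrite (mact_sing k (Lt_Le y m%:Z) hv); congr (sfun _ _); rewrite /k; lia.
have hz : Mpart L n (mact L k v (mgr L m y)).
  by apply: lval_inj => e; rewrite Lgr_lval ez /sfun eqxx.
have [x hx] := Mpart_y0 hz.
have nx : x <> 0.
  move=> x0; apply: nv; rewrite -(Le_eval hg hv) -/k.
  have : lval (mact L k v (mgr L m y)) n%:Z (vac V) = x by rewrite hx y0_vac.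
  by rewrite ez /sfun eqxx x0.
have Sx x' : S (y0 x').
  have SO a w : S w -> S (oact L a w).
    by move=> Sw; apply: subsp_sum => [|s _]; [split|exact: Sa].
  have [] := proj2 simple (fun x => S (y0 x)).
  - by [].
  - by rewrite (lin0 y0_lin).
  - by move=> c u w hu hw; rewrite y0_lin; exact: Sl.
  - by move=> a w hw; rewrite -oact_y0; exact: SO.
  - by move=> h; case: nx; apply: h; rewrite -hx.
  - by apply.
move=> w; rewrite (mgr_sum w); apply: subsp_sum => // j _.
have [z Sz' ez'] := submod_sing SS Sx (Lt_Le w j%:Z).
by have -> : mgr L j w = z by apply: lval_inj => e; rewrite ez'.
Qed.

Hypothesis nofactor : ~ AnFactorsPrev n (fun _ : U => True) rho.

(* If L(0) = 0, then lowering the degrees by one makes U the degree n - 1 part of a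
   module, so O_{n-1}(V) acts on it as zero. *)
Lemma Lmod_nonzero0 : Mnonzero L 0.
Proof.
apply: contrapT => h0; apply: nofactor => a ha x _.
have Ln m : m = n -> Mnonzero L m by move=> ->; exact: Lmod_nonzero.
have [n' [en {}ha]] : exists n', n = n'.+1 /\ inO n' a.
  have : n = 0%N \/ exists n', n = n'.+1 /\ inO n' a.
    by case: {+}n ha => [|n'] ha'; [left|right; exists n'].
  by case=> // /esym /Ln.
rewrite -(y0_vac (rho a x)) -oact_y0.
suff hO : Omega (n'%:Z) (y0 x) by rewrite (oact_inO hO ha).
move=> s b l hb hl; have [hl'|hl'] := lerP (s + n%:Z) l.
  by apply: (Mpart_Omega (y0_Mpart x) hb).
(* Now l = deg b + n - 1, so b_l maps the degree n part into L(0). *)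
apply: contrapT => nz; apply: h0; exists (mact L l b (y0 x)); split=> //.
rewrite /Mpart (mgr_mact _ _ hb (y0_Mpart x)).
by have -> : s + n%:Z - l - 1 == 0%N%:Z by lia.
Qed.

Lemma Lmod_AnIso : AnIso (Mpart L n) (oact L) (fun _ : U => True) rho.
Proof.
exists (fun y : L => lval y n%:Z (vac V)); split=> //.
- move=> y z /Mpart_y0[u ->] /Mpart_y0[w ->]; rewrite !y0_vac => ->; reflexivity.
- by move=> x _; exists (y0 x); [exact: y0_Mpart|exact: y0_vac].
- by move=> a y /Mpart_y0[u ->]; rewrite oact_y0_vac y0_vac.
Qed.
End InducedModuleIrreducible.

Theorem theorem4p1 (F : closedFieldType) (hF2 : (2%:R : F) != 0)
    (V : VOA F) (n : nat) :
  (* M |-> M(n) sends irreducible modules with M(0), M(n) nonzero to simple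
     A_n(V)-modules not factoring through A_{n-1}(V) *)
  (forall M : VMod V, VIrred M -> Mnonzero M 0 -> Mnonzero M n ->
     [/\ AnModOn n (Mpart M n) (oact M),
         AnSimple (Mpart M n) (oact M)
       & ~ AnFactorsPrev n (Mpart M n) (oact M)])
  /\
  (* it respects isomorphism classes *)
  (forall M1 M2 : VMod V, VIso M1 M2 ->
     AnIso (Mpart M1 n) (oact M1) (Mpart M2 n) (oact M2))
  /\
  (* injectivity on isomorphism classes *)
  (forall M1 M2 : VMod V,
     VIrred M1 -> Mnonzero M1 0 -> Mnonzero M1 n ->
     VIrred M2 -> Mnonzero M2 0 -> Mnonzero M2 n ->
     AnIso (Mpart M1 n) (oact M1) (Mpart M2 n) (oact M2) -> VIso M1 M2)
  /\
  (* surjectivity: every such U is L_n(U)(n) for an irreducible L_n(U)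
     with L_n(U)(0) nonzero *)
  (forall (U : lmodType F) (rho : vs V -> U -> U),
     AnModOn n (fun _ : U => True) rho ->
     AnSimple (fun _ : U => True) rho ->
     ~ AnFactorsPrev n (fun _ : U => True) rho ->
     exists L : VMod V,
       [/\ VIrred L, Mnonzero L 0, Mnonzero L n
         & AnIso (Mpart L n) (oact L) (fun _ : U => True) rho]).
Proof.
split; [|split; [|split]].
- move=> M irr nz0 nzn; split; first exact: Mpart_AnModOn.
    exact: irred_AnSimple.
  exact: irred_not_factor.
- by move=> M1 M2; exact: VIso_AnIso.
- move=> M1 M2 irr1 _ nz1 irr2 _ _ [f [fl fM fi fs fa]].
  exact: (graph_VIso fl fM fi fa irr1 irr2 nz1).
move=> U rho An simple nofactor; exists (Lmod An); split.
- exact: Lmod_irred.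
- exact: Lmod_nonzero0.
- exact: Lmod_nonzero.
- exact: Lmod_AnIso.
Qed.
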